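(* Let $(\gamma,v_1,v_2):I\to H^3\times\Delta_5$ be a hyperbolic framed curve with $a^2+b^2\neq0$, $A^2>M^2$ and $MA'-M'A\equiv0$ on $I$, and let $p_0=(t_0,\theta_0)$ be a singular point of the hyperbolic focal surface $\mathcal{F}^h$. (a) If $N(t_0)\neq0$: (1) $p_0$ is a cuspidal edge iff $M(t_0)\neq0$; (2) $p_0$ is never a swallowtail or a cuspidal cross cap. (b) If $N(t_0)=0$: (1) $p_0$ is a cuspidal edge iff $\theta_0\neq0$ and $(AN\sqrt{A^2-M^2})'(t_0)\neq0$; (2) $p_0$ is never a cuspidal beaks, cuspidal lips, swallowtail or cuspidal cross cap.
   Context: $\mathbb{R}^4_1$ denotes $\mathbb{R}^4$ with $\langle x,y\rangle=-x_0y_0+x_1y_1+x_2y_2+x_3y_3$; $H^3=\{x:\langle x,x\rangle=-1\}$, $S^3_1=\{x:\langle x,x\rangle=1\}$. For $x^1,x^2,x^3\in\mathbb{R}^4_1$, $x^1\wedge x^2\wedge x^3$ is the vector given by the formal determinant with first row $(-e_0,e_1,e_2,e_3)$ and the components of $x^1,x^2,x^3$ as remaining rows. Let $\Delta_5=\{(v_1,v_2)\in S^3_1\times S^3_1:\langle v_1,v_2\rangle=0\}$. A hyperbolic framed curve is a smooth map $(\gamma,v_1,v_2):I\to H^3\times\Delta_5$ with $\langle\gamma,v_i\rangle=\langle\gamma',v_i\rangle=0$. Put $\mu=\gamma\wedge v_1\wedge v_2$; then $\gamma'=m\mu$, $v_1'=nv_2+a\mu$, $v_2'=-nv_1+b\mu$,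 $\mu'=m\gamma-av_1-bv_2$ with $m=\langle\gamma',\mu\rangle$, $n=\langle v_1',v_2\rangle$, $a=\langle v_1',\mu\rangle$, $b=\langle v_2',\mu\rangle$. Put $f=ab'-a'b+n(a^2+b^2)$. With $a^2+b^2\neq0$, the Frenet type frame is $n_1=(av_1+bv_2)/\sqrt{a^2+b^2}$, $n_2=(-bv_1+av_2)/\sqrt{a^2+b^2}$, giving $\gamma'=M\mu$, $n_1'=Nn_2+A\mu$, $n_2'=-Nn_1$, $\mu'=M\gamma-An_1$ with $M=m$, $N=f/(a^2+b^2)$, $A=\sqrt{a^2+b^2}$. Hyperbolic focal surface: $\mathcal{F}^h(t,\theta)=\frac{\cosh\theta}{\sqrt{A^2-M^2}}(A\gamma-Mn_1)+\sinh\theta\,n_2$, $(t,\theta)\in I\times\mathbb{R}$, with singular set $\{\lambda^h=0\}$, $\lambda^h=\frac{\cosh\theta(MA'-AM')-\sinh\theta\,AN\sqrt{A^2-M^2}}{A^2-M^2}$ (so under $MA'-M'A\equiv0$ the points $(t,0)$ are singular). Singularity types up to $\mathcal{A}$-equivalence: cuspidal edge $(u,v)\mapsto(u,v^2,v^3)$; swallowtail $(u,v)\mapsto(u,4v^3+2uv,3v^4+uv^2)$; cuspidal beaks $(u,v)\mapsto(u,2v^3-u^2v,3v^4-u^2v^2)$; cuspidal lips $(u,v)\mapsto(u,2v^3+u^2v,3v^4+u^2v^2)$; cuspidal cross cap $(u,v)\mapsto(u,v^2,uv^3)$. *)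

(* Defs.v *)
From HB Require Import structures.
From mathcomp Require Import all_boot all_order all_algebra.
From mathcomp Require Import all_classical all_reals all_analysis.
Set Implicit Arguments. Unset Strict Implicit. Unset Printing Implicit Defensive.
Import Order.TTheory GRing.Theory Num.Theory.
Import numFieldNormedType.Exports.
Local Open Scope classical_set_scope.
Local Open Scope ring_scope.

Section Defs.
Variable R : realType.

Fixpoint iterD (U V : normedModType R) (vs : seq U) (f : U -> V) : U -> V :=
  match vs with
  | [::] => f
  | v :: vs' => fun x => 'D_v (iterD vs' f) x
  end.

Definition smooth_on (U V : normedModType R) (O : set U) (f : U -> V) :=
  open O /\
  forall (vs : seq U) (x : U), O x ->
    (forall v : U, derivable (iterD vs f) x v) /\ {for x, continuous (iterD vs f)}.

Definition diffeo_germ (U : normedModType R) (phi : U -> U) (p q : U) :=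
  phi p = q /\
  exists (O1 O2 : set U) (psi : U -> U),
    [/\ O1 p /\ O2 q, smooth_on O1 phi, smooth_on O2 psi,
        (forall x, O1 x -> O2 (phi x) /\ psi (phi x) = x) &
        (forall y, O2 y -> O1 (psi y) /\ phi (psi y) = y)].

Definition A_equiv (U V : normedModType R) (f : U -> V) (p : U) (g : U -> V) (q : U) :=
  exists (phi : U -> U) (Phi : V -> V),
    [/\ diffeo_germ phi p q, diffeo_germ Phi (f p) (g q) &
        \forall x \near p, Phi (f x) = g (phi x)].

Definition cr n (x : 'rV[R]_n.+1) (i : nat) : R := x ord0 (inord i).
Definition mkR2 (u v : R) : 'rV[R]_2 := \row_(j < 2) (if j == ord0 then u else v).
Definition mkR3 (x y z : R) : 'rV[R]_3 := \row_(j < 3) [:: x; y; z]`_j.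
Definition mkR4 (x0 x1 x2 x3 : R) : 'rV[R]_4 := \row_(j < 4) [:: x0; x1; x2; x3]`_j.

Definition e2_1 : 'rV[R]_2 := mkR2 1 0.
Definition e2_2 : 'rV[R]_2 := mkR2 0 1.

(* Chart of H^3: forget the x_0 coordinate; restricted to each sheet of H^3
   this is a diffeomorphism onto R^3 *)
Definition chartH (x : 'rV[R]_4) : 'rV[R]_3 := mkR3 (cr x 1) (cr x 2) (cr x 3).

Definition u_ (p : 'rV[R]_2) := cr p 0.
Definition v_ (p : 'rV[R]_2) := cr p 1.
Definition cuspidal_edge_model (p : 'rV[R]_2) : 'rV[R]_3 :=
  mkR3 (u_ p) (v_ p ^+ 2) (v_ p ^+ 3).
Definition swallowtail_model (p : 'rV[R]_2) : 'rV[R]_3 :=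
  mkR3 (u_ p) (4 * v_ p ^+ 3 + 2 * u_ p * v_ p) (3 * v_ p ^+ 4 + u_ p * v_ p ^+ 2).
Definition cuspidal_beaks_model (p : 'rV[R]_2) : 'rV[R]_3 :=
  mkR3 (u_ p) (2 * v_ p ^+ 3 - u_ p ^+ 2 * v_ p) (3 * v_ p ^+ 4 - u_ p ^+ 2 * v_ p ^+ 2).
Definition cuspidal_lips_model (p : 'rV[R]_2) : 'rV[R]_3 :=
  mkR3 (u_ p) (2 * v_ p ^+ 3 + u_ p ^+ 2 * v_ p) (3 * v_ p ^+ 4 + u_ p ^+ 2 * v_ p ^+ 2).
Definition cuspidal_crosscap_model (p : 'rV[R]_2) : 'rV[R]_3 :=
  mkR3 (u_ p) (v_ p ^+ 2) (u_ p * v_ p ^+ 3).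

Definition germ_type (model : 'rV[R]_2 -> 'rV[R]_3) (F : 'rV[R]_2 -> 'rV[R]_4)
  (p : 'rV[R]_2) := A_equiv (chartH \o F) p model 0.

Definition singular_point (F : 'rV[R]_2 -> 'rV[R]_4) (p : 'rV[R]_2) :=
  exists c1 c2 : R, (c1 != 0 \/ c2 != 0) /\
    c1 *: 'D_e2_1 F p + c2 *: 'D_e2_2 F p = 0.

Definition lor (x y : 'rV[R]_4) : R :=
  - cr x 0 * cr y 0 + cr x 1 * cr y 1 + cr x 2 * cr y 2 + cr x 3 * cr y 3.

Definition det3 (a11 a12 a13 a21 a22 a23 a31 a32 a33 : R) : R :=
  a11 * (a22 * a33 - a23 * a32) - a12 * (a21 * a33 - a23 * a31)
  + a13 * (a21 * a32 - a22 * a31).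

(* formal determinant with first row (-e0, e1, e2, e3) *)
Definition wedge (x y z : 'rV[R]_4) : 'rV[R]_4 :=
  let m i j k := det3 (cr x i) (cr x j) (cr x k) (cr y i) (cr y j) (cr y k)
                      (cr z i) (cr z j) (cr z k) in
  mkR4 (- m 1%N 2%N 3%N) (- m 0%N 2%N 3%N) (m 0%N 1%N 3%N) (- m 0%N 1%N 2%N).

Definition coshR (x : R) : R := (expR x + expR (- x)) / 2.
Definition sinhR (x : R) : R := (expR x - expR (- x)) / 2.

Definition hyperbolic_framed_curve (I : set R) (g v1 v2 : R -> 'rV[R]_4) :=
  [/\ smooth_on I g, smooth_on I v1, smooth_on I v2 &
    forall t, I t ->
      [/\ lor (g t) (g t) = -1, lor (v1 t) (v1 t) = 1, lor (v2 t) (v2 t) = 1,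
          lor (v1 t) (v2 t) = 0 &
          [/\ lor (g t) (v1 t) = 0, lor (g t) (v2 t) = 0,
              lor (derive1 g t) (v1 t) = 0 & lor (derive1 g t) (v2 t) = 0]]].

Section Curve.
Variables g v1 v2 : R -> 'rV[R]_4.

Definition mu t := wedge (g t) (v1 t) (v2 t).
Definition m_ t := lor (derive1 g t) (mu t).
Definition n_ t := lor (derive1 v1 t) (v2 t).
Definition a_ t := lor (derive1 v1 t) (mu t).
Definition b_ t := lor (derive1 v2 t) (mu t).
Definition f_ t := a_ t * derive1 b_ t - derive1 a_ t * b_ t
                   + n_ t * (a_ t ^+ 2 + b_ t ^+ 2).
Definition bigM t := m_ t.
Definition bigN t := f_ t / (a_ t ^+ 2 + b_ t ^+ 2).
Definition bigA t := Num.sqrt (a_ t ^+ 2 + b_ t ^+ 2).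
Definition n1 t := (bigA t)^-1 *: (a_ t *: v1 t + b_ t *: v2 t).
Definition n2 t := (bigA t)^-1 *: (- b_ t *: v1 t + a_ t *: v2 t).

Definition focal_h (p : 'rV[R]_2) : 'rV[R]_4 :=
  let t := cr p 0 in let th := cr p 1 in
  (coshR th / Num.sqrt (bigA t ^+ 2 - bigM t ^+ 2)) *: (bigA t *: g t - bigM t *: n1 t)
  + sinhR th *: n2 t.

Definition ANsq t := bigA t * bigN t * Num.sqrt (bigA t ^+ 2 - bigM t ^+ 2).
End Curve.
End Defs.

(* Main.v *)
(* Since M A' = M' A, the ratio M / A is a constant tanh, and rotating (gamma, n_1) by this constant hyperbolic angle gives an orthonormal frame (E, n, P, mu) with F(t, th) = cosh th E(t) + sinh th n(t), E' = - c N n, n' = - N (c E + s P), where c vanishes exactly when M does. Hence the singular set is {N(t) sinh th = 0}, and the null direction is explicit: d/dt + c N d/dth.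

   If N(t0) <> 0 and c <> 0, or if N(t0) = 0, N'(t0) <> 0 and th0 <> 0, coordinates (u, v) adapted to the singular curve and the null direction make the third order jet in v nondegenerate. The coordinate functions have vanishing v-derivative on v = 0, so by Whitney's theorem on even functions they are of the form g(u, v^2) + v^3 h(u, v^2): the surface is the image of (u, v^2, v^3) under a local diffeomorphism.

   In all other cases equivalence with a model is contradicted by a coarse invariant: a fibre which is a curve (c = 0: the curve E is constant), local injectivity (swallowtail and cross cap against the edge), or the kernel of the differential along a curve of singular points. *)
Require Import Defs.
From HB Require Import structures.
From mathcomp Require Import all_boot all_order all_algebra.
From mathcomp Require Import all_classical all_reals all_analysis.
From mathcomp Require Import ring lra.
Import Order.TTheory GRing.Theory Num.Theory.
Import numFieldNormedType.Exports.
Local Open Scope classical_set_scope.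
Local Open Scope ring_scope.
Set Implicit Arguments. Unset Strict Implicit. Unset Printing Implicit Defensive.

(** * Functions of class C^k *)

Section Smooth.
Variable R : realType.

(** Whitney's theorem is the heaviest step. For f even in v, the function f(u, sqrt s) is smooth up
    to s = 0 but exists only for s >= 0, whereas the diffeomorphism of the target must be smooth on
    a full neighbourhood. Seeley's series of reflected dilations supplies the missing half, jointly
    smoothly in u. The series samples f at arbitrarily large arguments and so asks for global
    bounds: the germ is first precomposed with e sin in each variable, a local diffeomorphism at 0
    that makes it periodic.

    The constant angle comes from (M / A)' A^2 = M' A - M A' = 0. Rotating by it removes the [mu]
    component of E', so that F_t lies in the span of F_th and P and has N as a factor; kernel and
    singular set can then be read off. The vector [mu] enters only through P', hence at third order,
    exactly where a cuspidal edge requires a new direction.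

    The edge is recognised by constructing the two diffeomorphism germs, since equivalence is
    literal here; the negative statements only retain from an equivalence what it does to kernels,
    fibres and orders of vanishing. *)

Fixpoint Ck (U V : normedModType R) (k : nat) (O : set U) (f : U -> V) : Prop :=
  match k with
  | 0 => forall x, O x -> {for x, continuous f}
  | k'.+1 => (forall x, O x -> differentiable f x) /\
             forall v, Ck k' O ('D_v f)
  end.

Definition Sm (U V : normedModType R) (O : set U) (f : U -> V) :=
  forall k, Ck k O f.

Section Gen.
Variables U V : normedModType R.
Implicit Types (O : set U).

Lemma Ck_continuous k O (f : U -> V) x : Ck k O f -> O x -> {for x, continuous f}.
Proof.
case: k => [|k] /=; first by move=> h /h.
by move=> [h _] /h /differentiable_continuous.
Qed.

Lemma CkS k O (f : U -> V) : Ck k.+1 O f -> Ck k O f.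
Proof.
elim: k f => [|k IH] f.
  by move=> fC x Ox; exact: (Ck_continuous fC Ox).
by move=> [df dvf]; split => // v; apply: IH; apply: dvf.
Qed.

Lemma Ck_subset k O O' (f : U -> V) : O' `<=` O -> Ck k O f -> Ck k O' f.
Proof.
move=> sO; elim: k f => [|k IH] f /=; first by move=> h x /sO /h.
by move=> [df dvf]; split=> [x /sO /df //|v]; apply: IH; apply: dvf.
Qed.

Lemma near_open O (P : U -> Prop) x : open O -> O x ->
  (forall y, O y -> P y) -> \forall y \near x, P y.
Proof. by move=> oO Ox h; apply: filterS h _; apply: open_nbhs_nbhs. Qed.

Lemma derive_eq_on O (f g : U -> V) x v : open O -> O x ->
  (forall y, O y -> f y = g y) -> 'D_v f x = 'D_v g x.
Proof.
move=> oO Ox h; have [->|v0] := eqVneq v 0; first by rewrite !derive0.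
by apply: near_eq_derive => //; apply: near_open oO Ox h.
Qed.

Lemma derivable_eq_on O (f g : U -> V) x v : open O -> O x ->
  (forall y, O y -> f y = g y) -> derivable f x v -> derivable g x v.
Proof.
move=> oO Ox h; have [->|v0] := eqVneq v 0; first by move=> _; apply: derivable0.
by apply: near_eq_derivable => //; apply: near_open oO Ox h.
Qed.

Lemma near_eq_differentiable (f g : U -> V) x :
  (\forall y \near x, f y = g y) -> differentiable f x -> differentiable g x.
Proof.
move=> fg df; have fgx := nbhs_singleton fg.
have h : g \o shift x = cst (g x) + 'd f x +o_ 0 id.
  apply/eqaddoE; have /diff_locally/eqaddoP := df => /(_ _ _) fo.
  apply/eqaddoP => e e0; have fe := fo e e0.
  have fg0 : \forall y \near 0, f (shift x y) = g (shift x y).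
    by move: fg; rewrite (near_shift 0 x) subr0.
  by apply: filterS2 fg0 fe => y /=; rewrite !fctE /= => <-; rewrite -fgx.
have dfc := diff_continuous df.
by apply/diff_locallyP; rewrite (diff_unique dfc h); split.
Qed.

Lemma Ck_eq k O (f g : U -> V) : open O -> (forall x, O x -> f x = g x) ->
  Ck k O f -> Ck k O g.
Proof.
move=> oO; elim: k f g => [|k IH] f g fg /=.
  move=> fC x Ox; have := fC _ Ox.
  rewrite /prop_for /continuous_at -(fg _ Ox) => h.
  apply: cvg_trans h; apply: near_eq_cvg.
  by apply: near_open oO Ox _ => y /fg.
move=> [df dvf]; split=> [x Ox|v].
  by apply: near_eq_differentiable (df _ Ox); apply: near_open oO Ox _.
by apply: IH (dvf v) => x Ox; apply: derive_eq_on oO Ox fg.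
Qed.

Lemma Ck_cst k O (c : V) : Ck k O (cst c : U -> V).
Proof.
elim: k c => [|k IH] c /=; first by move=> x _; exact: cst_continuous.
split=> [x _|v]; first exact: differentiable_cst.
have -> : 'D_v (cst c : U -> V) = cst 0 by apply/funext => x; rewrite derive_cst.
exact: IH.
Qed.

Lemma Ck_linear k O (f : {linear U -> V}) : continuous f -> Ck k O f.
Proof.
move=> fc; case: k => [|k] /=; first by move=> x _; exact: fc.
split=> [x _|v]; first exact: linear_differentiable.
have -> : 'D_v f = cst (f v).
  by apply/funext => x; rewrite deriveE ?diff_lin //; exact: linear_differentiable.
exact: Ck_cst.
Qed.

Lemma CkD k O (f g : U -> V) : open O -> Ck k O f -> Ck k O g ->
  Ck k O (f + g).
Proof.
move=> oO; elim: k f g => [|k IH] f g /=.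
  by move=> fC gC x Ox; apply: continuousD; [exact: fC|exact: gC].
move=> [df dvf] [dg dvg]; split=> [x Ox|v].
  by apply: differentiableD; [exact: df|exact: dg].
apply: (@Ck_eq _ _ ('D_v f + 'D_v g)) => //; last exact: IH.
by move=> x Ox; rewrite deriveD //; apply: diff_derivable; [exact: df|exact: dg].
Qed.

Lemma CkZ k O (c : R) (f : U -> V) : open O -> Ck k O f -> Ck k O (c *: f).
Proof.
move=> oO; elim: k f => [|k IH] f /=.
  by move=> fC x Ox; apply: cvgZl_tmp; exact: fC.
move=> [df dvf]; split=> [x Ox|v].
  by apply: differentiableZ; exact: df.
apply: (@Ck_eq _ _ (c *: 'D_v f)) => //; last exact: IH.
by move=> x Ox; rewrite deriveZ //; apply: diff_derivable; exact: df.
Qed.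

Lemma Ck_sum k O (I : Type) (r : seq I) (P : pred I) (f : I -> U -> V) : open O ->
  (forall i, P i -> Ck k O (f i)) -> Ck k O (fun x => \sum_(i <- r | P i) f i x).
Proof.
move=> oO h; elim: r => [|i r IH].
  by apply: Ck_eq (Ck_cst k O 0) => // x _; rewrite big_nil.
case: (boolP (P i)) => Pi.
  apply: (@Ck_eq _ _ (f i + (fun x => \sum_(i <- r | P i) f i x))) => //.
    by move=> x _; rewrite big_cons Pi.
  by apply: CkD => //; apply: h.
by apply: Ck_eq IH => // x _; rewrite big_cons (negbTE Pi).
Qed.

End Gen.

Lemma CkM (U : normedModType R) k (O : set U) (f g : U -> R) : open O -> Ck k O f -> Ck k O g ->
  Ck k O (f * g).
Proof.
move=> oO; elim: k f g => [|k IH] f g.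
  move=> /= fC gC x Ox; apply: cvgM; [exact: fC|exact: gC].
move=> Cf Cg; have [df dvf] := Cf; have [dg dvg] := Cg; split=> [x Ox|v].
  exact: (differentiableM (df _ Ox) (dg _ Ox)).
apply: (@Ck_eq _ _ _ _ (f * 'D_v g + g * 'D_v f)) => //.
  move=> x Ox; rewrite [RHS]deriveM //.
  - exact (diff_derivable (V := U) (f := f) (v := v) (df _ Ox)).
  - exact (diff_derivable (V := U) (f := g) (v := v) (dg _ Ox)).
exact (CkD oO (IH _ _ (CkS Cf) (dvg v)) (IH _ _ (CkS Cg) (dvf v))).
Qed.

Section Coord.
Variables U W : normedModType R.
(** An abstract finite coordinate system, so that the chain rule is proved once and serves both row
    vectors and [R] itself. *)
Variables (n : nat) (b : 'I_n -> W) (c : 'I_n -> {linear W -> R}).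
Hypothesis cc : forall i, continuous (c i).
Hypothesis decomp : forall w, w = \sum_i c i w *: b i.

Lemma derive_lin_comp (V1 V2 : normedModType R) (l : {linear V1 -> V2}) (f : U -> V1) x v :
  continuous l -> differentiable f x -> 'D_v (l \o f) x = l ('D_v f x).
Proof.
move=> lc df; have dl : differentiable l (f x) by exact: linear_differentiable.
rewrite deriveE; last exact: differentiable_comp.
by rewrite diff_comp // diff_lin //= deriveE.
Qed.

Lemma Ck_lin_comp k (O : set U) (V1 V2 : normedModType R) (l : {linear V1 -> V2}) (f : U -> V1) :
  open O -> continuous l -> Ck k O f -> Ck k O (l \o f).
Proof.
move=> oO lc; elim: k f => [|k IH] f /=.
  by move=> fC x Ox; apply: continuous_comp (fC x Ox) (lc _).
move=> [df dvf]; split=> [x Ox|v].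
  by apply: differentiable_comp; [exact: df|exact: linear_differentiable].
apply: Ck_eq (IH _ (dvf v)) => // x Ox /=.
by rewrite derive_lin_comp //; exact: df.
Qed.

Lemma Ck_coordP_gen k (O : set U) (f : U -> W) : open O ->
  Ck k O f <-> forall i, Ck k O (c i \o f).
Proof.
move=> oO; split=> [Cf i|]; first exact: Ck_lin_comp.
have fE (f' : U -> W) : f' = \sum_i (fun x => c i (f' x) *: b i).
  by apply/funext => x; rewrite fct_sumE; exact: decomp.
elim: k f => [|k IH] f.
  move=> fC; have := @Ck_sum _ _ 0 O _ (index_enum 'I_n) xpredT
    (fun i (x : U) => c i (f x) *: b i) oO.
  move=> H; have {}H : Ck 0 O (fun x => \sum_i c i (f x) *: b i).
    by apply: H => i _ x Ox; apply: cvgZr_tmp; exact: (fC i).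
  by apply: Ck_eq H => // x _; rewrite -decomp.
move=> fC.
have df x : O x -> differentiable f x.
  move=> Ox; rewrite (fE f); apply: differentiable_sum => i.
  by apply: differentiableZl; exact: (fC i).1.
split=> // v; apply: IH => i.
apply: Ck_eq ((fC i).2 v) => // x Ox /=.
by rewrite derive_lin_comp //; exact: df.
Qed.

(** Induction through D_v (h o f) = sum_i c_i (D_v f) * (D_(b_i) h o f): in coordinates the chain
    rule is a sum of products of scalar functions of class C^k, to which [CkM] applies. *)
Lemma Ck_comp_gen k (O : set U) (O' : set W) (f : U -> W) (h : W -> R) :
  open O -> (forall x, O x -> O' (f x)) ->
  Ck k O f -> Ck k O' h -> Ck k O (h \o f).
Proof.
move=> oO fO; elim: k h => [|k IH] h.
  by move=> /= fC hC x Ox; apply: continuous_comp (fC _ Ox) (hC _ (fO _ Ox)).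
move=> Cf [dh dvh]; have [df dvf] := Cf; split=> [x Ox|v].
  by apply: differentiable_comp; [exact: df|apply: dh; exact: fO].
apply: (@Ck_eq _ _ _ _ (fun x => \sum_i ((c i \o 'D_v f) * ('D_(b i) h \o f)) x)) => //.
  move=> x Ox /=; have dfx := df _ Ox; have dhx := dh _ (fO _ Ox).
  have dc := differentiable_comp dfx dhx.
  rewrite (deriveE _ dc) (diff_comp dfx dhx) /= -(deriveE _ dfx).
  rewrite [in RHS](decomp ('D_v f x)) linear_sum; apply: eq_bigr => i _.
  by rewrite linearZ /= -(deriveE _ dhx). 
apply: Ck_sum => // i _; apply: CkM => //.
  exact (Ck_lin_comp oO (cc (i:=i)) (dvf v)).
exact (IH _ (CkS Cf) (dvh (b i))).
Qed.

End Coord.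
End Smooth.

(** * Row vectors, mean value theorem, differentiability from partial derivatives *)

Section SmoothRV.
Variable R : realType.

Definition coordm n (i : 'I_n) (x : 'rV[R]_n) : R := x 0 i.
Fact coordm_linear n (i : 'I_n) : linear (@coordm n i).
Proof. by move=> a x y; rewrite /coordm !mxE. Qed.
HB.instance Definition _ n (i : 'I_n) :=
  GRing.isLinear.Build R 'rV[R]_n R *:%R (@coordm n i) (@coordm_linear n i).

Lemma coordm_continuous n (i : 'I_n.+1) : continuous (coordm i).
Proof. exact: coord_continuous. Qed.

Lemma coordm_decomp n (w : 'rV[R]_n) : w = \sum_i coordm i w *: delta_mx 0 i.
Proof. exact: row_sum_delta. Qed.

Lemma coord_le_norm n (x : 'rV[R]_n.+1) i : `|x 0 i| <= `|x|.
Proof.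
rewrite [leRHS]/Num.Def.normr /= mx_normrE.
exact: (le_bigmax _ (fun j : 'I_1 * 'I_n.+1 => `|x j.1 j.2|) (0, i)).
Qed.

Lemma norm_le_coord n (x : 'rV[R]_n.+1) e : 0 <= e -> (forall i, `|x 0 i| <= e) -> `|x| <= e.
Proof.
move=> e0 h; rewrite [leLHS]/Num.Def.normr /= mx_normrE.
by apply: bigmax_le => // -[i j] _ /=; rewrite ord1.
Qed.

Lemma Ck_coordP (U : normedModType R) n k (O : set U) (f : U -> 'rV[R]_n.+1) : open O ->
  Ck k O f <-> forall i, Ck k O (fun x => f x 0 i).
Proof. exact: (Ck_coordP_gen (@coordm_continuous n) (@coordm_decomp n.+1)). Qed.

Lemma Ck_comp_rV1 (U : normedModType R) n k (O : set U) O' (f : U -> 'rV[R]_n.+1) (h : 'rV[R]_n.+1 -> R) :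
  open O -> (forall x, O x -> O' (f x)) -> Ck k O f -> Ck k O' h -> Ck k O (h \o f).
Proof. exact: (Ck_comp_gen (@coordm_continuous n) (@coordm_decomp n.+1)). Qed.

Lemma Ck_comp_rV (U : normedModType R) n m k (O : set U) O' (f : U -> 'rV[R]_n.+1)
   (h : 'rV[R]_n.+1 -> 'rV[R]_m.+1) : open O -> open O' ->
  (forall x, O x -> O' (f x)) -> Ck k O f -> Ck k O' h -> Ck k O (h \o f).
Proof.
move=> oO oO' fO Cf /(Ck_coordP _ _ oO') Ch; apply/(Ck_coordP _ _ oO) => i.
exact: (Ck_comp_rV1 oO fO Cf (Ch i)).
Qed.

Lemma Ck_comp_R (U : normedModType R) k (O : set U) O' (f : U -> R) (h : R -> R) :
  open O -> (forall x, O x -> O' (f x)) -> Ck k O f -> Ck k O' h -> Ck k O (h \o f).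
Proof.
have H := @Ck_comp_gen R U R 1 (fun _ => 1) (fun _ => idfun).
apply: H => [_ x|w]; first exact: cvg_id.
by rewrite big_ord1 /= [RHS]mulr1.
Qed.

Let line_quot (U V : normedModType R) (f : U -> V) x v s :
  (fun h : R => h^-1 *: (((fun s : R => f (x + s *: v)) \o shift s) (h *: 1) - f (x + s *: v))) =
  (fun h : R => h^-1 *: ((f \o shift (x + s *: v)) (h *: v) - f (x + s *: v))).
Proof.
apply/funext => h /=.
by rewrite [h *: 1]mulr1 scalerDl addrCA addrA.
Qed.

Lemma derive_lineE (U V : normedModType R) (f : U -> V) x v s :
  'D_1 (fun s : R => f (x + s *: v)) s = 'D_v f (x + s *: v).
Proof. by rewrite /derive line_quot. Qed.

Lemma derivable_lineE (U V : normedModType R) (f : U -> V) x v s :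
  derivable f (x + s *: v) v -> derivable (fun s : R => f (x + s *: v)) s 1.
Proof. by rewrite /derivable line_quot. Qed.

Lemma MVT_line (U : normedModType R) (f : U -> R) x v (a : R) :
  (forall s : R, `|s| <= `|a| -> derivable f (x + s *: v) v) ->
  exists2 s : R, `|s| <= `|a| & f (x + a *: v) - f x = a * 'D_v f (x + s *: v).
Proof.
move=> df; pose g (s : R) := f (x + s *: v).
have dg (s : R) : `|s| <= `|a| -> is_derive s 1 g ('D_v f (x + s *: v)).
  move=> /df ds; apply: DeriveDef; last by rewrite derive_lineE.
  exact: derivable_lineE.
have g0 : g 0 = f x by rewrite /g scale0r addr0.
have gc (c d : R) : (forall s : R, s \in `[c, d] -> `|s| <= `|a|) -> {within `[c, d], continuous g}.
  by move=> cd; apply: derivable_within_continuous => s /cd /dg [].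
have [a0|a0] := leP 0 a.
  have ha (s : R) : s \in `[0, a] -> `|s| <= `|a|.
    by rewrite in_itv /= => /andP[s0 sa]; rewrite !ger0_norm.
  have [|c ca E] := @MVT_segment R g (fun s => 'D_v f (x + s *: v)) 0 a a0 _ (gc _ _ ha).
    by move=> s sa; apply: dg; apply: ha; exact: subset_itv_oo_cc.
  by exists c; [exact: ha|rewrite -/(g a) -g0 E subr0 mulrC].
have ha (s : R) : s \in `[a, 0] -> `|s| <= `|a|.
  by rewrite in_itv /= => /andP[s0 sa]; rewrite !ler0_norm ?lerN2 // ltW.
have [|c ca E] := @MVT_segment R g (fun s => 'D_v f (x + s *: v)) a 0 (ltW a0) _ (gc _ _ ha).
  by move=> s sa; apply: dg; apply: ha; exact: subset_itv_oo_cc.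
exists c; first exact: ha.
by rewrite -/(g a) -g0 -opprB E sub0r mulrN opprK mulrC.
Qed.

Lemma differentiable_of_approx (U V : normedModType R) (f : U -> V) x (l : {linear U -> V}) :
  continuous l ->
  (forall e, 0 < e -> \forall h \near 0, `|f (x + h) - f x - l h| <= e * `|h|) ->
  differentiable f x /\ 'd f x = l :> (U -> V).
Proof.
move=> lc fl.
have h : f \o shift x = cst (f x) + l +o_ 0 id.
  apply/eqaddoE; apply/eqaddoP => e e0; have fe := fl e e0.
  by apply: filterS fe => y /=; rewrite !fctE /= [y + x]addrC opprD addrA.
by have E := diff_unique lc h; split=> //; apply/diff_locallyP; rewrite E; split.
Qed.

Lemma diff_approx (U V : normedModType R) (f : U -> V) x : differentiable f x ->
  forall e, 0 < e -> \forall h \near 0, `|f (x + h) - f x - 'd f x h| <= e * `|h|.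
Proof.
move=> /diff_locally/eqaddoP fo e e0; have fe := fo e e0.
by apply: filterS fe => y /=; rewrite !fctE /= [y + x]addrC opprD addrA.
Qed.

Section PartialC1.
Variables (n : nat) (f : 'rV[R]_n.+1 -> R) (O : set 'rV[R]_n.+1) (x : 'rV[R]_n.+1).
Hypotheses (oO : open O) (Ox : O x).
Hypothesis df : forall y i, O y -> derivable f y (delta_mx 0 i).
Hypothesis dc : forall i, {for x, continuous ('D_(delta_mx 0 i) f)}.

Let step i (e : R) : 0 < e -> exists2 d, 0 < d & forall y a, `|y - x| < d -> `|a| < d ->
  `|f (y + a *: delta_mx 0 i) - f y - a * 'D_(delta_mx 0 i) f x| <= e * `|a|.
Proof.
move=> e0; have /cvgrPdist_le /(_ e e0) := @dc i.
have := open_nbhs_nbhs (conj oO Ox).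
move=> /nbhs_ballP[d1 /= d10 H1] /nbhs_ballP[d2 /= d20 H2].
have nd : `|delta_mx 0 i : 'rV[R]_n.+1| <= 1.
  by apply: norm_le_coord => // j; rewrite mxE; case: (_ && _); rewrite /= ?normr1 ?normr0 ?ler01.
(* Half of the radius for [y - x], half for the move along the axis. *)
pose d := Num.min d1 d2 / 2.
have d0 : 0 < d by rewrite divr_gt0 // lt_min d10.
exists d => // y a yd ad.
have yB s : `|s| <= `|a| -> `|x - (y + s *: delta_mx 0 i)| < Num.min d1 d2.
  move=> sa; rewrite opprD addrA (splitr (Num.min d1 d2)).
  apply: le_lt_trans (ler_normB _ _) _; apply: ltrD; first by rewrite distrC.
  rewrite normrZ; apply: le_lt_trans ad; rewrite -[leRHS]mulr1; exact: ler_pM.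
have [s sa ->] : exists2 s : R, `|s| <= `|a| & f (y + a *: delta_mx 0 i) - f y = a * 'D_(delta_mx 0 i) f (y + s *: delta_mx 0 i).
  apply: MVT_line => s /yB yb; apply: df; apply: H1.
  by rewrite -ball_normE /ball_ /=; apply: lt_le_trans yb _; rewrite ge_min lexx.
rewrite -mulrBr normrM mulrC ler_wpM2r // distrC; apply: H2.
by rewrite -ball_normE /ball_ /=; apply: lt_le_trans (yB _ sa) _; rewrite ge_min lexx orbT.
Qed.

(** A displacement is split into successive moves along the axes; each is a one-variable mean value
    estimate close to x, and the errors add up. *)
Let steps (s : seq 'I_n.+1) (e : R) : 0 < e -> exists2 d, 0 < d &
  forall y (a : 'I_n.+1 -> R), `|y - x| < d -> (forall i, `|a i| < d) ->
  `|f (y + \sum_(i <- s) a i *: delta_mx 0 i) - f y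
     - \sum_(i <- s) a i * 'D_(delta_mx 0 i) f x| <= e * \sum_(i <- s) `|a i|.
Proof.
move=> e0; elim: s => [|i s [d1 d10 H1]].
  by exists 1 => // y a _ _; rewrite !big_nil addr0 !subrr normr0 mulr0.
have [d2 d20 H2] := step i e0.
have nd : `|delta_mx 0 i : 'rV[R]_n.+1| <= 1.
  by apply: norm_le_coord => // j; rewrite mxE; case: (_ && _); rewrite /= ?normr1 ?normr0 ?ler01.
pose d := Num.min d1 d2 / 2.
have d0 : 0 < d by rewrite divr_gt0 // lt_min d10.
have dd : d <= Num.min d1 d2 by rewrite /d ler_pdivrMr // ler_peMr ?lt_min ?d10 // ?ler1n // ltW // lt_min d10.
exists d => // y a yd ad; rewrite !big_cons addrA.
set y' := y + a i *: _.
have := H2 y (a i) _ _; rewrite -/y' => /(_ _ _)/[dup] {}H2 _.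
have K2 := H2 (lt_le_trans (lt_le_trans yd dd) _) (lt_le_trans (lt_le_trans (ad i) dd) _).
have := K2 _ _; rewrite !ge_min !lexx !orbT => /(_ isT isT) {K2 H2}K2.
have K1 := H1 y' a _ _.
have {K1} := K1 _ _.
have y'd : `|y' - x| < d1.
  rewrite /y' addrAC; apply: le_lt_trans (ler_normD _ _) _.
  apply: (@lt_le_trans _ _ (Num.min d1 d2)); last by rewrite ge_min lexx.
  rewrite (splitr (Num.min _ _)) ltrD // normrZ; apply: le_lt_trans (ad i).
  by rewrite -[leRHS]mulr1 ler_pM.
have ad1 j : `|a j| < d1.
  by apply: lt_le_trans (ad j) (le_trans dd _); rewrite ge_min lexx.
move=> /(_ y'd ad1) K1; rewrite mulrDr.
have -> : f (y' + \sum_(j <- s) a j *: delta_mx 0 j) - f y -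
  (a i * 'D_(delta_mx 0 i) f x + \sum_(j <- s) a j * 'D_(delta_mx 0 j) f x) =
  (f y' - f y - a i * 'D_(delta_mx 0 i) f x) +
  (f (y' + \sum_(j <- s) a j *: delta_mx 0 j) - f y' - \sum_(j <- s) a j * 'D_(delta_mx 0 j) f x).
  by ring.
by apply: le_trans (ler_normD _ _) (lerD K2 K1).
Qed.

Definition dpart (h : 'rV[R]_n.+1) : R := \sum_i coordm i h * 'D_(delta_mx 0 i) f x.
Fact dpart_linear : linear dpart.
Proof.
move=> a u v; rewrite /dpart scaler_sumr -big_split /=; apply: eq_bigr => i _.
by rewrite linearP mulrDl /= [in RHS]/GRing.scale /= mulrA.
Qed.

Lemma differentiable_partials : differentiable f x.
Proof.
pose lM := GRing.isLinear.Build _ _ _ _ _ dpart_linear.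
pose l : {linear _ -> _} := HB.pack dpart lM.
apply: (proj1 (@differentiable_of_approx _ _ f x l _ _)).
  move=> h; rewrite /l /= /dpart.
  have : Ck 0 setT (fun h : 'rV[R]_n.+1 => \sum_i coordm i h * 'D_(delta_mx 0 i) f x).
    apply: Ck_sum; first exact: openT.
    move=> i _; exact (CkM openT (Ck_linear (f := coordm i) 0 setT (@coordm_continuous n i)) (Ck_cst 0 setT ('D_(delta_mx 0 i) f x))).
  by apply.
move=> e e0.
have [d d0 H] := @steps (index_enum 'I_n.+1) (e / n.+1%:R) (divr_gt0 e0 (ltr0Sn _ _)).
apply/nbhs_ballP; exists d => //= h; rewrite -ball_normE /ball_ /= sub0r normrN => hd.
have {H} := H x (fun i => coordm i h) _ _; rewrite subrr normr0 => /(_ d0 _).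
rewrite -coordm_decomp => H; apply: le_trans (H _) _.
  by move=> i; apply: le_lt_trans hd; exact: coord_le_norm.
rewrite -mulrA; apply: ler_wpM2l; first exact: ltW.
rewrite ler_pdivrMl ?ltr0Sn //.
apply: (@le_trans _ _ (\sum_(i < n.+1) `|h|)); last by rewrite sumr_const card_ord mulr_natl.
by apply: ler_sum => i _; exact: coord_le_norm.
Qed.
End PartialC1.

Lemma differentiable_rV (U : normedModType R) n (f : U -> 'rV[R]_n.+1) x :
  (forall i, differentiable (fun y => f y 0 i : R) x) -> differentiable f x.
Proof.
move=> df.
have -> : f = \sum_i (fun y => f y 0 i *: (delta_mx 0 i : 'rV[R]_n.+1)).
  by apply/funext => y; rewrite fct_sumE; exact: row_sum_delta.
by apply: differentiable_sum => i; apply: differentiableZl; exact: df.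
Qed.

Lemma derive_coord (U : normedModType R) n (f : U -> 'rV[R]_n.+1) x v i :
  derivable f x v -> ('D_v f x) 0 i = 'D_v (fun y => f y 0 i : R) x.
Proof. by move=> df; rewrite derive_mx // mxE. Qed.

Lemma derivable_coord (U : normedModType R) n (f : U -> 'rV[R]_n.+1) x v i :
  derivable f x v -> derivable (fun y => f y 0 i : R) x v.
Proof. by move=> /derivable_mxP /(_ 0 i). Qed.

Lemma Sm_smooth_on (U V : normedModType R) (O : set U) (f : U -> V) :
  open O -> Sm O f -> smooth_on O f.
Proof.
move=> oO Sf; split=> // vs x Ox.
have S : Sm O (Defs.iterD vs f).
  elim: vs => [|v vs IH]; first exact: Sf.
  by move=> k /=; have [_ /(_ v)] := IH k.+1.
split; last exact: (Ck_continuous (S 0)).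
by move=> v; apply: diff_derivable; exact: (S 1%N).1.
Qed.

Lemma smooth_on_derive (U V : normedModType R) (O : set U) (f : U -> V) v :
  smooth_on O f -> smooth_on O ('D_v f).
Proof.
move=> [oO h]; split=> // vs x Ox.
have E : Defs.iterD vs ('D_v f) = Defs.iterD (rcons vs v) f.
  by elim: vs => //= w vs ->.
by rewrite E; exact: h.
Qed.

Lemma smooth_on_Sm_gen (U V : normedModType R) (O : set U) (f : U -> V) :
  (forall (g : U -> V) x, smooth_on O g -> O x -> differentiable g x) ->
  smooth_on O f -> Sm O f.
Proof.
move=> H Sf k; elim: k f Sf => [|k IH] f Sf.
  by move=> x Ox; have [_ /(_ [::] x Ox)[]] := Sf.
split=> [x Ox|v]; first exact: H.
by apply: IH; exact: smooth_on_derive.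
Qed.

Lemma smooth_on_Sm_R (V : normedModType R) (O : set R) (f : R -> V) :
  smooth_on O f -> Sm O f.
Proof.
apply: smooth_on_Sm_gen => g x [_ h] Ox.
by apply/derivable1_diffP; have [] := h [::] x Ox.
Qed.

(** [smooth_on] only speaks of iterated directional derivatives and their continuity; Frechet
    differentiability, on which the chain rule rests, is recovered from the continuity of the
    partial derivatives. *)
Lemma smooth_on_Sm_rV n m (O : set 'rV[R]_n.+1) (f : 'rV[R]_n.+1 -> 'rV[R]_m.+1) :
  smooth_on O f -> Sm O f.
Proof.
apply: smooth_on_Sm_gen => g x [oO h] Ox.
apply: differentiable_rV => i.
apply: (differentiable_partials oO Ox).
  by move=> y j Oy; apply: derivable_coord; have [] := h [::] y Oy.
move=> j.
have C0 : Ck 0 O (fun y => ('D_(delta_mx 0 j) g y) 0 i).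
  move=> y Oy; have [_ c] := h [:: delta_mx 0 j] y Oy.
  exact: continuous_comp c (@coord_continuous _ _ _ _ _ _).
have C1 : Ck 0 O ('D_(delta_mx 0 j) (fun y => g y 0 i : R)).
  apply: Ck_eq C0 => // y Oy; rewrite derive_coord //.
  by have [] := h [::] y Oy.
exact: (C1 x Ox).
Qed.

End SmoothRV.

(** * Inverse function theorem *)

Section IFT.
Variable R : realType.

HB.instance Definition _ n := Complete.on 'rV[R]_n.+1.

Lemma CkV (U : normedModType R) k (O : set U) (f : U -> R) : open O ->
  (forall x, O x -> f x != 0) -> Ck k O f -> Ck k O (fun x => (f x)^-1).
Proof.
move=> oO f0; elim: k f f0 => [|k IH] f f0 Cf.
  by move=> x Ox; apply: cvgV; [exact: f0|exact: (Cf x Ox)].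
have [df dvf] := Cf; split=> [x Ox|v].
  exact (differentiableV (df x Ox) (f0 x Ox)).
have C1 := IH f f0 (CkS Cf).
have C2 := CkZ (-1) oO (CkM oO (CkM oO C1 C1) (dvf v)).
apply: Ck_eq C2 => // x Ox.
have dx : derivable f x v by exact (diff_derivable (V := U) (f := f) (v := v) (df _ Ox)).
rewrite [RHS](deriveV (f0 x Ox) dx).
by rewrite !fctE /= /GRing.scale /= mulN1r mulNr expr2 invfM.
Qed.

Lemma Ck_prod (U : normedModType R) k (O : set U) (I : Type) (r : seq I) (f : I -> U -> R) :
  open O -> (forall i, Ck k O (f i)) -> Ck k O (fun x => \prod_(i <- r) f i x).
Proof.
move=> oO h; elim: r => [|i r IH].
  by apply: Ck_eq (Ck_cst k O (1 : R)) => // x _; rewrite big_nil.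
apply: Ck_eq (CkM oO (h i) IH) => // x _.
by rewrite big_cons.
Qed.

Lemma Ck_det (U : normedModType R) k (O : set U) n (A : U -> 'M[R]_n) :
  open O -> (forall i j, Ck k O (fun x => A x i j)) -> Ck k O (fun x => \det (A x)).
Proof.
move=> oO h; apply: Ck_sum => // s _.
exact (CkZ ((-1) ^+ perm.odd_perm s) oO (Ck_prod (index_enum 'I_n) oO (fun i => h i (perm.fun_of_perm s i)))).
Qed.

(** Cramer's formula: the entries of the inverse are cofactors divided by the determinant. *)
Lemma Ck_invmx (U : normedModType R) k (O : set U) n (A : U -> 'M[R]_n) :
  open O -> (forall x, O x -> A x \in unitmx) ->
  (forall i j, Ck k O (fun x => A x i j)) ->
  forall i j, Ck k O (fun x => (invmx (A x)) i j).
Proof.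
move=> oO uA h i j.
have Cc : Ck k O (fun x => cofactor (A x) j i).
  apply: (CkZ ((-1) ^+ (j + i)) oO (_ : Ck k O (fun x => \det (row' j (col' i (A x)))))).
  apply: Ck_det => // a b; apply: Ck_eq (h (lift j a) (lift i b)) => // x _.
  by rewrite !mxE.
have Cd : Ck k O (fun x => (\det (A x))^-1).
  by apply: CkV => //; [move=> x /uA; rewrite unitmxE unitfE|exact: Ck_det].
apply: Ck_eq (CkM oO Cd Cc) => // x Ox.
by rewrite /invmx uA // !mxE.
Qed.

Lemma linear_rV_continuous n (V : normedModType R) (l : {linear 'rV[R]_n.+1 -> V}) : continuous l.
Proof.
have h : Ck 0 setT (fun x : 'rV[R]_n.+1 => \sum_i x 0 i *: l (delta_mx 0 i)).
  apply: Ck_sum => [|i _ x _]; first exact: openT.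
  have c := @coord_continuous R 1 n.+1 0 i x; exact (@cvgZr_tmp R V _ (nbhs x) (nbhs_filter x) _ _ (l (delta_mx 0 i)) c).
move=> x; have := h x I.
rewrite (_ : (fun _ => _) = l) //; apply/funext => y.
by rewrite [y in RHS]row_sum_delta linear_sum; apply: eq_bigr => i _; rewrite linearZ.
Qed.

(** Row vectors act on the left, so this is the transpose of the usual Jacobian matrix and D_v f is
    [v *m jac f x]. *)
Definition jac n m (f : 'rV[R]_n.+1 -> 'rV[R]_m.+1) x : 'M[R]_(n.+1, m.+1) :=
  \matrix_(i, j) ('D_(delta_mx 0 i) f x) 0 j.

Lemma derive_sumE (V : normedModType R) n (f : 'rV[R]_n.+1 -> V) x v : differentiable f x ->
  'D_v f x = \sum_i v 0 i *: 'D_(delta_mx 0 i) f x.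
Proof.
move=> df; rewrite deriveE // [v in LHS]row_sum_delta linear_sum.
by apply: eq_bigr => i _; rewrite linearZ /= deriveE.
Qed.

Lemma derive_jac n m (f : 'rV[R]_n.+1 -> 'rV[R]_m.+1) x v : differentiable f x ->
  'D_v f x = v *m jac f x.
Proof.
move=> df; rewrite derive_sumE // mulmx_sum_row; apply: eq_bigr => i _.
by congr (_ *: _); apply/rowP => j; rewrite !mxE.
Qed.

Lemma inj_unitmx n (A : 'M[R]_n.+1) : (forall v : 'rV_n.+1, v *m A = 0 -> v = 0) -> A \in unitmx.
Proof.
move=> h; rewrite -row_free_unit -kermx_eq0; apply/eqP/row_matrixP => i.
by rewrite row0; apply: h; rewrite -row_mul mulmx_ker row0.
Qed.



Lemma MVT_unit (U : normedModType R) (f : U -> R) x v :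
  (forall s : R, 0 <= s <= 1 -> derivable f (x + s *: v) v) ->
  exists2 s : R, 0 <= s <= 1 & f (x + v) - f x = 'D_v f (x + s *: v).
Proof.
move=> df; pose g (s : R) := f (x + s *: v).
have dg (s : R) : 0 <= s <= 1 -> is_derive s 1 g ('D_v f (x + s *: v)).
  move=> /df ds; apply: DeriveDef; last by rewrite derive_lineE.
  exact: derivable_lineE.
have gc : {within `[0, 1], continuous g}.
  by apply: derivable_within_continuous => s; rewrite in_itv /= => /dg [].
have [|c] := @MVT_segment R g (fun s => 'D_v f (x + s *: v)) 0 1 ler01 _ gc.
  by move=> s /subset_itv_oo_cc; rewrite in_itv /= => /dg.
rewrite in_itv /= => c01; rewrite /g scale0r scale1r addr0 subr0 mulr1 => E.
by exists c.
Qed.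

Section Local.
Variables (n : nat) (f : 'rV[R]_n.+1 -> 'rV[R]_n.+1) (O : set 'rV[R]_n.+1) (p : 'rV[R]_n.+1).
Hypotheses (oO : open O) (Op : O p) (Sf : Sm O f).
Hypothesis injp : forall v, 'D_v f p = 0 -> v = 0.

Let df x : O x -> differentiable f x. Proof. exact: (Sf 1%N).1. Qed.
Let J := jac f p.
Let Ju : J \in unitmx.
Proof. by apply: inj_unitmx => v; rewrite -derive_jac; [exact: injp|exact: df]. Qed.
Let B := invmx J.
(** The deviation of f from its linear part, normalised by the inverse Jacobian at p. Its
    differential vanishes at p, so it is 1/2-Lipschitz nearby, and f x = y exactly when x is a fixed
    point of the map sending x to [h x + y *m B]. *)
Let h : 'rV[R]_n.+1 -> 'rV[R]_n.+1 := idfun - (mulmxr B \o f).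

Let Sh : Sm O h.
Proof.
move=> k; have C1 : Ck k O (idfun : 'rV[R]_n.+1 -> 'rV[R]_n.+1).
  by apply: Ck_linear; exact: linear_rV_continuous.
have C2 := CkZ (-1) oO (Ck_lin_comp oO (@linear_rV_continuous n _ (mulmxr B)) (Sf k)).
apply: Ck_eq (CkD oO C1 C2) => // x _.
by rewrite /h !fctE scaleN1r.
Qed.

Let dh x : O x -> differentiable h x. Proof. exact: (Sh 1%N).1. Qed.

Let Dh x v : O x -> 'D_v h x = v - 'D_v f x *m B.
Proof.
move=> Ox; have lc := @linear_rV_continuous n _ (mulmxr B).
have dlf : differentiable (mulmxr B \o f) x.
  by apply: differentiable_comp; [exact: df|exact: linear_differentiable].
rewrite /h deriveB; [|exact: derivable_id|exact: diff_derivable].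
by rewrite derive_id derive_lin_comp //; exact: df.
Qed.

Let Dhp v : 'D_v h p = 0.
Proof. by rewrite Dh // derive_jac ?mulmxK ?subrr //; exact: df. Qed.

Let contr : exists2 r, 0 < r & forall x, `|x - p| < r ->
  O x /\ forall v, `|'D_v h x| <= 2^-1 * `|v|.
Proof.
(* The n + 1 partial derivatives together must contribute at most 1/2. *)
pose e : R := 2^-1 / n.+1%:R.
have e0 : 0 < e by rewrite divr_gt0 // invr_gt0.
have H i : \forall x \near p, `|'D_(delta_mx 0 i) h x| <= e.
  have C : {for p, continuous ('D_(delta_mx 0 i) h)} := (Sh 1%N).2 (delta_mx 0 i) p Op.
  have /cvgrPdist_le /(_ _ e0) C' := C.
  by apply: filterS C' => x; rewrite Dhp sub0r normrN.
have {}H : \forall x \near p, forall i, `|'D_(delta_mx 0 i) h x| <= e.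
  exact (@filter_forall _ _ _ (nbhs p) (nbhs_filter p) H).
have := open_nbhs_nbhs (conj oO Op).
move: H => /nbhs_ballP[d1 /= d10 H1] /nbhs_ballP[d2 /= d20 H2].
exists (Num.min d1 d2); first by rewrite lt_min d10.
move=> x; rewrite lt_min distrC => /andP[x1 x2].
have Ox : O x by apply: H2; rewrite -ball_normE.
split=> // v; have Hx := H1 x; rewrite -ball_normE in Hx; have {}Hx := Hx x1.
rewrite derive_sumE; last exact: dh.
apply: le_trans (ler_norm_sum _ _ _) _.
apply: (@le_trans _ _ (\sum_(i < n.+1) `|v| * e)).
  by apply: ler_sum => i _; rewrite normrZ ler_pM // coord_le_norm.
have n0 : n.+1%:R != 0 :> R by rewrite pnatr_eq0.
have E : (`|v| * e) *+ n.+1 = 2^-1 * `|v|.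
  rewrite -mulr_natl /e; set N := n.+1%:R in n0 *.
  by field; rewrite addrC natr1.
by rewrite sumr_const card_ord E.
Qed.

(** The norm of a row vector is its largest coordinate, so the mean value theorem can be applied
    coordinate by coordinate without loss in the constant. *)
Lemma lip_h r : (forall x, `|x - p| < r -> O x /\ forall v, `|'D_v h x| <= 2^-1 * `|v|) ->
  forall x y, `|x - p| < r -> `|y - p| < r -> `|h x - h y| <= 2^-1 * `|x - y|.
Proof.
move=> H x y xr yr; apply: norm_le_coord => [|j].
  by rewrite mulr_ge0 // invr_ge0.
have seg (s : R) : 0 <= s <= 1 -> `|(y + s *: (x - y)) - p| < r.
  move=> /andP[s0 s1].
  have -> : y + s *: (x - y) - p = (1 - s) *: (y - p) + s *: (x - p).
    rewrite scalerBl scale1r !scalerBr.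
    by rewrite addrAC; rewrite -!addrA; congr (_ + _); apply/rowP => k; rewrite !mxE; ring.
  apply: le_lt_trans (ler_normD _ _) _; rewrite !normrZ !ger0_norm ?subr_ge0 //.
  have [->|s1'] := eqVneq s 1; first by rewrite subrr mul0r add0r mul1r.
  have s1n : 0 < 1 - s by rewrite subr_gt0 lt_neqAle s1' s1.
  have h1 : (1 - s) * `|y - p| < (1 - s) * r by rewrite ltr_pM2l.
  have h2 : s * `|x - p| <= s * r by rewrite ler_wpM2l // ltW.
  by lra.
have dj z : O z -> differentiable (fun z => h z 0 j) z.
  move=> Oz; exact: (@differentiable_comp _ _ _ _ h (fun y : 'rV[R]_n.+1 => y 0 j : R) z (dh Oz)
    (@differentiable_coord R 1 n.+1 (h z) 0 j)).
have [|s s01 E] := @MVT_unit _ (fun z => h z 0 j) y (x - y).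
  by move=> s /seg /H[Oz _]; apply: diff_derivable; exact: dj.
have yx : y + (x - y) = x by rewrite addrC subrK.
rewrite yx in E.
have [Oz Hz] := H _ (seg _ s01).
rewrite [X in `|X|](_ : _ = h x 0 j - h y 0 j); last by rewrite !mxE.
rewrite E -derive_coord; last by apply: diff_derivable; exact: dh.
exact: le_trans (coord_le_norm _ _) (Hz _).
Qed.


Section Inverse.
Variable r : R.
Hypothesis r0 : 0 < r.
Hypothesis Hr : forall x, `|x - p| < r -> O x /\ forall v, `|'D_v h x| <= 2^-1 * `|v|.

Let r1 := r / 2.
Let r10 : 0 < r1. Proof. by rewrite divr_gt0. Qed.
Let r1r : r1 < r. Proof. by rewrite /r1 ltr_pdivrMr // ltr_pMr // ltr1n. Qed.

Let O2 : set 'rV[R]_n.+1 := [set y | `|(y - f p) *m B| < r1 / 2].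
Let O1 : set 'rV[R]_n.+1 := [set x | `|x - p| < r1 /\ O2 (f x)].

Let fB x y : (f x - f y) *m B = (x - y) - (h x - h y).
Proof.
rewrite /h !fctE /= mulmxBl; move: (f x *m B) (f y *m B) => a b.
by apply/rowP => j; rewrite !mxE; ring.
Qed.

(** [f] followed by [B] is the identity minus [h], and [h] absorbs at most half of [x - y]. *)
Lemma inv_expand x y : `|x - p| < r -> `|y - p| < r ->
  `|x - y| <= 2 * `|(f x - f y) *m B|.
Proof.
move=> xr yr; have L := lip_h Hr xr yr.
have : `|x - y| <= `|(f x - f y) *m B| + `|h x - h y|.
  rewrite fB; apply: le_trans (ler_normD _ _).
  by rewrite subrK.
lra.
Qed.

Lemma inv_surj y : O2 y -> exists2 x, `|x - p| < r1 & f x = y.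
Proof.
rewrite /O2 /= => yO.
pose U : set 'rV[R]_n.+1 := closed_ball p r1.
have UE x : U x <-> `|x - p| <= r1.
  by rewrite /U closed_ballE // /closed_ball_ /= distrC.
(* The fixed points of [T] are the preimages of y. By the choice of [O2], [T p] is at distance less
   than r1 / 2 from p, and the contraction adds at most r1 / 2: [T] preserves the closed ball and
   its fixed point lies in the open one. *)
pose T (x : 'rV[R]_n.+1) : 'rV[R]_n.+1 := h x + y *m B.
have Tp : T p - p = (y - f p) *m B.
  rewrite /T /h !fctE /= mulmxBl; move: (f p *m B) (y *m B) => a b.
  by apply/rowP => j; rewrite !mxE; ring.
have TU x : `|x - p| <= r1 -> `|T x - p| < r1.
  move=> xr; have xr' := le_lt_trans xr r1r.
  have L := lip_h Hr xr' (_ : `|p - p| < r); rewrite subrr normr0 in L.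
  have {}L := L r0.
  have -> : T x - p = (h x - h p) + (T p - p).
    rewrite /T; move: (h x) (h p) (y *m B) => a b c.
    by apply/rowP => j; rewrite !mxE; ring.
  apply: le_lt_trans (ler_normD _ _) _; rewrite Tp.
  lra.
have TUU : set_fun U U T by move=> x /UE /TU /ltW; apply: (iffRL (UE _)).
have [x Ux Ex] : exists2 x, U x & x = mkfun_fun TUU x.
  apply: (@banach_fixed_point R _ U (mkfun_fun TUU)).
  - exists (2^-1)%:nng; split => /=; first by rewrite invf_lt1 ?ltr1n.
    move=> [a b] [/= /UE aU /UE bU].
    have L := lip_h Hr (le_lt_trans aU r1r) (le_lt_trans bU r1r).
    change (`|T a - T b| <= 2^-1 * `|a - b|).
    suff -> : T a - T b = h a - h b by [].
    by rewrite /T; move: (y *m B) => c; apply/rowP => j; rewrite !mxE; ring.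
  - exact: closed_ball_closed.
  - by exists p; apply/UE; rewrite subrr normr0 ltW.
have {}Ex : x = T x := Ex.
exists x; first by rewrite Ex; apply: TU; apply/UE.
have E : (f x - y) *m B = 0.
  rewrite mulmxBl.
  have : x - T x = 0 by rewrite -Ex subrr.
  rewrite /T /h !fctE /=; move: (f x *m B) (y *m B) => a b E.
  by rewrite -E; apply/rowP => j; rewrite !mxE; ring.
have Bu : B \in unitmx by rewrite unitmx_inv.
by apply/eqP; rewrite -subr_eq0 -(mulmxK Bu (f x - y)) E mul0mx.
Qed.

Let psi y := xget p [set x | `|x - p| < r1 /\ f x = y].

Let psiP y : O2 y -> `|psi y - p| < r1 /\ f (psi y) = y.
Proof.
move=> /inv_surj[x xr fx].
by have /(xgetPex p) : exists x, `|x - p| < r1 /\ f x = y by exists x.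
Qed.

Let psir y : O2 y -> `|psi y - p| < r.
Proof. by move=> /psiP[h1 _]; exact: lt_trans h1 r1r. Qed.

Let psiK x : O1 x -> psi (f x) = x.
Proof.
move=> [xr Ofx]; have [p1 p2] := psiP Ofx.
have := inv_expand (psir Ofx) (lt_trans xr r1r).
by rewrite p2 subrr mul0mx normr0 mulr0 normr_le0 subr_eq0 => /eqP.
Qed.

Let psi_lip : exists2 C, 0 < C & forall y z, O2 y -> O2 z -> `|psi y - psi z| <= C * `|y - z|.
Proof.
have [k k0 kH] := linear_lipschitz (@linear_rV_continuous n _ (mulmxr B)).
exists (2 * k) => [|y z Oy Oz]; first by rewrite mulr_gt0.
apply: le_trans (inv_expand (psir Oy) (psir Oz)) _.
have [_ ->] := psiP Oy; have [_ ->] := psiP Oz.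
by rewrite -mulrA ler_wpM2l //; exact: (kH (y - z)).
Qed.

Let oO2 : open O2.
Proof.
have c : continuous (fun y => `|(y - f p) *m B|).
  have c1 : continuous (mulmxr B \- cst (f p *m B)).
    by move=> y; apply: continuousB; [exact: linear_rV_continuous|exact: cst_continuous].
  have E : (fun y => (y - f p) *m B) = mulmxr B \- cst (f p *m B).
    by apply/funext => y /=; rewrite mulmxBl.
  rewrite -E in c1.
  by move=> y; exact: (continuous_comp (c1 y) (@norm_continuous _ _ _)).
apply: (@open_comp _ _ (fun y => `|(y - f p) *m B|) [set z | z < r1 / 2]).
  by move=> y _; exact: c.
exact: open_lt.
Qed.

Let oO1 : open O1.
Proof.
have oB : open [set x : 'rV[R]_n.+1 | `|x - p| < r1].
  have -> : [set x : 'rV[R]_n.+1 | `|x - p| < r1] = ball p r1.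
    by apply/seteqP; split => x /=; rewrite -ball_normE /ball_ /= distrC.
  exact: ball_open.
rewrite openE => x [xr Ofx]; rewrite /interior.
have n1 : \forall z \near x, `|z - p| < r1 by apply: (near_open (U := 'rV[R]_n.+1) oB xr).
have [Ox _] := Hr (lt_trans xr r1r).
have fc : {for x, continuous f} by exact: differentiable_continuous (df Ox).
have n2 : \forall z \near x, O2 (f z).
  by apply: fc; apply: open_nbhs_nbhs.
by apply: filterS2 n1 n2 => z.
Qed.

Let Jx_unit x : `|x - p| < r -> jac f x \in unitmx.
Proof.
move=> xr; have [Ox Hx] := Hr xr; apply: inj_unitmx => v.
rewrite -derive_jac; last exact: df.
move=> E; have := Hx v; rewrite Dh // E mul0mx subr0 => le1.
by apply/eqP; rewrite -normr_le0; lra.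
Qed.

Let dpsi y : O2 y -> differentiable psi y /\ 'd psi y = mulmxr (invmx (jac f (psi y))) :> (_ -> _).
Proof.
move=> Oy; set Ji := invmx _.
apply: differentiable_of_approx; first exact: linear_rV_continuous.
move=> e e0; have [C C0 Clip] := psi_lip.
have [k k0 kH] := linear_lipschitz (@linear_rV_continuous n _ (mulmxr Ji)).
have [p1 p2] := psiP Oy.
have [Ox Hx] := Hr (psir Oy).
have dfx := df Ox.
(* [k] bounds the inverse Jacobian and [C] is a Lipschitz constant of [psi]; the error in the
   expansion of f gets multiplied by both. *)
pose e' := e / (k * C).
have e'0 : 0 < e' by rewrite divr_gt0 // mulr_gt0.
have /nbhs_ballP[d /= d0 Hd] := diff_approx dfx e'0.
have n1 : \forall z \near (0 : 'rV[R]_n.+1), O2 (y + z).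
  have /nbhs_ballP[t /= t0 Ht] := open_nbhs_nbhs (conj oO2 Oy).
  apply/nbhs_ballP; exists t => //= z; rewrite -ball_normE /ball_ /= sub0r normrN => zt.
  by apply: Ht; rewrite -ball_normE /ball_ /= opprD addrA subrr sub0r normrN.
have n2 : \forall z \near (0 : 'rV[R]_n.+1), `|z| < d / C.
  apply/nbhs_ballP; exists (d / C); first by rewrite /= divr_gt0.
  by move=> z; rewrite -ball_normE /ball_ /= sub0r normrN.
apply: filterS2 n1 n2 => z Oz zd.
have [q1 q2] := psiP Oz.
set w := psi (y + z) - psi y.
have wC : `|w| <= C * `|z|.
  by have := Clip _ _ Oz Oy; rewrite [y + z - y]addrC addKr.
have wd : ball (0 : 'rV[R]_n.+1) d w.
  rewrite -ball_normE /ball_ /= sub0r normrN; apply: le_lt_trans wC _.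
  by rewrite mulrC -ltr_pdivlMr.
have wE : psi y + w = psi (y + z) by rewrite /w addrC subrK.
have zE : y + z - y = z by rewrite [y + z]addrC addrK.
have A := Hd w wd; rewrite wE q2 p2 zE -deriveE // derive_jac // in A.
have -> : w - mulmxr Ji z = - (mulmxr Ji (z - w *m jac f (psi y))).
  have Jy : jac f (psi y) \in unitmx by apply: Jx_unit; exact: psir.
  by rewrite /= mulmxBl /Ji (mulmxK Jy) opprB.
rewrite normrN; apply: le_trans (kH _) _.
apply: (@le_trans _ _ (k * (e' * `|w|))); first by rewrite ler_wpM2l // ltW.
apply: (@le_trans _ _ (k * (e' * (C * `|z|)))).
  by rewrite ler_wpM2l ?(ltW k0) // ler_wpM2l // ltW.
rewrite le_eqVlt /e'; apply/orP; left; apply/eqP; field.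
by rewrite !gt_eqF.
Qed.

(** Bootstrap: the derivative of [psi] is the inverse Jacobian of f taken along [psi], hence C^k as
    soon as [psi] is, which makes [psi] of class C^(k + 1). *)
Let Spsi : Sm O2 psi.
Proof.
elim=> [|k IH].
  by move=> y Oy; apply: differentiable_continuous; exact: (dpsi Oy).1.
split=> [y Oy|v]; first exact: (dpsi Oy).1.
have Dpsi y : O2 y -> 'D_v psi y = v *m invmx (jac f (psi y)).
  by move=> Oy; have [d1 d2] := dpsi Oy; rewrite deriveE // d2.
apply: (@Ck_eq _ _ _ _ _ (fun y => v *m invmx (jac f (psi y)))) => //.
  by move=> y /Dpsi.
have CJ : forall i j, Ck k O2 (fun y => (jac f (psi y)) i j).
  move=> i j.
  have C1 : Ck k O (fun x => ('D_(delta_mx 0 i) f x) 0 j).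
    by apply: (Ck_coordP _ _ oO).1; exact: (Sf k.+1).2.
  have C2 := Ck_comp_rV1 oO2 (fun y Oy => (Hr (psir Oy)).1) IH C1.
  by apply: Ck_eq C2 => // y Oy; rewrite /= mxE.
have CI := Ck_invmx oO2 (fun y Oy => Jx_unit (psir Oy)) CJ.
apply/(Ck_coordP _ _ oO2) => j.
have : Ck k O2 (fun y => \sum_i v 0 i * (invmx (jac f (psi y))) i j).
  by apply: Ck_sum => // i _; exact: (CkZ (v 0 i) oO2 (CI i j)).
by apply: Ck_eq => // y _; rewrite mxE.
Qed.

Lemma inverse_function_aux : diffeo_germ f p (f p).
Proof.
have Op2 : O2 (f p) by rewrite /O2 /= subrr mul0mx normr0 divr_gt0.
split=> //; exists O1, O2, psi; split.
- by split=> //; split=> //; rewrite subrr normr0.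
- apply: Sm_smooth_on => // k; apply: Ck_subset (Sf k).
  by move=> x [xr _]; exact: (Hr (lt_trans xr r1r)).1.
- exact: Sm_smooth_on.
- by move=> x O1x; split; [exact: O1x.2|exact: psiK].
- by move=> y Oy; have [p1 p2] := psiP Oy; split=> //; split=> //; rewrite p2.
Qed.

End Inverse.

Theorem inverse_function : diffeo_germ f p (f p).
Proof. by have [r r0 Hr] := contr; exact: inverse_function_aux r0 Hr. Qed.

End Local.
End IFT. 

(** * Seeley extension *)

Section TaylorClass.
Variable R : realType.
Implicit Types (D : set R) (h f : R -> R -> R).

Definition bnd D h := exists2 C, 0 <= C & forall u s, D s -> `|h u s| <= C.

(* Uniform Taylor remainders instead of partial derivatives: they make sense up to the boundary when [D] is a closed half-line. *)
Definition tay D h h1 h2 := exists2 C, 0 <= C &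
  forall u u' s s', D s -> D s' ->
    `|h u' s' - h u s - (u' - u) * h1 u s - (s' - s) * h2 u s|
      <= C * ((u' - u) ^+ 2 + (s' - s) ^+ 2).

(** [D] restricts the second variable only; the first is a parameter ranging over the whole line. *)
Fixpoint TC k D h : Prop :=
  match k with
  | 0 => bnd D h
  | k'.+1 => bnd D h /\ exists h1 h2, [/\ TC k' D h1, TC k' D h2 & tay D h h1 h2]
  end.

Lemma TC_bnd k D h : TC k D h -> bnd D h.
Proof. by case: k => [|k] // []. Qed.

Lemma TCS k D h : TC k.+1 D h -> TC k D h.
Proof.
elim: k h => [|k IH] h; first by case.
move=> [bh [h1 [h2 [T1 T2 T]]]]; split=> //; exists h1, h2.
by split=> //; apply: IH.
Qed.

Lemma TC_le k l D h : (k <= l)%N -> TC l D h -> TC k D h.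
Proof.
move=> /subnK <-; elim: (l - k)%N h => // n IH h.
by rewrite addSn => /TCS; exact: IH.
Qed.

(** At distance at least 1 the uniform bound suffices; closer, the squares in the Taylor remainder
    are dominated by the increments themselves. *)
Lemma TC_lip D h : TC 1 D h -> exists2 L, 0 <= L & forall u u' s s', D s -> D s' ->
  `|h u' s' - h u s| <= L * (`|u' - u| + `|s' - s|).
Proof.
move=> [[C0 C00 H0] [h1 [h2 [[C1 C10 H1] [C2 C20 H2] [C C_0 H]]]]].
exists (2 * C0 + C1 + C2 + C) => [|u u' s s' Ds Ds']; first by rewrite !addr_ge0 // mulr_ge0.
have [hu|hu] := lerP 1 (`|u' - u| + `|s' - s|).
  apply: le_trans (ler_normB _ _) _; apply: (@le_trans _ _ (2 * C0)).
    by rewrite mulr_natl mulr2n lerD // H0.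
  have p : 2 * C0 <= 2 * C0 + C1 + C2 + C by rewrite -!addrA lerDl !addr_ge0.
  by apply: le_trans p _; rewrite ler_peMr // !addr_ge0 // mulr_ge0.
set a := u' - u in hu *; set b := s' - s in hu *.
have a1 : `|a| <= 1 by apply: ltW; apply: le_lt_trans hu; rewrite lerDl.
have b1 : `|b| <= 1 by apply: ltW; apply: le_lt_trans hu; rewrite lerDr.
have T := H u u' s s' Ds Ds'; rewrite -/a -/b in T.
have -> : h u' s' - h u s = (h u' s' - h u s - a * h1 u s - b * h2 u s) + (a * h1 u s + b * h2 u s).
  by ring.
have E1 : `|a * h1 u s + b * h2 u s| <= C1 * `|a| + C2 * `|b|.
  apply: le_trans (ler_normD _ _) _; rewrite !normrM; apply: lerD.
    by rewrite mulrC ler_wpM2r // H1.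
  by rewrite mulrC ler_wpM2r // H2.
have a2 : a ^+ 2 <= `|a| by rewrite -real_normK ?num_real // expr2 ler_piMl.
have b2 : b ^+ 2 <= `|b| by rewrite -real_normK ?num_real // expr2 ler_piMl.
have E2 : C * (a ^+ 2 + b ^+ 2) <= C * (`|a| + `|b|) by rewrite ler_wpM2l // lerD.
apply: le_trans (ler_normD _ _) _; apply: le_trans (lerD (le_trans T E2) E1) _.
have p1 : 0 <= C0 * `|a| by rewrite mulr_ge0.
have p2 : 0 <= C0 * `|b| by rewrite mulr_ge0.
have p3 : 0 <= C1 * `|b| by rewrite mulr_ge0.
have p4 : 0 <= C2 * `|a| by rewrite mulr_ge0.
lra.
Qed.

Lemma TCD k D f g : TC k D f -> TC k D g -> TC k D (fun u s => f u s + g u s).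
Proof.
have bD f' g' : bnd D f' -> bnd D g' -> bnd D (fun u s => f' u s + g' u s).
  move=> [C C0 H] [C' C'0 H']; exists (C + C') => [|u s Ds]; first exact: addr_ge0.
  by apply: le_trans (ler_normD _ _) _; rewrite lerD ?H ?H'.
elim: k f g => [|k IH] f g; first exact: bD.
move=> [bf [f1 [f2 [F1 F2 [C C0 H]]]]] [bg [g1 [g2 [G1 G2 [C' C'0 H']]]]].
split; first exact: bD.
exists (fun u s => f1 u s + g1 u s), (fun u s => f2 u s + g2 u s); split; [exact: IH|exact: IH|].
exists (C + C') => [|u u' s s' Ds Ds']; first exact: addr_ge0.
have E := lerD (H u u' s s' Ds Ds') (H' u u' s s' Ds Ds').
rewrite -mulrDl in E; apply: le_trans E.
apply: le_trans (ler_normD _ _); rewrite le_eqVlt; apply/orP; left; apply/eqP; congr `|_|; ring.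
Qed.

Section Functional.
Variables (I : Type) (beta : I -> R) (D D' : set R).
Variables (adm : (I -> R) -> Prop) (L : (I -> R) -> R).
Hypothesis admD : forall p q, adm p -> adm q -> adm (fun i => p i + q i).
Hypothesis admZ : forall (c : R) p, adm p -> adm (fun i => c * p i).
Hypothesis LD : forall p q, adm p -> adm q -> L (fun i => p i + q i) = L p + L q.
Hypothesis LZ : forall (c : R) p, adm p -> L (fun i => c * p i) = c * L p.
Hypothesis Lbnd : forall n, exists2 K, 0 <= K & forall p C, adm p -> 0 <= C ->
  (forall i, `|p i| <= C * (1 + `|beta i|) ^+ n) -> `|L p| <= K * C.
Hypothesis Dbeta : forall i v, D' v -> D (beta i * v).
Hypothesis admf : forall f j u v, TC 1 D f -> D' v -> adm (fun i => beta i ^+ j * f u (beta i * v)).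

(* [L] is a series or an integral over the parameter [i]; each derivative in [v] of a superposition of the dilations [v |-> beta i * v] brings out one more factor [beta i], whence the exponent [j]. *)
Definition Lop j f u v := L (fun i => beta i ^+ j * f u (beta i * v)).

Let H1 i : 1 <= 1 + `|beta i|. Proof. by rewrite lerDl. Qed.
Let H0 i : 0 <= 1 + `|beta i|. Proof. by rewrite (le_trans ler01). Qed.

Lemma tay_Lop j f f1 f2 : TC 1 D f -> TC 1 D f1 -> TC 1 D f2 -> tay D f f1 f2 ->
  tay D' (Lop j f) (Lop j f1) (Lop j.+1 f2).
Proof.
move=> T1f F1' F2' [C C0 H].
(* Growth j comes from the factor [beta i ^+ j], and 2 more from the square of
   [beta i * s' - beta i * s] in the remainder. *)
have [K K0 HK] := Lbnd j.+2.
exists (K * C) => [|u u' s s' Ds Ds']; first exact: mulr_ge0.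
set p' := fun i => beta i ^+ j * f u' (beta i * s').
set p := fun i => beta i ^+ j * f u (beta i * s).
set p1 := fun i => beta i ^+ j * f1 u (beta i * s).
set p2 := fun i => beta i ^+ j.+1 * f2 u (beta i * s).
have ap' : adm p' by exact: admf.
have ap : adm p by exact: admf.
have ap1 : adm p1 by exact: admf.
have ap2 : adm p2 by exact: admf.
have -> : Lop j f u' s' - Lop j f u s - (u' - u) * Lop j f1 u s - (s' - s) * Lop j.+1 f2 u s =
   L (fun i => p' i + (-1 * p i + (- (u' - u) * p1 i + - (s' - s) * p2 i))).
  have a3 := admZ (- (s' - s)) ap2.
  have a2 := admZ (- (u' - u)) ap1.
  have a1 := admZ (-1) ap.
  rewrite (LD ap' (admD a1 (admD a2 a3))) (LD a1 (admD a2 a3)) (LD a2 a3) !LZ //.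
  by rewrite /Lop -/p' -/p -/p1 -/p2; ring.
rewrite -mulrA; apply: HK.
- by apply: admD => //; apply: admD; [exact: admZ|apply: admD; exact: admZ].
- by rewrite mulr_ge0 // addr_ge0 // sqr_ge0.
move=> i; rewrite /p' /p /p1 /p2.
rewrite (_ : _ + _ = beta i ^+ j * (f u' (beta i * s') - f u (beta i * s) - (u' - u) * f1 u (beta i * s)
   - (beta i * s' - beta i * s) * f2 u (beta i * s))); last by rewrite exprS; ring.
rewrite normrM; have := H u u' _ _ (Dbeta i Ds) (Dbeta i Ds').
move=> /(ler_wpM2l (normr_ge0 (beta i ^+ j))) /le_trans; apply.
rewrite mulrCA -mulrA ler_wpM2l // mulrDr mulrDl; apply: lerD.
  rewrite mulrC ler_wpM2l ?sqr_ge0 // normrX.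
  apply: (@le_trans _ _ ((1 + `|beta i|) ^+ j)); first by rewrite lerXn2r ?nnegrE // lerDr.
  by rewrite ler_weXn2l // leqW.
rewrite -mulrBr exprMn mulrA mulrC ler_wpM2l ?sqr_ge0 // normrX.
rewrite -[beta i ^+ 2]real_normK ?num_real // -exprD addn2.
by rewrite lerXn2r ?nnegrE // lerDr.
Qed.

(** One order is lost because admissibility is available only for functions of class [TC 1],
    including the last derivatives that occur. *)
Lemma TC_Lop k j f : TC k.+1 D f -> TC k D' (Lop j f).
Proof.
have bL j' f' : TC 1 D f' -> bnd D' (Lop j' f').
  move=> Tf; have [C C0 H] := TC_bnd Tf.
  have [K K0 HK] := Lbnd j'.
  exists (K * C) => [|u s Ds]; first exact: mulr_ge0.
  apply: HK => //; first exact: admf.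
  move=> i; have Hf := H u _ (Dbeta i Ds); rewrite normrM mulrC ler_pM //.
  by rewrite normrX lerXn2r ?nnegrE // lerDr.
elim: k j f => [|k IH] j f Tf; first by apply: bL; apply: (TC_le _ Tf).
have T1f : TC 1 D f by apply: (TC_le _ Tf).
have [bf [f1 [f2 [F1 F2 T]]]] := Tf.
split; first exact: bL.
exists (Lop j f1), (Lop j.+1 f2); split; [exact: IH|exact: IH|].
exact: tay_Lop T1f (@TC_le 1 k.+1 D f1 isT F1) (@TC_le 1 k.+1 D f2 isT F2) T.
Qed.
End Functional.
End TaylorClass.

(** * Series dominated by a geometric series, and weighted sums of dilations *)

Section GeometricSums.
Variable R : realType.
Implicit Types a b : nat -> R.

Let q : R := 8^-1.
Let q0 : 0 < q. Proof. by rewrite /q invr_gt0. Qed.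
Let q1 : `|q| < 1. Proof. by rewrite gtr0_norm // /q invf_lt1 // ltr1n. Qed.

Definition gb a := exists2 K, 0 <= K & forall i, `|a i| <= K * q ^+ i.
Definition gsum a : R := limn (series a).

Lemma gb_norm a : gb a -> cvgn [normed series a].
Proof.
move=> [K K0 H]; apply: (@series_le_cvg _ _ (geometric K q)) => //=.
- by move=> n; rewrite mulr_ge0 // exprn_ge0 // ltW.
- exact: is_cvg_geometric_series.
Qed.

Lemma gb_cvg a : gb a -> cvgn (series a).
Proof. by move=> /gb_norm /normed_cvg. Qed.

Lemma gsum_bound a K : 0 <= K -> (forall i, `|a i| <= K * q ^+ i) -> `|gsum a| <= K * 2.
Proof.
move=> K0 H; have Ha : gb a by exists K.
apply: le_trans (lim_series_norm (gb_norm Ha)) _.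
have cg := @is_cvg_geometric_series R K q q1.
have Lg : limn (series (geometric K q)) = K * (1 - q)^-1.
  by apply: cvg_lim => //; exact: cvg_geometric_series.
apply: le_trans (lim_series_le (gb_norm Ha) cg H) _; rewrite Lg.
have -> : (1 - q)^-1 = 8 / 7 :> R by rewrite /q; field.
rewrite ler_wpM2l //; lra.
Qed.

Lemma gbD a b : gb a -> gb b -> gb (fun i => a i + b i).
Proof.
move=> [K K0 H] [K' K'0 H']; exists (K + K') => [|i]; first exact: addr_ge0.
by rewrite mulrDl; apply: le_trans (ler_normD _ _) (lerD (H i) (H' i)).
Qed.

Lemma gbZ c a : gb a -> gb (fun i => c * a i).
Proof.
move=> [K K0 H]; exists (`|c| * K) => [|i]; first exact: mulr_ge0.
by rewrite normrM -mulrA ler_wpM2l.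
Qed.

Lemma gsumD a b : gb a -> gb b -> gsum (fun i => a i + b i) = gsum a + gsum b.
Proof. by move=> /gb_cvg ca /gb_cvg cb; rewrite /gsum -(lim_seriesD ca cb). Qed.

Lemma gsumZ c a : gb a -> gsum (fun i => c * a i) = c * gsum a.
Proof. by move=> /gb_cvg ca; rewrite /gsum -[RHS](lim_seriesZ c ca). Qed.

Lemma eq_gsum a b : a =1 b -> gsum a = gsum b.
Proof. by move=> /funext ->. Qed.

Lemma gsum_shift a : gb a -> gsum a = a 0%N + gsum (fun i => a i.+1).
Proof.
move=> Ha; have ca := gb_cvg Ha.
have E : series a \o succn = cst (a 0%N) + series (fun i => a i.+1).
  by apply/funext => n; rewrite /series /= big_nat_recl.
have c1 : (series a \o succn) @ \oo --> gsum a.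
  by rewrite (cvg_shiftS (series a)).
have c2 : series (fun i => a i.+1) @ \oo --> gsum a - a 0%N.
  have -> : series (fun i => a i.+1) = (series a \o succn) - cst (a 0%N).
    by rewrite E; apply/funext => n; rewrite !fctE addrC addKr.
  by apply: cvgB c1 _; exact: cvg_cst.
by rewrite /gsum (cvg_lim _ c2) // addrC subrK.
Qed.

Section WeightedSum.
Variables (w B : nat -> R).
Hypothesis B0 : forall i, 0 <= B i.
Hypothesis Hw : forall n, gb (fun i => w i * (1 + `|- B i|) ^+ n).

(** Polynomial growth in the scales. The weights beat every power of the scales, so such sequences
    are summable against them. *)
Definition wadm (p : nat -> R) := exists n C, 0 <= C /\ forall i, `|p i| <= C * (1 + `|- B i|) ^+ n.
Definition wsum (p : nat -> R) := gsum (fun i => w i * p i).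

Let H1 i : 1 <= 1 + `|- B i|. Proof. by rewrite lerDl. Qed.
Let H0 i : 0 <= 1 + `|- B i|. Proof. by rewrite (le_trans ler01). Qed.

Lemma wadm_gb p : wadm p -> gb (fun i => w i * p i).
Proof.
move=> [n [C [C0 H]]]; have [K K0 HK] := Hw n.
exists (C * K) => [|i]; first exact: mulr_ge0.
rewrite normrM -mulrA; apply: le_trans (ler_wpM2l C0 (HK i)).
rewrite normrM [`|(_) ^+ n|]ger0_norm ?exprn_ge0 // mulrCA ler_wpM2l //.
Qed.

Lemma wadmD p p' : wadm p -> wadm p' -> wadm (fun i => p i + p' i).
Proof.
move=> [n [C [C0 H]]] [n' [C' [C'0 H']]]; exists (maxn n n'), (C + C').
split; first exact: addr_ge0.
move=> i; apply: le_trans (ler_normD _ _) _; rewrite mulrDl; apply: lerD.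
  by apply: le_trans (H i) _; rewrite ler_wpM2l // ler_weXn2l // leq_maxl.
by apply: le_trans (H' i) _; rewrite ler_wpM2l // ler_weXn2l // leq_maxr.
Qed.

Lemma wadmZ c p : wadm p -> wadm (fun i => c * p i).
Proof.
move=> [n [C [C0 H]]]; exists n, (`|c| * C); split; first exact: mulr_ge0.
by move=> i; rewrite normrM -mulrA ler_wpM2l.
Qed.

Let Dp : set R := [set s : R | 0 <= s].
Let Dm : set R := [set s : R | s <= 0].

Let wsumD p p' : wadm p -> wadm p' -> wsum (fun i => p i + p' i) = wsum p + wsum p'.
Proof.
move=> Hp Hp'; rewrite /wsum -gsumD; [|exact: wadm_gb|exact: wadm_gb].
  by apply: eq_gsum => i; rewrite mulrDr.
Qed.

Let wsumZ c p : wadm p -> wsum (fun i => c * p i) = c * wsum p.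
Proof.
move=> Hp; rewrite /wsum -gsumZ; last exact: wadm_gb.
  by apply: eq_gsum => i; rewrite mulrCA.
Qed.

Let wsum_bnd n : exists2 K, 0 <= K & forall p C, wadm p -> 0 <= C ->
  (forall i, `|p i| <= C * (1 + `|- B i|) ^+ n) -> `|wsum p| <= K * C.
Proof.
have [K K0 HK] := Hw n.
exists (K * 2) => [|p C Hp C0 H]; first by rewrite mulr_ge0.
  have -> : K * 2 * C = C * K * 2 by ring.
  apply: gsum_bound; first exact: mulr_ge0.
  move=> i; rewrite -mulrA; apply: le_trans (ler_wpM2l C0 (HK i)).
  rewrite !normrM [`|(_) ^+ n|]ger0_norm ?exprn_ge0 // mulrCA ler_wpM2l //.
Qed.

Let Dbeta i v : Dm v -> Dp (- B i * v).
Proof. by move=> v0; rewrite /Dp /= mulr_le0 // oppr_le0. Qed.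

Let wadmf f j u v : TC 1 Dp f -> Dm v -> wadm (fun i => (- B i) ^+ j * f u (- B i * v)).
Proof.
move=> Tf v0; have [C C0 H] := TC_bnd Tf.
exists j, C; split=> // i; have Hf := H u _ (Dbeta i v0); rewrite normrM mulrC ler_pM //.
by rewrite normrX lerXn2r ?nnegrE // lerDr.
Qed.

(** The dilation factors are nonpositive, so the values at v <= 0 are built from those of f on the
    half-line s >= 0. *)
Lemma TC_wsum k j f : TC k.+1 Dp f -> TC k Dm (Lop (fun i => - B i) wsum j f).
Proof. exact: (TC_Lop wadmD wadmZ wsumD wsumZ wsum_bnd Dbeta wadmf). Qed.

Lemma tay_wsum j f f1 f2 : TC 1 Dp f -> TC 1 Dp f1 -> TC 1 Dp f2 -> tay Dp f f1 f2 ->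
  tay Dm (Lop (fun i => - B i) wsum j f) (Lop (fun i => - B i) wsum j f1) (Lop (fun i => - B i) wsum j.+1 f2).
Proof. exact: (tay_Lop wadmD wadmZ wsumD wsumZ wsum_bnd Dbeta wadmf). Qed.

End WeightedSum.

End GeometricSums.

(** * Weights with all moments equal to one *)

Section SeeleyWeights.
Variable R : realType.
Let q : R := 8^-1.
Let Q : R := 8.
Let q0 : 0 < q. Proof. by rewrite /q invr_gt0. Qed.
Let q1 : q <= 1. Proof. by rewrite /q invf_le1 // ler1n. Qed.
Let qn0 n : 0 <= q ^+ n. Proof. by rewrite exprn_ge0 // ltW. Qed.
Let qn1 n : q ^+ n <= 1. Proof. by rewrite exprn_ile1 // ltW. Qed.
Let Q0 : 0 < Q. Proof. by rewrite /Q. Qed.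
Let Q1 : 1 <= Q. Proof. by rewrite /Q ler1n. Qed.
Let Qn0 n : 0 <= Q ^+ n. Proof. by rewrite exprn_ge0 // ltW. Qed.
Let qQ : q * Q = 1. Proof. by rewrite /q /Q mulVf. Qed.

(* [cc i = (-1) ^ i * 8 ^ - (i (i + 1) / 2)] decays faster than every power of the scales [8 ^ i] grows. *)
Fixpoint cc (i : nat) : R :=
  match i with 0 => 1 | i'.+1 => - (cc i' * q ^+ i'.+1) end.

Let cc_le i : `|cc i| <= q ^+ i.
Proof.
elim: i => [|i IH] /=; first by rewrite normr1.
rewrite normrN normrM (ger0_norm (qn0 i.+1)).
by rewrite ler_piMl //; exact: le_trans IH _.
Qed.

Let cc_le1 i : `|cc i| <= 1.
Proof. exact: le_trans (cc_le i) _. Qed.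

(** Passing from i to i + 1 multiplies the left side by Q^m q^(i + 1), which is at most 1 as soon as
    i + 1 >= m; before that, |cc i| <= 1 and Q^(i m) <= Q^(m m) suffice. *)
Let cc_fast m : forall i, `|cc i| * Q ^+ (i * m) <= Q ^+ (m * m).
Proof.
elim=> [|i IH]; first by rewrite mul0n expr0 mulr1 normr1 exprn_ege1.
have [im|im] := leqP i.+1 m.
  apply: (@le_trans _ _ (1 * Q ^+ (i.+1 * m))).
    by rewrite ler_wpM2r // exprn_ge0 // ltW.
  by rewrite mul1r ler_weXn2l // leq_mul2r im orbT.
apply: (le_trans _ IH); rewrite /= normrN normrM (ger0_norm (qn0 i.+1)).
rewrite -mulrA ler_wpM2l // mulSn exprD mulrA ler_piMl //.
rewrite -(subnKC im) addnC -addSnnS exprD -mulrA -exprMn qQ expr1n mulr1.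
exact: qn1.
Qed.

Let gbA n : gb (fun i => cc i * (Q ^+ i) ^+ n).
Proof.
exists (Q ^+ (n.+1 * n.+1)) => [|i]; first by rewrite exprn_ge0 // ltW.
have H := ler_wpM2r (qn0 i) (cc_fast n.+1 i); apply: (le_trans _ H).
have -> : `|cc i| * Q ^+ (i * n.+1) * q ^+ i = `|cc i| * (Q ^+ i) ^+ n.
  rewrite -mulrA mulnS exprD mulrAC -exprMn [Q * q]mulrC qQ expr1n mul1r.
  by rewrite exprM.
by rewrite normrM [`|(_) ^+ n|]ger0_norm // exprn_ge0.
Qed.

Let gbB n : gb (fun i => cc i * (q ^+ i.+1) ^+ n).
Proof.
exists 1 => // i; rewrite mul1r normrM; apply: le_trans (cc_le i).
by rewrite -exprM ler_piMr // ger0_norm.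
Qed.

Let gbq n : gb (fun i => cc i * (q ^+ i) ^+ n).
Proof.
exists 1 => // i; rewrite mul1r normrM; apply: le_trans (cc_le i).
by rewrite -exprM ler_piMr // ger0_norm.
Qed.

(* Both sums satisfy S (n + 1) = 1 - Q ^ n * S n. *)
Let AB n : gsum (fun i => cc i * (Q ^+ i) ^+ n) = gsum (fun i => cc i * (q ^+ i.+1) ^+ n).
Proof.
elim: n => [|n IH].
  by apply: eq_gsum => i; rewrite !expr0.
have -> : gsum (fun i => cc i * (Q ^+ i) ^+ n.+1) = 1 - Q ^+ n * gsum (fun i => cc i * (Q ^+ i) ^+ n).
  rewrite gsum_shift // expr1n mulr1 -mulNr -gsumZ //; congr (_ + _).
  apply: eq_gsum => i /=.
  have H : q ^+ i.+1 * Q ^+ i.+1 = 1 by rewrite -exprMn qQ expr1n.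
  have -> : (Q ^+ i.+1) ^+ n.+1 = Q ^+ i.+1 * (Q ^+ n * (Q ^+ i) ^+ n).
    by rewrite exprS [X in X ^+ n]exprS exprMn.
  rewrite -[RHS]mul1r -H; move: (q ^+ i.+1) (Q ^+ i.+1) (Q ^+ n) => x y z; ring.
have E : gsum (fun i => cc i * (q ^+ i) ^+ n) = Q ^+ n * gsum (fun i => cc i * (q ^+ i.+1) ^+ n).
  rewrite -gsumZ //; apply: eq_gsum => i.
  rewrite mulrCA; congr (_ * _); rewrite -exprMn exprS mulrA [Q * q]mulrC qQ mul1r //.
have F := gsum_shift (gbq n).
have G : (fun i => cc i.+1 * (q ^+ i.+1) ^+ n) = (fun i => -1 * (cc i * (q ^+ i.+1) ^+ n.+1)).
  apply/funext => i /=; rewrite [X in _ = _ * (_ * X)]exprS.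
  move: (q ^+ i.+1) => x; ring.
rewrite IH -E F G gsumZ // expr0 expr1n mulr1 mulN1r /=; ring.
Qed.

(** The scales [Q ^+ i] and [q ^+ i.+1] together run through all integer powers of 8. The weight 1 /
    (1 + x) at the scale x turns x^n + x^(n + 1) into x^n, so that by [AB] consecutive moments [M n]
    are opposite; moments alternating in sign at x are constant moments at - x. *)
Let r1 i : R := (1 + Q ^+ i)^-1.
Let r2 i : R := (1 + q ^+ i.+1)^-1.
Let dQ i : 0 < 1 + Q ^+ i. Proof. by rewrite ltr_wpDr // exprn_ge0 // ltW. Qed.
Let dq i : 0 < 1 + q ^+ i.+1. Proof. by rewrite ltr_wpDr // exprn_ge0 // ltW. Qed.
Let r1_le i : `|r1 i| <= 1.
Proof.
by rewrite ger0_norm; [rewrite invf_le1 // lerDl|rewrite invr_ge0 ltW].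
Qed.
Let r2_le i : `|r2 i| <= 1.
Proof.
by rewrite ger0_norm; [rewrite invf_le1 // lerDl|rewrite invr_ge0 ltW].
Qed.

Let gbMr (a r : nat -> R) : gb a -> (forall i, `|r i| <= 1) -> gb (fun i => a i * r i).
Proof.
move=> [K K0 H] Hr; exists K => // i; rewrite normrM; apply: le_trans (H i).
by rewrite ler_piMr.
Qed.

Let M n := gsum (fun i => cc i * (Q ^+ i) ^+ n * r1 i) - gsum (fun i => cc i * (q ^+ i.+1) ^+ n * r2 i).

Let M_rec n : M n.+1 = - M n.
Proof.
apply/eqP; rewrite -addr_eq0; apply/eqP; rewrite /M.
rewrite addrACA -gsumD; [|exact: gbMr|exact: gbMr].
rewrite -opprD -gsumD; [|exact: gbMr|exact: gbMr].
rewrite -[RHS](subrr (gsum (fun i => cc i * (q ^+ i.+1) ^+ n))) -{1}AB.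
congr (_ - _); apply: eq_gsum => i.
  have d := lt0r_neq0 (dQ i).
  rewrite -mulrDl exprS mulrCA -[X in _ + X]mul1r -mulrDl [_ + 1]addrC.
  by rewrite mulrC mulrA /r1 mulVf // mul1r.
have d := lt0r_neq0 (dq i).
rewrite -mulrDl exprS mulrCA -[X in _ + X]mul1r -mulrDl [_ + 1]addrC.
by rewrite mulrC mulrA /r2 mulVf // mul1r.
Qed.

Let M_pow n : M n = (-1) ^+ n * M 0.
Proof. by elim: n => [|n IH]; rewrite ?mul1r // M_rec IH exprS mulN1r mulNr. Qed.

Let M0_neq0 : M 0 != 0.
Proof.
have g1 := gbMr (gbA 0) r1_le; have g2 := gbMr (gbB 0) r2_le.
(* The two terms of index 0 give 1/2 - 8/9 = - 7/18, which exceeds in size the bound 2 q = 1/4 on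
   the rest. *)
have E : M 0 = (1 / 2 - 8 / 9) + gsum (fun i => cc i.+1 * (r1 i.+1 - r2 i.+1)).
  rewrite /M -mulN1r -gsumZ // -gsumD //; last exact: gbZ.
  rewrite gsum_shift; last by apply: gbD => //; exact: gbZ.
  congr (_ + _).
    rewrite /r1 /r2 /= !expr0 expr1 /q; by field.
  by apply: eq_gsum => i; rewrite !expr0; ring.
have B : `|gsum (fun i => cc i.+1 * (r1 i.+1 - r2 i.+1))| <= q * 2.
  apply: gsum_bound; first exact: ltW.
  move=> i; rewrite normrM -exprS; apply: le_trans (cc_le _).
  rewrite ler_piMr //.
  have p1 : 0 <= r1 i.+1 by rewrite invr_ge0 ltW.
  have p2 : 0 <= r2 i.+1 by rewrite invr_ge0 ltW.
  have := r1_le i.+1; have := r2_le i.+1; rewrite (ger0_norm p1) (ger0_norm p2) => h1 h2.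
  by rewrite ler_norml; apply/andP; split; lra.
move: B; rewrite ler_norml /q => /andP[B1 B2].
by rewrite lt_eqF // E; lra.
Qed.

(* With these moments all one-sided derivatives of [sum_i w i * f (- B i * s)] at [s = 0] match those of [f]. *)
Lemma seeley_weights : exists w1 w2 B1 B2 : nat -> R,
  [/\ (forall i, 0 <= B1 i) /\ (forall i, 0 <= B2 i),
      (forall n, gb (fun i => w1 i * (1 + `|- B1 i|) ^+ n)),
      (forall n, gb (fun i => w2 i * (1 + `|- B2 i|) ^+ n)) &
      (forall n, wsum w1 (fun i => (- B1 i) ^+ n) + wsum w2 (fun i => (- B2 i) ^+ n) = 1)].
Proof.
pose m := (M 0)^-1.
exists (fun i => m * (cc i * r1 i)), (fun i => - m * (cc i * r2 i)), (fun i => Q ^+ i), (fun i => q ^+ i.+1).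
split.
- by split=> i; rewrite exprn_ge0 // ltW.
- move=> n; have [K K0 H] := gbZ m (gbA n).
  exists (2 ^+ n * K) => [|i]; first by rewrite mulr_ge0 // exprn_ge0.
  rewrite -mulrA; apply: le_trans (ler_wpM2l (exprn_ge0 n (ler0n R 2)) (H i)).
  have Qi : 1 <= Q ^+ i by rewrite exprn_ege1.
  have Qi0 : 0 <= Q ^+ i by apply: le_trans Qi.
  have Y : (1 + Q ^+ i) ^+ n <= 2 ^+ n * (Q ^+ i) ^+ n.
    by rewrite -exprMn lerXn2r ?nnegrE ?addr_ge0 ?mulr_ge0 // mulr2n mulrDl mul1r lerD.
  have Y0 : 0 <= (1 + Q ^+ i) ^+ n by rewrite exprn_ge0 // addr_ge0.
  rewrite normrN (ger0_norm Qi0) !normrM (ger0_norm Y0) (ger0_norm (exprn_ge0 n Qi0)).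
  have Z := ler_pM (normr_ge0 _) Y0 (r1_le i) Y; rewrite mul1r in Z.
  have W := ler_wpM2l (mulr_ge0 (normr_ge0 m) (normr_ge0 (cc i))) Z.
  by rewrite -!mulrA in W *; rewrite [leRHS]mulrCA [X in _ <= _ * X]mulrCA.
- move=> n; exists (`|m| * 2 ^+ n) => [|i]; first by rewrite mulr_ge0 // exprn_ge0.
  have qi : q ^+ i.+1 <= 1 by rewrite exprn_ile1 // ltW.
  have qi0 : 0 <= q ^+ i.+1 by rewrite exprn_ge0 // ltW.
  have Y : (1 + q ^+ i.+1) ^+ n <= 2 ^+ n.
    by rewrite lerXn2r ?nnegrE ?addr_ge0 // [2]mulr2n lerD2l.
  have Y0 : 0 <= (1 + q ^+ i.+1) ^+ n by rewrite exprn_ge0 // addr_ge0.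
  rewrite normrN (ger0_norm qi0) !normrM (ger0_norm Y0) normrN.
  have Z := ler_pM (normr_ge0 _) Y0 (r2_le i) Y; rewrite mul1r in Z.
  have W := ler_pM (normr_ge0 (cc i)) (mulr_ge0 (normr_ge0 _) Y0) (cc_le i) Z.
  have W' := ler_wpM2l (normr_ge0 m) W.
  by rewrite -!mulrA in W' *; rewrite [X in _ <= _ * X]mulrC.
move=> n; rewrite /wsum.
have E1 : gsum (fun i => m * (cc i * r1 i) * (- Q ^+ i) ^+ n) =
   (m * (-1) ^+ n) * gsum (fun i => cc i * (Q ^+ i) ^+ n * r1 i).
  rewrite -gsumZ; last exact: gbMr.
  apply: eq_gsum => i /=; rewrite [(- (Q ^+ i)) ^+ n]exprNn; move: ((-1) ^+ n) ((Q ^+ i) ^+ n) => x y; ring.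
have E2 : gsum (fun i => - m * (cc i * r2 i) * (- q ^+ i.+1) ^+ n) =
   - (m * (-1) ^+ n) * gsum (fun i => cc i * (q ^+ i.+1) ^+ n * r2 i).
  rewrite -gsumZ; last exact: gbMr.
  apply: eq_gsum => i /=; rewrite [(- (q ^+ i.+1)) ^+ n]exprNn; move: ((-1) ^+ n) ((q ^+ i.+1) ^+ n) => x y; ring.
have S : (-1) ^+ n * (-1) ^+ n = 1 :> R by rewrite -exprMn mulrNN mulr1 expr1n.
rewrite E1 E2 mulNr -mulrBr -/(M n) M_pow.
have -> : m * (-1) ^+ n * ((-1) ^+ n * M 0) = ((-1) ^+ n * (-1) ^+ n) * (m * M 0).
  by move: ((-1) ^+ n) => x; ring.
by rewrite S mul1r /m mulVf.
Qed.

End SeeleyWeights.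

(** * Gluing across the boundary s = 0 *)

Section SeeleyExtension.
Variable R : realType.
Variables (w1 w2 B1 B2 : nat -> R).
Hypotheses (B10 : forall i, 0 <= B1 i) (B20 : forall i, 0 <= B2 i).
Hypothesis Hw1 : forall n, gb (fun i => w1 i * (1 + `|- B1 i|) ^+ n).
Hypothesis Hw2 : forall n, gb (fun i => w2 i * (1 + `|- B2 i|) ^+ n).
Hypothesis mom : forall n, wsum w1 (fun i => (- B1 i) ^+ n) + wsum w2 (fun i => (- B2 i) ^+ n) = 1.

Let Dp : set R := [set s : R | 0 <= s].
Let Dm : set R := [set s : R | s <= 0].

(** The values proposed for s <= 0. The index j counts the s-derivatives already taken, each of
    which inserts a factor [- B i]. *)
Let N j (h : R -> R -> R) u s := Lop (fun i => - B1 i) (wsum w1) j h u s + Lop (fun i => - B2 i) (wsum w2) j h u s.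
Let W j (h : R -> R -> R) u s := if 0 <= s then h u s else N j h u s.

Let TN k j h : TC k.+1 Dp h -> TC k Dm (N j h).
Proof. by move=> Th; apply: TCD; apply: TC_wsum. Qed.

Let wadm_pow (B : nat -> R) j : wadm B (fun i => (- B i) ^+ j).
Proof.
by exists j, 1; split=> // i; rewrite mul1r normrX lerXn2r ?nnegrE ?addr_ge0 // lerDr.
Qed.

Let Lop0 (w B : nat -> R) j h u : (forall n, gb (fun i => w i * (1 + `|- B i|) ^+ n)) ->
  Lop (fun i => - B i) (wsum w) j h u 0 = h u 0 * wsum w (fun i => (- B i) ^+ j).
Proof.
move=> Hw; rewrite /Lop /wsum -gsumZ; last exact: wadm_gb.
by apply: eq_gsum => i; rewrite mulr0; ring.
Qed.

(** The moments are 1 for every j, so the one-sided derivatives of all orders agree at s = 0. *)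
Let N0 j h u : N j h u 0 = h u 0.
Proof. by rewrite /N !Lop0 // -mulrDr mom mulr1. Qed.

Let Wp j h u s : 0 <= s -> W j h u s = h u s.
Proof. by rewrite /W => ->. Qed.

Let Wm j h u s : s <= 0 -> W j h u s = N j h u s.
Proof.
rewrite /W => s0; case: ifP => // s0'; have -> : s = 0 by apply/eqP; rewrite eq_le s0.
by rewrite N0.
Qed.

(** Expansion between points on opposite sides, passing through (u, 0). Since s and s' have opposite
    signs, s^2 + s'^2 <= (s' - s)^2, so the remainders of the two legs and the change of base point
    from (u, s) to (u, 0) are all quadratic in the total increment. *)
Let cross (D E : set R) (f f1 f2 : R -> R -> R) C C' L1 L2 u u' s s' :
  0 <= C -> 0 <= C' -> 0 <= L1 -> 0 <= L2 ->
  `|f u' s' - f u 0 - (u' - u) * f1 u 0 - (s' - 0) * f2 u 0| <= C * ((u' - u) ^+ 2 + (s' - 0) ^+ 2) ->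
  `|f u 0 - f u s - (u - u) * f1 u s - (0 - s) * f2 u s| <= C' * ((u - u) ^+ 2 + (0 - s) ^+ 2) ->
  `|f1 u 0 - f1 u s| <= L1 * (`|u - u| + `|0 - s|) ->
  `|f2 u 0 - f2 u s| <= L2 * (`|u - u| + `|0 - s|) ->
  s * s' <= 0 ->
  `|f u' s' - f u s - (u' - u) * f1 u s - (s' - s) * f2 u s| <= (C + C' + L1 + L2) * ((u' - u) ^+ 2 + (s' - s) ^+ 2).
Proof.
move=> C0 C'0 L10 L20; rewrite !subrr !subr0 !sub0r normr0 expr0n /= !add0r mul0r subr0 normrN sqrrN.
move=> H1 H2 H3 H4 ss.
set a := u' - u in H1 *.
have -> : f u' s' - f u s - a * f1 u s - (s' - s) * f2 u s =
  (f u' s' - f u 0 - a * f1 u 0 - s' * f2 u 0) + (f u 0 - f u s - - s * f2 u s)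
  + (a * (f1 u 0 - f1 u s) + s' * (f2 u 0 - f2 u s)) by ring.
have d2 : s ^+ 2 + s' ^+ 2 <= (s' - s) ^+ 2 by nra.
have K1 : `|a * (f1 u 0 - f1 u s)| <= L1 * (a ^+ 2 + s ^+ 2).
  rewrite normrM; apply: (le_trans (ler_wpM2l (normr_ge0 a) H3)).
  rewrite mulrCA ler_wpM2l // -[a ^+ 2]real_normK ?num_real // -[s ^+ 2]real_normK ?num_real //.
  by have := normr_ge0 a; have := normr_ge0 s; have := sqr_ge0 (`|a| - `|s|); nra.
have K2 : `|s' * (f2 u 0 - f2 u s)| <= L2 * (s' ^+ 2 + s ^+ 2).
  rewrite normrM; apply: (le_trans (ler_wpM2l (normr_ge0 s') H4)).
  rewrite mulrCA ler_wpM2l // -[s' ^+ 2]real_normK ?num_real // -[s ^+ 2]real_normK ?num_real //.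
  by have := normr_ge0 s'; have := normr_ge0 s; have := sqr_ge0 (`|s'| - `|s|); nra.
apply: le_trans (ler_normD _ _) _.
apply: le_trans (lerD (ler_normD _ _) (ler_normD _ _)) _.
set d := (s' - s) ^+ 2 in d2 *.
have p1 : C * (a ^+ 2 + s' ^+ 2) <= C * (a ^+ 2 + d) by rewrite ler_wpM2l // lerD2l; have := sqr_ge0 s; lra.
have p2 : C' * s ^+ 2 <= C' * (a ^+ 2 + d) by rewrite ler_wpM2l //; have := sqr_ge0 s'; have := sqr_ge0 a; lra.
have p3 : L1 * (a ^+ 2 + s ^+ 2) <= L1 * (a ^+ 2 + d) by rewrite ler_wpM2l // lerD2l; have := sqr_ge0 s'; lra.
have p4 : L2 * (s' ^+ 2 + s ^+ 2) <= L2 * (a ^+ 2 + d) by rewrite ler_wpM2l //; have := sqr_ge0 a; lra.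
lra.
Qed.

(** The derivatives of [W j h] are [W j h1] and [W j.+1 h2]. Two orders are spent: one in [TC_Lop],
    one because crossing s = 0 uses the Lipschitz bounds of the derivatives on the left side. *)
Lemma TC_W k j h : TC k.+2 Dp h -> TC k setT (W j h).
Proof.
have bW j' h' : TC 1 Dp h' -> bnd setT (W j' h').
  move=> Th; have [C C0 H] := TC_bnd Th.
  have [C' C'0 H'] := TC_bnd (TN (k := 0) j' Th).
  exists (C + C') => [|u s _]; first exact: addr_ge0.
  have [s0|s0] := leP 0 s.
    by rewrite Wp //; apply: (le_trans (H u s s0)); rewrite lerDl.
  by rewrite (Wm _ _ _ (ltW s0)); apply: (le_trans (H' u s (ltW s0))); rewrite lerDr.
elim: k j h => [|k IH] j h Th.
  by apply: bW; exact: (@TC_le R 1 2 Dp h isT Th).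
have T1h : TC 1 Dp h := @TC_le R 1 k.+3 Dp h isT Th.
have [bh [h1 [h2 [F1 F2 T]]]] := Th.
have [C C0 H] := T.
have T1 : TC 1 Dp h1 := @TC_le R 1 k.+2 Dp h1 isT F1.
have T2 : TC 1 Dp h2 := @TC_le R 1 k.+2 Dp h2 isT F2.
split; first exact: bW.
exists (W j h1), (W j.+1 h2); split; [exact: IH|exact: IH|].
have [L1 L10 HL1] := TC_lip T1.
have [L2 L20 HL2] := TC_lip T2.
have [M1 M10 HM1] := TC_lip (TN (k := 1) j (@TC_le R 2 k.+2 Dp h1 isT F1)).
have [M2 M20 HM2] := TC_lip (TN (k := 1) j.+1 (@TC_le R 2 k.+2 Dp h2 isT F2)).
have [C' C'0 H'] : tay Dm (N j h) (N j h1) (N j.+1 h2).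
  have [Ca Ca0 Ha] := tay_wsum B10 Hw1 j T1h T1 T2 T.
  have [Cb Cb0 Hb] := tay_wsum B20 Hw2 j T1h T1 T2 T.
  exists (Ca + Cb) => [|u u' s s' Ds Ds']; first exact: addr_ge0.
  have E := lerD (Ha u u' s s' Ds Ds') (Hb u u' s s' Ds Ds').
  rewrite -mulrDl in E; apply: (le_trans _ E); apply: (le_trans _ (ler_normD _ _)).
  by rewrite le_eqVlt; apply/orP; left; apply/eqP; congr `|_|; rewrite /N; ring.
exists (C + C' + (L1 + M1) + (L2 + M2)) => [|u u' s s' _ _]; first by rewrite !addr_ge0.
have sq0 : 0 <= (u' - u) ^+ 2 + (s' - s) ^+ 2 by rewrite addr_ge0 // sqr_ge0.
have mono K : K <= C + C' + (L1 + M1) + (L2 + M2) -> forall x : R,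
  `|x| <= K * ((u' - u) ^+ 2 + (s' - s) ^+ 2) ->
  `|x| <= (C + C' + (L1 + M1) + (L2 + M2)) * ((u' - u) ^+ 2 + (s' - s) ^+ 2).
  by move=> HK x Hx; apply: (le_trans Hx); exact: ler_wpM2r.
have z0 : (0 : R) <= 0 by [].
have [s0|s0] := leP 0 s; have [s'0|s'0] := leP 0 s'.
- by rewrite !Wp //; apply: (mono C); [lra|exact: H].
- rewrite (Wm _ _ _ (ltW s'0)) !(Wp _ _ _ s0); apply: (mono (C' + C + L1 + L2)); first lra.
  rewrite -(Wp j h u s0) -(Wp j h1 u s0) -(Wp j.+1 h2 u s0) -(Wm j h u' (ltW s'0)).
  apply: cross => //; rewrite ?(Wm j h u' (ltW s'0)) ?(Wm _ _ _ z0).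
  + exact: (H' u u' 0 s' z0 (ltW s'0)).
  + by rewrite N0 !(Wp _ _ _ s0); exact: (H u u s 0 s0 z0).
  + by rewrite N0 !(Wp _ _ _ s0); exact: (HL1 u u s 0 s0 z0).
  + by rewrite N0 !(Wp _ _ _ s0); exact: (HL2 u u s 0 s0 z0).
  + by rewrite mulr_ge0_le0 // ltW.
- rewrite (Wp _ _ _ s'0) !(Wm _ _ _ (ltW s0)); apply: (mono (C + C' + M1 + M2)); first lra.
  rewrite -(Wm j h u (ltW s0)) -(Wm j h1 u (ltW s0)) -(Wm j.+1 h2 u (ltW s0)) -(Wp j h u' s'0).
  apply: cross => //; rewrite ?(Wp j h u' s'0) ?(Wp _ _ _ z0).
  + exact: (H u u' 0 s' z0 s'0).
  + by rewrite -(N0 j) !(Wm _ _ _ (ltW s0)); exact: (H' u u s 0 (ltW s0) z0).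
  + by rewrite -(N0 j) !(Wm _ _ _ (ltW s0)); exact: (HM1 u u s 0 (ltW s0) z0).
  + by rewrite -(N0 j.+1) !(Wm _ _ _ (ltW s0)); exact: (HM2 u u s 0 (ltW s0) z0).
  + by rewrite mulr_le0_ge0 // ltW.
- by rewrite !(Wm _ _ _ (ltW s0)) (Wm _ _ _ (ltW s'0)); apply: (mono C'); [lra|exact: (H' _ _ _ _ (ltW s0) (ltW s'0))].
Qed.

End SeeleyExtension.

Lemma seeley_extension (R : realType) (h : R -> R -> R) :
  (forall k, TC k [set s : R | 0 <= s] h) ->
  exists2 W, (forall k, TC k setT W) & forall u s, 0 <= s -> W u s = h u s.
Proof.
move=> Th; have [w1 [w2 [B1 [B2 [[B10 B20] Hw1 Hw2 mom]]]]] := seeley_weights R.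
exists (fun u s => if 0 <= s then h u s else
  Lop (fun i => - B1 i) (wsum w1) 0 h u s + Lop (fun i => - B2 i) (wsum w2) 0 h u s).
  by move=> k; exact: (TC_W B10 B20 Hw1 Hw2 mom 0 (Th k.+2)).
by move=> u s ->.
Qed.

(** * Even functions and functions with a cuspidal critical line *)

Section Whitney.
Variable R : realType.
Notation mu := (@lebesgue_measure R).
Implicit Types f g : R -> R -> R.

Definition TCoo f := forall k, TC k setT f.

Lemma quad0 (a C : R) : (forall d, `|d * a| <= C * d ^+ 2) -> a = 0.
Proof.
move=> H; apply/eqP/negPn/negP => a0.
have na : 0 < `|a| by rewrite normr_gt0.
have C0 : 0 <= C by have := H 1; rewrite mul1r expr1n mulr1; exact: le_trans.
pose d := `|a| / (2 * (C + 1)).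
have C1 : 0 < 2 * (C + 1) by lra.
have d0 : 0 < d by rewrite divr_gt0.
have := H d; rewrite normrM gtr0_norm // expr2 mulrCA ler_pM2l //.
have dE : d * (2 * (C + 1)) = `|a| by rewrite /d divfK // gt_eqF.
by rewrite -dE => h; nra.
Qed.

Lemma quad_is_derive (f : R -> R) (x l C : R) : (forall d, `|f (x + d) - f x - d * l| <= C * d ^+ 2) ->
  is_derive x 1 f l.
Proof.
move=> H.
have C0 : 0 <= C.
  by have := H 1; rewrite expr1n mulr1; exact: le_trans.
have L : h^-1 *: ((f \o shift x) (h *: 1) - f x) @[h --> 0^'] --> l.
  apply/cvgrPdist_le => e e0; near=> h.
  have h0 : h != 0 by near: h; exact: nbhs_dnbhs_neq.
  have hn : 0 < `|h| by rewrite normr_gt0.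
  rewrite /= [h *: 1]mulr1 [h + x]addrC distrC.
  rewrite -(ler_pM2l hn) -normrM.
  have -> : h * (h^-1 *: (f (x + h) - f x) - l) = f (x + h) - f x - h * l.
    by rewrite mulrBr [h * (_ *: _)]mulrA divff // mul1r.
  apply: le_trans (H h) _; rewrite -real_normK ?num_real // expr2 mulrCA ler_wpM2l //.
  have : `|h| < e / (C + 1).
    by near: h; apply: dnbhs0_lt; rewrite divr_gt0 // ltr_wpDl.
  rewrite ltr_pdivlMr ?ltr_wpDl // => /ltW; apply: le_trans.
  by rewrite mulrC ler_wpM2l // lerDl.
by apply: DeriveDef; [apply/cvg_ex; exists l|apply: cvg_lim].
Unshelve. all: by end_near. Qed.

Lemma lip_continuous (f : R -> R) L : 0 <= L -> (forall x y, `|f y - f x| <= L * `|y - x|) ->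
  continuous f.
Proof.
move=> L0 H x; apply/cvgrPdist_le => e e0; near=> y.
rewrite distrC; apply: le_trans (H x y) _.
have : `|y - x| < e / (L + 1).
  near: y; apply/nbhs_ballP; exists (e / (L + 1)); first by rewrite /= divr_gt0 // ltr_wpDl.
  by move=> y /=; rewrite distrC.
rewrite ltr_pdivlMr ?ltr_wpDl // => /ltW; apply: le_trans.
by rewrite mulrC ler_wpM2l // lerDl.
Unshelve. all: by end_near. Qed.

Lemma tay_slices f f1 f2 : tay setT f f1 f2 -> exists2 C, 0 <= C & forall u v d,
  `|f (u + d) v - f u v - d * f1 u v| <= C * d ^+ 2 /\
  `|f u (v + d) - f u v - d * f2 u v| <= C * d ^+ 2.
Proof.
move=> [C C0 H]; exists C => // u v d.
have E x : x + d - x = d by rewrite [x + d]addrC addrK.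
have A := H u (u + d) v v I I; have B := H u u v (v + d) I I.
by rewrite E subrr expr0n /= addr0 mul0r subr0 in A; rewrite E subrr expr0n /= add0r mul0r subr0 in B.
Qed.

Lemma tay_unique f f1 f2 g1 g2 : tay setT f f1 f2 -> tay setT f g1 g2 ->
  f1 = g1 /\ f2 = g2.
Proof.
move=> /tay_slices[C C0 H] /tay_slices[C' C'0 H'].
split; apply/funext => u; apply/funext => v; apply/eqP; rewrite -subr_eq0; apply/eqP;
  apply: (@quad0 _ (C' + C)) => d; have [A1 A2] := H u v d; have [B1 B2] := H' u v d.
  rewrite mulrDl; apply: (le_trans _ (lerD B1 A1)).
  apply: (le_trans _ (ler_normB _ _)).
  by rewrite le_eqVlt; apply/orP; left; apply/eqP; congr `|_|; ring.
rewrite mulrDl; apply: (le_trans _ (lerD B2 A2)).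
apply: (le_trans _ (ler_normB _ _)).
by rewrite le_eqVlt; apply/orP; left; apply/eqP; congr `|_|; ring.
Qed.

(** Each order k comes with its own existential derivatives; by uniqueness of first order expansions
    they are the same functions for all k. *)
Lemma TCoo_tay f : TCoo f -> exists f1 f2, [/\ TCoo f1, TCoo f2 & tay setT f f1 f2].
Proof.
move=> Tf; have [_ [f1 [f2 [_ _ T]]]] := Tf 1%N.
exists f1, f2; split=> // k; have [_ [g1 [g2 [G1 G2 T']]]] := Tf k.+1.
  by have [-> _] := tay_unique T T'.
by have [_ ->] := tay_unique T T'.
Qed.

Lemma tay_derive2 f f1 f2 (u v : R) : tay setT f f1 f2 -> is_derive v 1 (f u) (f2 u v).
Proof.
move=> /tay_slices[C C0 H]; apply: (@quad_is_derive _ _ _ C) => d.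
by have [] := H u v d.
Qed.

Lemma TCZ k c g : TC k setT g -> TC k setT (fun u v => c * g u v).
Proof.
elim: k g => [|k IH] g.
  move=> [K K0 HK]; exists (`|c| * K) => [|u v _]; first exact: mulr_ge0.
  by rewrite normrM ler_wpM2l // HK.
move=> [[K K0 HK] [g1 [g2 [G1 G2 [K' K'0 HK']]]]]; split.
  exists (`|c| * K) => [|u v _]; first exact: mulr_ge0.
  by rewrite normrM ler_wpM2l // HK.
exists (fun u v => c * g1 u v), (fun u v => c * g2 u v); split; [exact: IH|exact: IH|].
exists (`|c| * K') => [|u u' v v' _ _]; first exact: mulr_ge0.
rewrite -mulrA; apply: (le_trans _ (ler_wpM2l (normr_ge0 c) (HK' u u' v v' I I))).
by rewrite -normrM le_eqVlt; apply/orP; left; apply/eqP; congr `|_|; ring.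
Qed.

Lemma TC_refl k f : TC k setT f -> TC k setT (fun u v => f u (- v)).
Proof.
elim: k f => [|k IH] f; first by move=> [C C0 H]; exists C => // u v _; exact: H.
move=> [[C0 C00 H0] [f1 [f2 [F1 F2 [C C_0 H]]]]]; split.
  by exists C0 => // u v _; exact: H0.
exists (fun u v => f1 u (- v)), (fun u v => - 1 * f2 u (- v)).
split; [exact: IH|exact/TCZ/IH|].
exists C => // u u' v v' _ _; have A := H u u' (- v) (- v') I I.
have E : (- v' - - v) ^+ 2 = (v' - v) ^+ 2 by ring.
rewrite E in A; apply: (le_trans _ A).
by rewrite le_eqVlt; apply/orP; left; apply/eqP; congr `|_|; ring.
Qed.

Definition evenv f := forall u v, f u (- v) = f u v.
Definition oddv f := forall u v, f u (- v) = - f u v.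

(** The reflected expansion yields a second pair of derivatives, which uniqueness identifies with
    the first. *)
Lemma even_tay f f1 f2 : evenv f -> tay setT f f1 f2 -> evenv f1 /\ oddv f2.
Proof.
move=> ef T; have [C C0 H] := T.
have T' : tay setT f (fun u v => f1 u (- v)) (fun u v => - f2 u (- v)).
  exists C => // u u' v v' _ _; have A := H u u' (- v) (- v') I I.
  have E : (- v' - - v) ^+ 2 = (v' - v) ^+ 2 by ring.
  rewrite E !ef in A; apply: (le_trans _ A).
  by rewrite le_eqVlt; apply/orP; left; apply/eqP; congr `|_|; ring.
have [E1 E2] := tay_unique T T'; split=> u v; first by rewrite [in RHS]E1.
by rewrite [in RHS]E2 opprK.
Qed.

Lemma odd_tay f f1 f2 : oddv f -> tay setT f f1 f2 -> oddv f1 /\ evenv f2.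
Proof.
move=> ef T; have [C C0 H] := T.
have T' : tay setT f (fun u v => - f1 u (- v)) (fun u v => f2 u (- v)).
  exists C => // u u' v v' _ _; have A := H u u' (- v) (- v') I I.
  have E : (- v' - - v) ^+ 2 = (v' - v) ^+ 2 by ring.
  rewrite E !ef in A; apply: (le_trans _ A).
  by rewrite le_eqVlt; apply/orP; left; apply/eqP; rewrite -normrN; congr `|_|; ring.
have [E1 E2] := tay_unique T T'; split=> u v; last by rewrite [in RHS]E2.
by rewrite [in RHS]E1 opprK.
Qed.


Definition mean (p : R -> R) : R := (\int[mu]_(x in `[0%R, 1%R]) p x)%R.
Let cadm (p : R -> R) := continuous p.

Let cint (p : R -> R) : continuous p -> mu.-integrable `[0%R, 1%R] (EFin \o p).
Proof.
move=> cp; have cw : {within `[0%R, 1%R], continuous p} by exact: continuous_subspaceT.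
exact (continuous_compact_integrable (@segment_compact R 0 1) cw).
Qed.

Let m01 : measurable (`[0%R, 1%R] : set (measurableTypeR R)).
Proof. exact: measurable_itv. Qed.

Let cadmD p q : cadm p -> cadm q -> cadm (fun i => p i + q i).
Proof. by move=> cp cq x; exact: (cvgD (cp x) (cq x)). Qed.
Let cadmZ (c : R) p : cadm p -> cadm (fun i => c * p i).
Proof. by move=> cp x; exact: (cvgM (cvg_cst c) (cp x)). Qed.
Let meanD p q : cadm p -> cadm q -> mean (fun i => p i + q i) = mean p + mean q.
Proof. by move=> cp cq; apply: RintegralD => //; exact: cint. Qed.
Let meanZ (c : R) p : cadm p -> mean (fun i => c * p i) = c * mean p.
Proof. by move=> cp; apply: RintegralZl => //; exact: cint. Qed.
Let mean_bnd n : exists2 K, 0 <= K & forall p C, cadm p -> 0 <= C ->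
  (forall i : R, `|p i| <= C * (1 + `|i|) ^+ n) -> `|mean p| <= K * C.
Proof.
exists (2 ^+ n) => [|p C cp C0 H]; first by rewrite exprn_ge0.
apply: (le_trans (le_normr_Rintegral m01 (cint cp))).
have ca : continuous (fun x => `|p x|).
  by move=> x; apply: (continuous_comp (cp x)); exact: norm_continuous.
have cc : continuous (cst (2 ^+ n * C) : R -> R) by move=> x; exact: cst_continuous.
apply: (le_trans (le_Rintegral m01 (cint ca) (cint cc) _)).
  move=> x; rewrite /= in_itv /= => /andP[x0 x1]; apply: (le_trans (H x)).
  by rewrite mulrC ler_wpM2r // lerXn2r ?nnegrE ?addr_ge0 // ger0_norm // [2]mulr2n lerD2l.
have M : mu (`[0%R, 1%R] : set R) = 1%:E.
  by rewrite lebesgue_measure_itv /= lte_fin ltr01 -EFinB subr0.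
rewrite (Rintegral_cst mu m01) (_ : fine _ = 1) ?mulr1 //.
exact (congr1 fine M).
Qed.

Let slice_cont f u v : TC 1 setT f -> continuous (fun i : R => f u (i * v)).
Proof.
move=> /TC_lip[L L0 H]; apply: (@lip_continuous _ (L * `|v|)); first exact: mulr_ge0.
move=> x y; apply: (le_trans (H _ _ _ _ I I)).
by rewrite subrr normr0 add0r -mulrBl normrM -mulrA [`|v| * _]mulrC.
Qed.

Let slice_adm f j (u v : R) : TC 1 setT f -> setT v -> cadm (fun i => i ^+ j * f u (i * v)).
Proof.
move=> Tf _ x; have c1 := @exprn_continuous R j x.
have c2 := @slice_cont f u v Tf x; exact (cvgM c1 c2).
Qed.

(** The mean of [f u] over the segment from 0 to v. As an instance of [Lop] with the integral over
    [0, 1] as functional, it gets its smoothness in (u, v) from [TC_Lop]. *)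
Definition avg f := Lop (fun i : R => i) mean 0 f.

Lemma TCoo_avg f : TCoo f -> TCoo (avg f).
Proof.
by move=> Tf k; apply: (@TC_Lop R R (fun i => i) setT setT cadm mean cadmD cadmZ meanD meanZ mean_bnd).
Qed.

Lemma avgE f f1 f2 u v : TCoo f -> TCoo f2 -> tay setT f f1 f2 ->
  v * avg f2 u v = f u v - f u 0.
Proof.
move=> Tf Tf2 T.
have c1 : continuous (fun i : R => v * f2 u (i * v)).
  exact: (cadmZ (@slice_cont f2 u v (Tf2 1%N))).
have D (x : R) : is_derive x 1 (fun i : R => f u (i * v)) (v * f2 u (x * v)).
  have [C C0 H] := tay_slices T; apply: (@quad_is_derive _ _ _ (C * v ^+ 2)) => d.
  have [_ A] := H u (x * v) (d * v); rewrite -mulrDl exprMn in A.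
  have E : C * v ^+ 2 * d ^+ 2 = C * (d ^+ 2 * v ^+ 2) by ring.
  by rewrite E mulrA.
have F := @continuous_FTC2 R (fun i : R => v * f2 u (i * v)) (fun i : R => f u (i * v)) 0 1 ltr01 _ _ _.
have {}F := F (continuous_subspaceT c1) _ _.
rewrite /avg /Lop -meanZ; last first.
  by apply: slice_adm.
rewrite /mean /Rintegral.
under eq_integral do rewrite expr0 mul1r.
rewrite F /= ?mul1r ?mul0r //.
- have cf := @slice_cont f u v (Tf 1%N); split.
  + by move=> x _; exact: (@ex_derive _ _ _ _ _ _ _ (D x)).
  + exact: cvg_at_right_filter (cf 0).
  + exact: cvg_at_left_filter (cf 1).
- by move=> x _; rewrite derive1E; exact: (@derive_val _ _ _ _ _ _ _ (D x)).
Qed.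

Lemma avg_even f : evenv f -> evenv (avg f).
Proof. by move=> ef u v; congr mean; apply/funext => i; rewrite mulrN ef. Qed.

Lemma avg_odd f : TCoo f -> oddv f -> oddv (avg f).
Proof.
move=> Tf of_ u v; rewrite -[RHS]mulN1r /avg /Lop -meanZ; last exact: slice_adm.
by congr mean; apply/funext => i; rewrite mulrN of_ mulN1r mulrN.
Qed.

(** By the fundamental theorem of calculus the quotient by v is the mean of the v-derivative over
    the segment from 0 to v; it has the parity of that derivative. *)
Lemma hadamard f : TCoo f -> (forall u, f u 0 = 0) -> exists q,
  [/\ TCoo q, (forall u v, f u v = v * q u v), (oddv f -> evenv q) & (evenv f -> oddv q)].
Proof.
move=> Tf f0; have [f1 [f2 [F1 F2 T]]] := TCoo_tay Tf.
exists (avg f2); split; first exact: TCoo_avg.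
- by move=> u v; rewrite (avgE u v Tf F2 T) f0 subr0.
- by move=> /odd_tay /(_ T)[_ e2]; exact: avg_even.
- by move=> /even_tay /(_ T)[_ e2]; exact: avg_odd.
Qed.

(** The chain rule gives f_v(u, sqrt s) / (2 sqrt s). Now f_v is odd in v, so its quotient by v is
    again smooth and even: the derivative has the same shape as the function, and the argument can
    be iterated. *)
Lemma even_sqrt_derive f : TCoo f -> evenv f -> exists q,
  [/\ TCoo q, evenv q & forall u s : R, 0 < s -> is_derive s 1 (fun s => f u (Num.sqrt s)) (q u (Num.sqrt s))].
Proof.
move=> Tf ef; have [f1 [f2 [F1 F2 T]]] := TCoo_tay Tf.
have [_ o2] := even_tay ef T.
have z2 u : f2 u 0 = 0.
  by have := o2 u 0; rewrite oppr0 => h; lra.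
have [q [Tq Hq eq _]] := hadamard F2 z2.
exists (fun u v => 2^-1 * q u v); split; first by move=> k; exact: TCZ.
  by move=> u v; rewrite eq.
move=> u s s0.
have d1 := tay_derive2 u (Num.sqrt s) T.
have d2 := is_derive1_sqrt s0.
have := @is_derive1_comp R (f u) Num.sqrt s _ _ d1 d2.
have -> : f2 u (Num.sqrt s) * (2 * Num.sqrt s)^-1 = 2^-1 * q u (Num.sqrt s).
  rewrite Hq; field; by rewrite sqrtr_eq0 -ltNge.
by [].
Qed.

(** The derivative formula is available for s > 0 only, but the mean value theorem needs it just
    inside the interval; continuity of the square root takes care of s = 0. *)
Lemma even_sqrt_MVT f q : TCoo f ->
  (forall u s : R, 0 < s -> is_derive s 1 (fun s => f u (Num.sqrt s)) (q u (Num.sqrt s))) ->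
  forall u s s', 0 <= s -> s <= s' -> exists2 c, s <= c <= s' &
    f u (Num.sqrt s') - f u (Num.sqrt s) = q u (Num.sqrt c) * (s' - s).
Proof.
move=> Tf D u s s' s0 ss'.
have fc : continuous (f u).
  have [L L0 H] := TC_lip (Tf 1%N).
  apply: (@lip_continuous _ L) => // x y; apply: (le_trans (H u u x y I I)).
  by rewrite subrr normr0 add0r.
have gc : continuous (fun s => f u (Num.sqrt s)).
  by move=> x; exact: (continuous_comp (@sqrt_continuous R x) (fc _)).
have [|c] := @MVT_segment R (fun s => f u (Num.sqrt s)) (fun s => q u (Num.sqrt s)) s s' ss' _ (continuous_subspaceT gc).
  by move=> x; rewrite in_itv /= => /andP[sx _]; apply: D; exact: le_lt_trans sx.
by rewrite in_itv /= => cs E; exists c.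
Qed.

Lemma even_sqrt_lip f : TCoo f -> evenv f -> exists2 L, 0 <= L & forall u s s', 0 <= s -> 0 <= s' ->
  `|f u (Num.sqrt s') - f u (Num.sqrt s)| <= L * `|s' - s|.
Proof.
move=> Tf ef; have [q [Tq _ D]] := even_sqrt_derive Tf ef.
have [L L0 H] := TC_bnd (Tq 0%N); exists L => // u.
have W s s' : 0 <= s -> s <= s' -> `|f u (Num.sqrt s') - f u (Num.sqrt s)| <= L * `|s' - s|.
  move=> s0 ss'; have [c _ ->] := even_sqrt_MVT Tf D u s0 ss'.
  by rewrite normrM ler_wpM2r // H.
move=> s s' s0 s'0; have [ss'|ss'] := leP s s'; first exact: W.
by rewrite distrC [`|s' - s|]distrC; apply: W => //; exact: ltW.
Qed.

(** Even functions of sqrt s are closed under both derivatives: the u-derivative stays even, and the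
    s-derivative is given by [even_sqrt_derive]. *)
Lemma TC_sqrt k f : TCoo f -> evenv f ->
  TC k [set s : R | 0 <= s] (fun u s => f u (Num.sqrt s)).
Proof.
have bh f' : TCoo f' -> bnd [set s : R | 0 <= s] (fun u s => f' u (Num.sqrt s)).
  by move=> Tf; have [C C0 H] := TC_bnd (Tf 0%N); exists C => // u s _; exact: H.
elim: k f => [|k IH] f Tf ef; first exact: bh.
split; first exact: bh.
have [q [Tq eq D]] := even_sqrt_derive Tf ef.
have [f1 [f2 [F1 F2 T]]] := TCoo_tay Tf.
have [e1 _] := even_tay ef T.
exists (fun u s => f1 u (Num.sqrt s)), (fun u s => q u (Num.sqrt s)).
split; [exact: IH|exact: IH|].
have [C C0 H] := T.
have [L1 L10 H1] := even_sqrt_lip F1 e1.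
have [L2 L20 H2] := even_sqrt_lip Tq eq.
exists (C + L1 + L2) => [|u u' s s' /= s0 s'0]; first by rewrite !addr_ge0.
have A1 := H u u' (Num.sqrt s') (Num.sqrt s') I I.
rewrite subrr expr0n /= mul0r subr0 addr0 in A1.
have A2 := H1 u s s' s0 s'0.
have A3 : `|f u (Num.sqrt s') - f u (Num.sqrt s) - (s' - s) * q u (Num.sqrt s)| <= L2 * (s' - s) ^+ 2.
  rewrite -[(s' - s) ^+ 2]real_normK ?num_real // expr2 mulrA.
  have [ss'|ss'] := leP s s'.
    have [c /andP[sc cs'] ->] := even_sqrt_MVT Tf D u s0 ss'.
    rewrite [(s' - s) * _]mulrC -mulrBl normrM ler_wpM2r //.
    apply: (le_trans (H2 u s c s0 (le_trans s0 sc))); rewrite ler_wpM2l //.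
    by rewrite !ger0_norm ?subr_ge0 // lerD2r.
  have [c /andP[sc cs'] E] := even_sqrt_MVT Tf D u s'0 (ltW ss').
  have -> : f u (Num.sqrt s') - f u (Num.sqrt s) - (s' - s) * q u (Num.sqrt s) =
    (q u (Num.sqrt c) - q u (Num.sqrt s)) * (s' - s).
    have E' : f u (Num.sqrt s') - f u (Num.sqrt s) = q u (Num.sqrt c) * (s' - s).
      by rewrite -[LHS]opprB E; ring.
    by rewrite E'; ring.
  rewrite normrM ler_wpM2r //.
  apply: (le_trans (H2 u s c s0 (le_trans s'0 sc))); rewrite ler_wpM2l //.
  by rewrite distrC [leRHS]distrC !ger0_norm ?subr_ge0 ?(ltW ss') // lerB.
set a := u' - u in A1 *; set b := s' - s in A2 A3 *.
have -> : f u' (Num.sqrt s') - f u (Num.sqrt s) - a * f1 u (Num.sqrt s) - b * q u (Num.sqrt s) =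
  (f u' (Num.sqrt s') - f u (Num.sqrt s') - a * f1 u (Num.sqrt s')) +
  a * (f1 u (Num.sqrt s') - f1 u (Num.sqrt s)) +
  (f u (Num.sqrt s') - f u (Num.sqrt s) - b * q u (Num.sqrt s)) by ring.
have A2' : `|a * (f1 u (Num.sqrt s') - f1 u (Num.sqrt s))| <= L1 * (a ^+ 2 + b ^+ 2).
  rewrite normrM; apply: (le_trans (ler_wpM2l (normr_ge0 a) A2)).
  rewrite mulrCA ler_wpM2l // -[a ^+ 2]real_normK ?num_real // -[b ^+ 2]real_normK ?num_real //.
  by have := normr_ge0 a; have := normr_ge0 b; have := sqr_ge0 (`|a| - `|b|); nra.
have p1 : 0 <= C * b ^+ 2 by rewrite mulr_ge0 // sqr_ge0.
have p2 : 0 <= L2 * a ^+ 2 by rewrite mulr_ge0 // sqr_ge0.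
have p3 := ler_normD (f u' (Num.sqrt s') - f u (Num.sqrt s') - a * f1 u (Num.sqrt s') +
  a * (f1 u (Num.sqrt s') - f1 u (Num.sqrt s))) (f u (Num.sqrt s') - f u (Num.sqrt s) - b * q u (Num.sqrt s)).
have p4 := ler_normD (f u' (Num.sqrt s') - f u (Num.sqrt s') - a * f1 u (Num.sqrt s'))
  (a * (f1 u (Num.sqrt s') - f1 u (Num.sqrt s))).
lra.
Qed.

(** On s >= 0 the function sought is f(u, sqrt s); the Seeley extension provides the other
    half-line. *)
Lemma whitney_even f : TCoo f -> evenv f ->
  exists2 g, TCoo g & forall u v, f u v = g u (v ^+ 2).
Proof.
move=> Tf ef; have [W TW HW] := seeley_extension (fun k => TC_sqrt k Tf ef).
exists W => // u v; rewrite HW ?sqr_ge0 // sqrtr_sqr.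
by have [v0|v0] := leP 0 v; rewrite ?(ger0_norm v0) ?(ltr0_norm v0) ?ef.
Qed.

(** Splitting into even and odd parts in v. On v = 0 the odd part vanishes to third order, its value
    and second derivative by parity and its first derivative by assumption, so three divisions by v
    leave an even factor of v^3. *)
Lemma whitney_cusp f f1 f2 : TCoo f -> tay setT f f1 f2 -> (forall u, f2 u 0 = 0) ->
  exists ge go, [/\ TCoo ge, TCoo go & forall u v, f u v = ge u (v ^+ 2) + v ^+ 3 * go u (v ^+ 2)].
Proof.
move=> Tf T f20.
have Tr k : TC k setT (fun u v => f u (- v)) by exact: TC_refl.
pose fe u v := 2^-1 * (f u v + f u (- v)).
pose fo u v := 2^-1 * (f u v + -1 * f u (- v)).
have Te : TCoo fe by move=> k; apply: TCZ; apply: TCD.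
have To : TCoo fo by move=> k; apply: TCZ; apply: TCD => //; exact: TCZ.
have ee : evenv fe by move=> u v; rewrite /fe opprK; ring.
have oo : oddv fo by move=> u v; rewrite /fo opprK; ring.
have fo0 u : fo u 0 = 0 by have := oo u 0; rewrite oppr0 => h; lra.
have [q1 [Tq1 H1 + _]] := hadamard To fo0; move=> /(_ oo) e1.
(* [q1 u 0] is the v-derivative of the odd part at v = 0, which is [f2 u 0]; the quadratic estimates
   avoid computing it. *)
have q10 u : q1 u 0 = 0.
  have [C C0 S] := tay_slices T; have [L L0 HL] := TC_lip (Tq1 1%N).
  apply: (@quad0 _ (C + L)) => d.
  have [_ S1] := S u 0 d; have [_ S2] := S u 0 (- d).
  rewrite !add0r !f20 !mulr0 !subr0 sqrrN in S1 S2.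
  have E : `|d * q1 u d| <= C * d ^+ 2.
    rewrite -H1 /fo normrM ger0_norm ?invr_ge0 //.
    have -> : f u d + -1 * f u (- d) = (f u d - f u 0) - (f u (- d) - f u 0) by ring.
    have := ler_normB (f u d - f u 0) (f u (- d) - f u 0); lra.
  have E2 : `|d * (q1 u 0 - q1 u d)| <= L * d ^+ 2.
    rewrite normrM -[d ^+ 2]real_normK ?num_real // expr2 mulrCA ler_wpM2l //.
    have := HL u u d 0 I I; by rewrite subrr normr0 add0r sub0r normrN.
  have -> : d * q1 u 0 = d * q1 u d + d * (q1 u 0 - q1 u d) by ring.
  by rewrite mulrDl; apply: (le_trans (ler_normD _ _) (lerD E E2)).
have [q2 [Tq2 H2 _]] := hadamard Tq1 q10; move=> /(_ e1) o2.
have q20 u : q2 u 0 = 0 by have := o2 u 0; rewrite oppr0 => h; lra.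
have [q3 [Tq3 H3 + _]] := hadamard Tq2 q20; move=> /(_ o2) e3.
have [ge Tge Hge] := whitney_even Te ee.
have [go Tgo Hgo] := whitney_even Tq3 e3.
exists ge, go; split=> // u v; rewrite -Hge -Hgo.
have -> : v ^+ 3 * q3 u v = fo u v by rewrite H1 H2 H3; ring.
by rewrite /fe /fo; field.
Qed.

Lemma TC_Ck k f : TC k.+1 setT f -> Ck k setT (fun p : 'rV[R]_2 => f (p 0 0) (p 0 1)).
Proof.
have dif f' f1 f2 p : tay setT f' f1 f2 -> let g := fun p : 'rV[R]_2 => f' (p 0 0) (p 0 1) in
  differentiable g p /\ forall v, 'D_v g p = v 0 0 * f1 (p 0 0) (p 0 1) + v 0 1 * f2 (p 0 0) (p 0 1).
  move=> [C C0 H] g.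
  pose l (v : 'rV[R]_2) := v 0 0 * f1 (p 0 0) (p 0 1) + v 0 1 * f2 (p 0 0) (p 0 1).
  have ll : linear l by move=> a u v; rewrite /l !mxE /GRing.scale /=; ring.
  pose lM := GRing.isLinear.Build _ _ _ _ _ ll.
  pose L : {linear _ -> _} := HB.pack l lM.
  have [d1 d2] : differentiable g p /\ 'd g p = L :> (_ -> _).
    apply: differentiable_of_approx; first exact: linear_rV_continuous.
    move=> e e0; apply/nbhs_ballP; exists (e / (2 * C + 1)); first by rewrite /= divr_gt0 // ltr_wpDl // mulr_ge0.
    move=> h; rewrite -ball_normE /ball_ /= sub0r normrN => hd.
    have A := H (p 0 0) ((p + h) 0 0) (p 0 1) ((p + h) 0 1) I I.
    have E i : (p + h) 0 i - p 0 i = h 0 i by rewrite mxE [_ + h 0 i]addrC addrK.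
    rewrite !E in A; rewrite /g /L /= /l opprD addrA; apply: (le_trans A).
    have B i : h 0 i ^+ 2 <= `|h| * `|h|.
      by rewrite -real_normK ?num_real // expr2 ler_pM // coord_le_norm.
    have B0 := B 0; have B1 := B 1.
    apply: (@le_trans _ _ ((2 * C) * `|h| * `|h|)); first by have := normr_ge0 h; nra.
    rewrite ler_wpM2r //; move: hd; rewrite ltr_pdivlMr ?ltr_wpDl ?mulr_ge0 //.
    by have := normr_ge0 h; lra.
  by split=> // v; rewrite deriveE // d2.
elim: k f => [|k IH] f; move=> [bf [f1 [f2 [F1 F2 T]]]].
  by move=> p _; apply: differentiable_continuous; exact: (dif _ _ _ _ T).1.
split=> [p _|v]; first exact: (dif _ _ _ _ T).1.
have oT : open [set: 'rV[R]_2] by exact: openT.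
have C1 := CkZ (v 0 0) oT (IH _ F1).
have C2 := CkZ (v 0 1) oT (IH _ F2).
apply: Ck_eq (CkD oT C1 C2) => // p _.
by rewrite (dif _ _ _ _ T).2.
Qed.

End Whitney.

(** * Germs *)

Section Germs.
Variable R : realType.

Lemma smooth_onP n m (O : set 'rV[R]_n.+1) (f : 'rV[R]_n.+1 -> 'rV[R]_m.+1) :
  smooth_on O f <-> open O /\ Sm O f.
Proof.
split=> [h|[ oO Sf]]; last exact: Sm_smooth_on.
by split; [exact: h.1|exact: smooth_on_Sm_rV].
Qed.

Lemma open_preimage (U V : normedModType R) (O : set U) (f : U -> V) (P : set V) :
  open O -> (forall x, O x -> {for x, continuous f}) -> open P ->
  open [set x | O x /\ P (f x)].
Proof.
move=> oO fc oP; rewrite openE => x [ Ox Pfx].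
have n1 := open_nbhs_nbhs (conj oO Ox).
have n2 : \forall z \near x, P (f z) by apply: (fc x Ox); exact: open_nbhs_nbhs.
by apply: filterS2 n1 n2 => z.
Qed.

Lemma diffeo_germ_inv n (f : 'rV[R]_n.+1 -> 'rV[R]_n.+1) p q : diffeo_germ f p q ->
  exists2 g, diffeo_germ g q p &
    (\forall x \near p, g (f x) = x) /\ (\forall y \near q, f (g y) = y).
Proof.
move=> [fp [ O1 [ O2 [g [[ O1p O2q] S1 S2 H1 H2]]]]].
have oO1 := S1.1; have oO2 := S2.1.
exists g.
  split; first by rewrite -fp; exact: (H1 p O1p).2.
  by exists O2, O1, f; split.
split.
  by apply: filterS (open_nbhs_nbhs (conj oO1 O1p)) => x /H1[].
by apply: filterS (open_nbhs_nbhs (conj oO2 O2q)) => y /H2[].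
Qed.

Lemma diffeo_germ_comp n (f g : 'rV[R]_n.+1 -> 'rV[R]_n.+1) p q r :
  diffeo_germ f p q -> diffeo_germ g q r -> diffeo_germ (g \o f) p r.
Proof.
move=> [fp [ O1 [ O2 [f' [[ O1p O2q] /smooth_onP[ oO1 S1] /smooth_onP[ oO2 S2] H1 H2]]]]].
move=> [gq [P1 [P2 [g' [[P1q P2r] /smooth_onP[oP1 T1] /smooth_onP[oP2 T2] K1 K2]]]]].
split; first by rewrite /= fp.
have oA : open [set x | O1 x /\ P1 (f x)].
  by apply: open_preimage => // x; exact: (Ck_continuous (S1 0%N)).
have oB : open [set y | P2 y /\ O2 (g' y)].
  by apply: open_preimage => // x; exact: (Ck_continuous (T2 0%N)).
exists [set x | O1 x /\ P1 (f x)], [set y | P2 y /\ O2 (g' y)], (f' \o g'); split.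
- split; split=> //=; first by rewrite fp.
  by rewrite -gq (K1 q P1q).2.
- apply/smooth_onP; split=> // k.
  apply: (Ck_comp_rV oA oP1 (O' := P1)); first by move=> x [].
    by apply: Ck_subset (S1 k) => x [].
  exact: T1.
- apply/smooth_onP; split=> // k.
  apply: (Ck_comp_rV oB oO2 (O' := O2)); first by move=> x [].
    by apply: Ck_subset (T2 k) => x [].
  exact: S2.
- move=> x [ O1x P1fx] /=; have [a1 a2] := K1 _ P1fx; have [b1 b2] := H1 _ O1x.
  by split; rewrite ?a2 ?b2.
- move=> y [P2y O2y] /=; have [a1 a2] := H2 _ O2y; have [b1 b2] := K2 _ P2y.
  by split; rewrite ?a2 ?b2.
Qed.

Lemma diffeo_germ_continuous n (f : 'rV[R]_n.+1 -> 'rV[R]_n.+1) p q :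
  diffeo_germ f p q -> {for p, continuous f}.
Proof.
move=> [fp [ O1 [ O2 [f' [[ O1p O2q] /smooth_onP[ oO1 S1] _ _ _]]]]].
exact: (Ck_continuous (S1 0%N)).
Qed.

Lemma A_equiv_source n m (G : 'rV[R]_n.+1 -> 'rV[R]_m.+1) (chi : 'rV[R]_n.+1 -> 'rV[R]_n.+1)
   p' p (g : 'rV[R]_n.+1 -> 'rV[R]_m.+1) q :
  diffeo_germ chi p' p -> A_equiv (G \o chi) p' g q -> A_equiv G p g q.
Proof.
move=> Dchi [phi [Phi [Dphi DPhi E]]].
have [xi Dxi [_ K]] := diffeo_germ_inv Dchi.
exists (phi \o xi), Phi; split.
- exact: diffeo_germ_comp Dxi Dphi.
- by move: DPhi; rewrite /= Dchi.1.
have xc := diffeo_germ_continuous Dxi.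
have E0 : nbhs (xi p) (fun z => Phi ((G \o chi) z) = g (phi z)) by rewrite Dxi.1.
have E' : \forall y \near p, Phi ((G \o chi) (xi y)) = g (phi (xi y)) := xc _ E0.
by apply: filterS2 K E' => y /= ->.
Qed.

Definition per (F : 'rV[R]_2 -> R) := forall (x : 'rV[R]_2) i, F (x + (2 * pi) *: delta_mx 0 i) = F x.

Lemma per_derive F v : per F -> per ('D_v F).
Proof.
move=> pF x i; rewrite /derive; set c := _ *: _.
rewrite (_ : (fun h : R => h^-1 *: ((F \o shift (x + c)) (h *: v) - F (x + c))) =
   (fun h : R => h^-1 *: ((F \o shift x) (h *: v) - F x))) //.
by apply/funext => h /=; rewrite addrA !pF.
Qed.

Lemma per_nat F n x i : per F -> F (x + (n%:R * (2 * pi)) *: delta_mx 0 i) = F x.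
Proof.
move=> pF; elim: n => [|n IH]; first by rewrite mul0r scale0r addr0.
by rewrite -natr1 mulrDl mul1r scalerDl addrA pF.
Qed.

Lemma per_int F (z : int) x i : per F -> F (x - (z%:~R * (2 * pi)) *: delta_mx 0 i) = F x.
Proof.
move=> pF; case: z => n.
  by rewrite -[in RHS](subrK ((n%:R * (2 * pi)) *: delta_mx 0 i) x) per_nat // -pmulrn.
by rewrite NegzE mulrNz mulNr scaleNr opprK -pmulrn per_nat.
Qed.

(** Subtracting multiples of the period moves every point into a compact square. *)
Lemma per_bounded F : per F -> (forall x, {for x, continuous F}) ->
  exists2 C, 0 <= C & forall x, `|F x| <= C.
Proof.
move=> pF cF.
pose A : set 'rV[R]_2 := [set x | forall i, `[0, 2 * pi]%classic (x 0 i)].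
have cA : compact A.
  exact (@rV_compact R 2 (fun=> `[0, 2 * pi]%classic) (fun=> @segment_compact R 0 (2 * pi))).
have pi2 : 0 < 2 * pi :> R by rewrite mulr_gt0 // pi_gt0.
have A0 : A !=set0.
  by exists 0 => i; rewrite /= mxE in_itv /= lexx ltW.
have cn : continuous (fun x => `|F x|).
  by move=> x; apply: (continuous_comp (cF x)); exact: norm_continuous.
have [c _ H] := EVT_max_rV A0 cA (continuous_subspaceT cn).
exists `|F c| => // x.
pose d i := Num.floor (x 0 i / (2 * pi)).
pose y := x - ((d 0)%:~R * (2 * pi)) *: delta_mx 0 0 - ((d 1)%:~R * (2 * pi)) *: delta_mx 0 1.
have <- : F y = F x by rewrite /y !per_int.
apply: H; rewrite inE => i.
have yE : y 0 i = x 0 i - (d i)%:~R * (2 * pi).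
  rewrite /y !mxE /=; case: i => [[|[|//]] h] /=; rewrite ?mulr1 ?mulr0 ?subr0;
  congr (_ - _); rewrite -?subr0; (try by congr (x _ _); apply/val_inj);
  by congr ((d _)%:~R * _); apply/val_inj.
have [f1 f2] : (d i)%:~R <= x 0 i / (2 * pi) /\ x 0 i / (2 * pi) < (d i)%:~R + 1.
  by have := floor_le (x 0 i / (2 * pi)); have := floorD1_gt (x 0 i / (2 * pi)); rewrite intrD.
rewrite /= yE in_itv /=; move: f1 f2; rewrite ler_pdivlMr // ltr_pdivrMr // mulrDl mul1r => f1 f2.
by apply/andP; split; lra.
Qed.

(** Periodicity passes to all derivatives, which are therefore bounded on the whole plane; the mean
    value theorem along segments then gives Taylor bounds with uniform constants. *)
Lemma per_TCoo F : Sm setT F -> per F -> TCoo (fun u v => F (mkR2 u v)).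
Proof.
move=> SF pF k; elim: k F SF pF => [|k IH] F SF pF.
  have [C C0 H] := per_bounded pF (fun x => Ck_continuous (SF 0%N) I).
  by exists C.
have SD (G : 'rV[R]_2 -> R) v : Sm setT G -> Sm setT ('D_v G) by move=> SG l; exact: (SG l.+1).2.
have bF G : Sm setT G -> per G -> exists2 C, 0 <= C & forall x, `|G x| <= C.
  by move=> SG pG; exact: per_bounded pG (fun x => Ck_continuous (SG 0%N) I).
split; first by have [C C0 H] := bF F SF pF; exists C.
pose D i := 'D_(delta_mx 0 i) F.
have dG (G : 'rV[R]_2 -> R) x : Sm setT G -> differentiable G x by move=> SG; exact: (SG 1%N).1.
exists (fun u v => D 0 (mkR2 u v)), (fun u v => D 1 (mkR2 u v)).
have I0 := IH (D 0) (SD F _ SF) (per_derive _ pF).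
have I1 := IH (D 1) (SD F _ SF) (per_derive _ pF).
split; [exact: I0|exact: I1|].
have sum2 (G : 'rV[R]_2 -> R) x w : Sm setT G ->
   'D_w G x = w 0 0 * 'D_(delta_mx 0 0) G x + w 0 1 * 'D_(delta_mx 0 1) G x.
  move=> SG; rewrite derive_sumE; last exact: dG.
  rewrite big_ord_recl big_ord1 (_ : lift ord0 ord0 = 1) //.
  exact/val_inj.
have LD i : exists2 L, 0 <= L & forall x y, `|D i y - D i x| <= L * (`|(y - x) 0 0| + `|(y - x) 0 1|).
  have SDi : Sm setT (D i) by exact: SD.
  have [C1 C10 H1] := bF _ (SD _ (delta_mx 0 0) SDi) (per_derive _ (per_derive _ pF)).
  have [C2 C20 H2] := bF _ (SD _ (delta_mx 0 1) SDi) (per_derive _ (per_derive _ pF)).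
  exists (C1 + C2) => [|x y]; first exact: addr_ge0.
  have [|s _ E] := @MVT_unit _ _ (D i) x (y - x).
    by move=> s _; apply: diff_derivable; exact: dG.
  have xyE : x + (y - x) = y by rewrite addrC subrK.
  rewrite xyE in E; rewrite E sum2 //.
  have h1 := H1 (x + s *: (y - x)); have h2 := H2 (x + s *: (y - x)).
  move: h1 h2; move: ('D_(delta_mx 0 0) (D i) _) ('D_(delta_mx 0 1) (D i) _) => d c.
  move: ((y - x) 0 0) ((y - x) 0 1) => a b h1 h2.
  have e := ler_normD (a * d) (b * c); rewrite !normrM in e; apply: (le_trans e).
  have e1 : `|a| * `|d| <= `|a| * C1 by rewrite ler_wpM2l.
  have e2 : `|b| * `|c| <= `|b| * C2 by rewrite ler_wpM2l.
  have e3 : 0 <= `|a| * C2 by rewrite mulr_ge0.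
  have e4 : 0 <= `|b| * C1 by rewrite mulr_ge0.
  lra.
have [L0 L00 H0] := LD 0; have [L1 L10 H1] := LD 1.
exists (2 * (L0 + L1)) => [|u u' s s' _ _]; first by rewrite mulr_ge0 // addr_ge0.
set x := mkR2 u s; set y := mkR2 u' s'.
have [|t /andP[t0 t1] E] := @MVT_unit _ _ F x (y - x).
  by move=> t _; apply: diff_derivable; exact: dG.
have xy : x + (y - x) = y by rewrite addrC subrK.
rewrite xy sum2 // in E.
have w0 : (y - x) 0 0 = u' - u by rewrite !mxE.
have w1 : (y - x) 0 1 = s' - s by rewrite !mxE.
rewrite w0 w1 in E; rewrite E.
set z := x + t *: (y - x) in E *.
have zx i : `|(z - x) 0 i| <= `|(y - x) 0 i|.
  rewrite /z [x + _]addrC addrK mxE normrM ger0_norm //.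
  by rewrite ler_piMl.
have B0 := H0 x z; have B1 := H1 x z.
have Z0 := zx 0; have Z1 := zx 1; rewrite w0 in Z0; rewrite w1 in Z1.
rewrite -/(D 0 z) -/(D 1 z).
move: (D 0 z) (D 0 x) (D 1 z) (D 1 x) B0 B1 => d0z d0x d1z d1x B0 B1.
move: (u' - u) (s' - s) Z0 Z1 {E w0 w1} => a b Z0 Z1.
have -> : a * d0z + b * d1z - a * d0x - b * d1x = a * (d0z - d0x) + b * (d1z - d1x) by ring.
have e := ler_normD (a * (d0z - d0x)) (b * (d1z - d1x)); rewrite !normrM in e; apply: (le_trans e).
have C0 : `|d0z - d0x| <= L0 * (`|a| + `|b|).
  by apply: (le_trans B0); rewrite ler_wpM2l // lerD.
have C1 : `|d1z - d1x| <= L1 * (`|a| + `|b|).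
  by apply: (le_trans B1); rewrite ler_wpM2l // lerD.
have D0 := ler_wpM2l (normr_ge0 a) C0.
have D1 := ler_wpM2l (normr_ge0 b) C1.
rewrite -[a ^+ 2]real_normK ?num_real // -[b ^+ 2]real_normK ?num_real //.
move: (normr_ge0 a) (normr_ge0 b) D0 D1; move: `|a| `|b| => A B A0 B0' D0 D1.
have q : 0 <= (A - B) ^+ 2 by exact: sqr_ge0.
have r0 : A * (L0 * (A + B)) <= L0 * (2 * (A ^+ 2 + B ^+ 2)).
  by rewrite mulrCA ler_wpM2l //; nra.
have r1 : B * (L1 * (A + B)) <= L1 * (2 * (A ^+ 2 + B ^+ 2)).
  by rewrite mulrCA ler_wpM2l //; nra.
lra.
Qed.

End Germs.

(** * Recognition of the cuspidal edge *)

Section OneVar.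
Variable R : realType.

Lemma derive_R1 (V : normedModType R) (f : R -> V) (x v : R) : differentiable f x -> 'D_v f x = v *: 'D_1 f x.
Proof.
by move=> df; rewrite !deriveE // -[v in LHS]mulr1 -[v * 1]/(v *: (1 : R)) linearZ.
Qed.

Lemma Ck_is_derive k (O : set R) (f f' : R -> R) : open O ->
  (forall x, O x -> is_derive x 1 f (f' x)) -> Ck k O f' -> Ck k.+1 O f.
Proof.
move=> oO D Cf'.
have df x : O x -> differentiable f x.
  by move=> Ox; apply/derivable1_diffP; have [] := D x Ox.
split=> // v; have C := CkZ v oO Cf'; apply: Ck_eq C => // x Ox.
have E : 'D_v f x = v *: 'D_1 f x by exact: derive_R1 (df x Ox).
by rewrite E; have [_ ->] := D x Ox.
Qed.

Lemma Ck_sincos k : Ck k [set: R] (@sin R) /\ Ck k [set: R] (@cos R).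
Proof.
elim: k => [|k [IHs IHc]].
  by split=> x _; [exact: continuous_sin|exact: continuous_cos].
split; first by apply: (Ck_is_derive openT _ IHc) => x _; exact: is_derive_sin.
have C := CkZ (-1) openT IHs.
apply: (Ck_is_derive openT _ C) => x _.
by rewrite fctE scaleN1r; exact: is_derive_cos.
Qed.

Lemma Ck_sqrt k : Ck k [set x : R | 0 < x] (@Num.sqrt R).
Proof.
have oO : open [set x : R | 0 < x] by exact: open_gt.
elim: k => [|k IH]; first by move=> x _; exact: sqrt_continuous.
have C : Ck k [set x : R | 0 < x] (fun x => ((2 *: (@Num.sqrt R : R -> R)) x)^-1).
  apply: CkV => //; last exact: CkZ.
  by move=> x /= x0; rewrite gt_eqF // mulr_gt0 // sqrtr_gt0.
by apply: (Ck_is_derive oO _ C) => x x0; exact: is_derive1_sqrt.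
Qed.

Lemma abs_sin_le (x : R) : `|sin x| <= `|x|.
Proof.
have [|s _ E] := @MVT_line R R (@sin R) 0 1 x.
  by move=> s _; exact: derivable_sin.
move: E; rewrite !add0r sin0 subr0 ![_ *: 1]mulr1 => ->.
rewrite normrM; have -> : 'D_1 (@sin R) s = cos s by have [_ ->] := is_derive_sin s.
by rewrite ler_piMr // ler_norml cos_geN1 cos_le1.
Qed.

Lemma sin_sub_le (x : R) : `|sin x - x| <= `|x| ^+ 3.
Proof.
have [|s sx E] := @MVT_line R R (@sin R) 0 1 x.
  by move=> s _; exact: derivable_sin.
move: E; rewrite !add0r sin0 subr0 ![_ *: 1]mulr1.
have -> : 'D_1 (@sin R) s = cos s by have [_ ->] := is_derive_sin s.
move=> ->.
have [|r rs E] := @MVT_line R R (@cos R) 0 1 s.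
  by move=> r _; exact: derivable_cos.
move: E; rewrite !add0r cos0 ![_ *: 1]mulr1.
have -> : 'D_1 (@cos R) r = - sin r by have [_ ->] := is_derive_cos r.
move=> E; have -> : x * cos s - x = x * (s * - sin r) by rewrite -E; ring.
rewrite !normrM normrN exprS ler_wpM2l // expr2 ler_pM //.
by apply: (le_trans (abs_sin_le r)); apply: (le_trans rs).
Qed.

Definition o3 (f : R -> R) := forall e, 0 < e -> \forall v \near 0, `|f v| <= e * `|v| ^+ 3.

Lemma o3D f g : o3 f -> o3 g -> o3 (fun v => f v + g v).
Proof.
move=> of_ og e e0; have e2 : 0 < e / 2 by rewrite divr_gt0.
have A := of_ _ e2; have B := og _ e2; apply: filterS2 A B => v A B.
by apply: (le_trans (ler_normD _ _)); rewrite [e in leRHS]splitr mulrDl lerD.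
Qed.

Lemma o3N f : o3 f -> o3 (fun v => - f v).
Proof. by move=> H e /H; apply: filterS => v; rewrite normrN. Qed.

Lemma near0_lt (e : R) : 0 < e -> \forall v \near (0 : R), `|v| < e.
Proof.
by move=> e0; apply/nbhs_ballP; exists e => //= v; rewrite /ball /= sub0r normrN.
Qed.

Lemma o3_of_le4 f C : 0 <= C -> (forall v, `|v| <= 1 -> `|f v| <= C * `|v| ^+ 4) -> o3 f.
Proof.
move=> C0 H e e0; near=> v; apply: (le_trans (H v _)).
  by apply: ltW; near: v; exact: near0_lt.
have : `|v| < e / (C + 1).
  by near: v; apply: near0_lt; rewrite divr_gt0 // ltr_wpDl.
rewrite ltr_pdivlMr ?ltr_wpDl // => h.
rewrite exprS mulrA ler_wpM2r ?exprn_ge0 //.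
by have := normr_ge0 v; lra.
Unshelve. all: by end_near. Qed.

Lemma eq_o3 f g : f =1 g -> o3 f -> o3 g.
Proof. by move=> /funext ->. Qed.

(** Uniqueness of the jet, used to identify coefficients computed in two ways. *)
Lemma o3_coef x y : o3 (fun v => v ^+ 2 * x + v ^+ 3 * y) -> x = 0 /\ y = 0.
Proof.
move=> H.
have x0 : x = 0.
  have A := H 1 ltr01.
  have [d /= d0 Hd] : exists2 d : R, 0 < d & forall v, `|v| < d -> `|v ^+ 2 * x + v ^+ 3 * y| <= 1 * `|v| ^+ 3.
    move: A => /nbhs_ballP[d /= d0 Hd]; exists d => // v vd; apply: Hd.
    by rewrite /ball /= sub0r normrN.
  apply: contrapT => /eqP xn.
  have nx : 0 < `|x| by rewrite normr_gt0.
  have K0 : 0 < 2 * (1 + `|y|) by rewrite mulr_gt0 // ltr_wpDr.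
  pose v := Num.min (d / 2) (`|x| / (2 * (1 + `|y|))).
  have v0 : 0 < v by rewrite lt_min !divr_gt0.
  have vd : `|v| < d.
    rewrite gtr0_norm //; apply: (@le_lt_trans _ _ (d / 2)); first by rewrite ge_min lexx.
    by rewrite ltr_pdivrMr // ltr_pMr // ltr1n.
  have := Hd v vd; rewrite mul1r (gtr0_norm v0).
  have -> : v ^+ 2 * x + v ^+ 3 * y = v ^+ 2 * (x + v * y) by ring.
  rewrite normrM [`|v ^+ 2|]ger0_norm ?sqr_ge0 // [v ^+ 3]exprSr ler_pM2l ?exprn_gt0 // => h.
  have vx : v * (2 * (1 + `|y|)) <= `|x| by rewrite -ler_pdivlMr // ge_min lexx orbT.
  have h2 : `|x| <= `|x + v * y| + v * `|y|.
    rewrite -{2}(gtr0_norm v0) -normrM; have := ler_normB (x + v * y) (v * y).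
    by rewrite addrK.
  lra.
split=> //; move: H; rewrite x0 => H.
apply: contrapT => /eqP yn; have ny : 0 < `|y| by rewrite normr_gt0.
have /nbhs_ballP[d /= d0 Hd] := H (`|y| / 2) (divr_gt0 ny (ltr0Sn _ 1)).
have v0 : 0 < d / 2 by rewrite divr_gt0.
have vd : d / 2 < d by rewrite ltr_pdivrMr // ltr_pMr // ltr1n.
have := Hd (d / 2); rewrite /ball /= sub0r normrN (gtr0_norm v0) => /(_ vd).
move: (d / 2) v0 => v v0; rewrite mulr0 add0r normrM (gtr0_norm (exprn_gt0 3 v0)).
by rewrite [_ * `|y|]mulrC ler_pM2r ?exprn_gt0 //; lra.
Qed.

Lemma o3_comp_sin f (e : R) : 0 < e -> o3 f -> o3 (fun v => f (e * sin v)).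
Proof.
move=> e0 H c c0.
have /nbhs_ballP[d /= d0 Hd] := H (c / e ^+ 3) (divr_gt0 c0 (exprn_gt0 3 e0)).
apply/nbhs_ballP; exists (d / e); first by rewrite /= divr_gt0.
move=> v; rewrite /ball /= sub0r normrN => vd.
have ev : `|e * sin v| <= e * `|v| by rewrite normrM gtr0_norm // ler_pM2l // abs_sin_le.
have := Hd (e * sin v); rewrite /ball /= sub0r normrN => K.
apply: (le_trans (K _)).
  by apply: (le_lt_trans ev); rewrite mulrC -ltr_pdivlMr.
have : `|e * sin v| ^+ 3 <= (e * `|v|) ^+ 3 by rewrite lerXn2r ?nnegrE // mulr_ge0 // ltW.
move=> /(ler_wpM2l (ltW (divr_gt0 c0 (exprn_gt0 3 e0)))) /le_trans; apply.
by rewrite exprMn mulrA divfK // gt_eqF // exprn_gt0.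
Qed.

End OneVar.

(** * Coordinates of the plane and the periodic substitution *)

Section EdgeCriterion.
Variable R : realType.

Lemma cr0E n (x : 'rV[R]_n.+1) : cr x 0 = x 0 0.
Proof. by rewrite /cr; congr (x _ _); apply/val_inj; rewrite /= inordK. Qed.
Lemma cr1E n (x : 'rV[R]_n.+2) : cr x 1 = x 0 1.
Proof. by rewrite /cr; congr (x _ _); apply/val_inj; rewrite /= inordK. Qed.

Lemma e2_1E : @e2_1 R = delta_mx 0 0.
Proof. by apply/rowP => j; rewrite !mxE; case: j => [[|[|]]]. Qed.
Lemma e2_2E : @e2_2 R = delta_mx 0 1.
Proof. by apply/rowP => j; rewrite !mxE; case: j => [[|[|]]]. Qed.

Lemma mkR2E (x : 'rV[R]_2) : mkR2 (x 0 0) (x 0 1) = x.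
Proof.
by apply/rowP => j; rewrite mxE; case: j => [[|[|//]] h] /=; congr (x _ _); apply/val_inj.
Qed.

Lemma mkR2_0 (u v : R) : (mkR2 u v) 0 0 = u. Proof. by rewrite mxE. Qed.
Lemma mkR2_1 (u v : R) : (mkR2 u v) 0 1 = v. Proof. by rewrite mxE. Qed.

Lemma mkR2_line1 (u v : R) : mkR2 u v = mkR2 0 v + u *: delta_mx 0 0.
Proof. by apply/rowP => j; rewrite !mxE; case: j => [[|[|]]] //= h; rewrite ?mulr1 ?mulr0 ?add0r ?addr0. Qed.
Lemma mkR2_line2 (u v : R) : mkR2 u v = mkR2 u 0 + v *: delta_mx 0 1.
Proof. by apply/rowP => j; rewrite !mxE; case: j => [[|[|]]] //= h; rewrite ?mulr1 ?mulr0 ?add0r ?addr0. Qed.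

Lemma mkR2_00 : mkR2 0 0 = 0 :> 'rV[R]_2.
Proof. by apply/rowP => j; rewrite !mxE; case: ifP. Qed.

Lemma derive_slice1 (V : normedModType R) (F : 'rV[R]_2 -> V) (u v : R) :
  'D_1 (fun u => F (mkR2 u v)) u = 'D_(delta_mx 0 0) F (mkR2 u v).
Proof.
rewrite [in RHS]mkR2_line1 -derive_lineE; congr ('D_1 _ u); apply/funext => w.
by rewrite [in LHS]mkR2_line1.
Qed.

Lemma derive_slice2 (V : normedModType R) (F : 'rV[R]_2 -> V) (u v : R) :
  'D_1 (fun v => F (mkR2 u v)) v = 'D_(delta_mx 0 1) F (mkR2 u v).
Proof.
rewrite [in RHS]mkR2_line2 -derive_lineE; congr ('D_1 _ v); apply/funext => w.
by rewrite [in LHS]mkR2_line2.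
Qed.

Lemma derive_comp_rV (U V : normedModType R) n (f : U -> 'rV[R]_n.+1) (g : 'rV[R]_n.+1 -> V) x v :
  differentiable f x -> differentiable g (f x) -> 'D_v (g \o f) x = 'D_('D_v f x) g (f x).
Proof.
move=> df dg; rewrite !deriveE //; last exact: differentiable_comp.
by rewrite diff_comp.
Qed.

Section Sigma.
Variable e : R.
Hypothesis e0 : 0 < e.
(* Precomposing with [e * sin] makes a germ globally defined and bounded together with all its derivatives. *)
Definition sinmap (x : 'rV[R]_2) : 'rV[R]_2 := mkR2 (e * sin (x 0 0)) (e * sin (x 0 1)).

Lemma Ck_sinmap k : Ck k setT sinmap.
Proof.
have oT2 : open [set: 'rV[R]_2] by exact: openT.
have C i : Ck k setT (fun x : 'rV[R]_2 => e * sin (x 0 i)).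
  have C1 : Ck k setT (fun x : 'rV[R]_2 => x 0 i : R).
    exact (Ck_linear (f := coordm i) k setT (@coordm_continuous R 1 i)).
  have C2 := Ck_comp_R oT2 (fun _ _ => I) C1 (Ck_sincos R k).1.
  exact (CkZ e oT2 C2).
apply/(Ck_coordP _ _ oT2) => i.
by apply: Ck_eq (C i) => // x _; rewrite mxE; case: i => [[|[|//]] h] /=; congr (_ * sin (x _ _)); apply/val_inj.
Qed.

Lemma sinmap0 : sinmap 0 = 0.
Proof. by rewrite /sinmap !mxE sin0 mulr0 mkR2_00. Qed.

Lemma sinmap_line2 u (t : R) : sinmap (mkR2 u t) = mkR2 (e * sin u) (e * sin t).
Proof. by rewrite /sinmap mkR2_0 mkR2_1. Qed.

Lemma D_sinmap x v : 'D_v sinmap x = mkR2 (e * (cos (x 0 0) * v 0 0)) (e * (cos (x 0 1) * v 0 1)).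
Proof.
have ds : differentiable sinmap x by exact: (Ck_sinmap 1).1.
have D i : 'D_v (fun x : 'rV[R]_2 => e * sin (x 0 i)) x = e * (cos (x 0 i) * v 0 i).
  rewrite -[x]addr0 -(scale0r v) -derive_lineE.
  have d : is_derive (0 : R) 1 (fun s : R => x 0 i + s * v 0 i) (v 0 i).
    apply: (@quad_is_derive _ _ _ _ 0) => d.
    by rewrite mul0r add0r [X in `|X|](_ : _ = 0) ?normr0 ?mul0r //; ring.
  have d2 := is_derive_sin (x 0 i + 0 * v 0 i).
  have d3 := @is_derive1_comp R (@sin R) (fun s : R => x 0 i + s * v 0 i) 0 _ _ d2 d.
  have [h1 h2] := d3.
  have -> : (fun s : R => e * sin ((x + s *: v) 0 i)) = e *: (@sin R \o (fun s : R => x 0 i + s * v 0 i)).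
    by apply/funext => s; rewrite fctE !mxE.
  by rewrite (deriveZ _ h1) h2 !mxE mul0r addr0.
apply/rowP => j; rewrite derive_coord; last exact: diff_derivable.
rewrite [RHS]mxE; case: j => [[|[|//]] h] /=.
  rewrite -D; congr ('D_v _ x); apply/funext => y; rewrite mxE //=.
rewrite -D; congr ('D_v _ x); apply/funext => y; rewrite mxE //=.
Qed.

Lemma sinmap_germ : diffeo_germ sinmap 0 0.
Proof.
rewrite -{2}sinmap0; apply: (@inverse_function R 1 sinmap setT 0 openT I).
  exact: Ck_sinmap.
move=> v; rewrite D_sinmap !mxE cos0 !mul1r => /rowP E.
have E0 := E 0; have E1 := E 1; rewrite !mxE /= in E0 E1.
rewrite -(mkR2E v); have -> : v 0 0 = 0.
  by apply/eqP; move/eqP: E0; rewrite mulf_eq0 gt_eqF.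
have -> : v 0 1 = 0.
  by apply/eqP; move/eqP: E1; rewrite mulf_eq0 gt_eqF.
exact: mkR2_00.
Qed.

Lemma sinmap_per (K : 'rV[R]_2 -> R) : per (K \o sinmap).
Proof.
move=> x i /=; congr K; rewrite /sinmap !mxE.
have S (y : R) (b : bool) : sin (y + 2 * pi * b%:R) = sin y.
  by case: b; rewrite ?mulr1 ?mulr0 ?addr0 // [2 * pi]mulr_natl sinD2pi.
by rewrite /= !S.
Qed.
End Sigma.
End EdgeCriterion.

(** * Factoring a germ through the standard cuspidal edge *)

Section EdgeMain.
Variable R : realType.

Lemma mkR3_0 (x y z : R) : (mkR3 x y z) 0 0 = x. Proof. by rewrite mxE. Qed.
Lemma mkR3_1 (x y z : R) : (mkR3 x y z) 0 1 = y. Proof. by rewrite mxE. Qed.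
Lemma mkR3_2 (x y z : R) : (mkR3 x y z) 0 ord_max = z. Proof. by rewrite mxE. Qed.

Lemma I3_ind (P : 'I_3 -> Prop) : P 0 -> P 1 -> P ord_max -> forall i, P i.
Proof.
move=> p0 p1 p2 [[|[|[|//]]] h].
- by rewrite (_ : Ordinal h = 0) //; exact/val_inj.
- by rewrite (_ : Ordinal h = 1) //; exact/val_inj.
- by rewrite (_ : Ordinal h = ord_max) //; exact/val_inj.
Qed.

Lemma derive_sum3 (V : normedModType R) (F : 'rV[R]_3 -> V) x w : differentiable F x ->
  'D_w F x = w 0 0 *: 'D_(delta_mx 0 0) F x + w 0 1 *: 'D_(delta_mx 0 1) F x
     + w 0 ord_max *: 'D_(delta_mx 0 ord_max) F x.
Proof.
move=> dF; rewrite (derive_sumE _ dF) !big_ord_recl big_ord0 addr0 addrA.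
rewrite (_ : lift ord0 ord0 = 1); last exact/val_inj.
by rewrite (_ : lift ord0 (lift ord0 ord0) = ord_max) //; exact/val_inj.
Qed.

Section Construct.
Variables (O : set 'rV[R]_2) (K : 'rV[R]_2 -> 'rV[R]_3) (a b : 'rV[R]_3).
Hypotheses (oO : open O) (O0 : O 0) (SK : Sm O K).
Hypothesis Kv0 : forall u, O (mkR2 u 0) -> 'D_(delta_mx 0 1) K (mkR2 u 0) = 0.
Hypothesis Kexp : forall i, o3 (fun v => (K (mkR2 0 v) - K 0) 0 i - (v ^+ 2 * a 0 i + v ^+ 3 * b 0 i)).
Hypothesis Kind : forall x y z : R, x *: 'D_(delta_mx 0 0) K 0 + y *: a + z *: b = 0 ->
  [/\ x = 0, y = 0 & z = 0].

Variable e : R.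
Hypothesis e0 : 0 < e.
Hypothesis He : forall x : 'rV[R]_2, `|x| <= e -> O x.

Let sg := sinmap e.
Let F : 'rV[R]_2 -> 'rV[R]_3 := K \o sg.
Let oT2 : open [set: 'rV[R]_2]. Proof. exact: openT. Qed.

Let Osg x : O (sg x).
Proof.
apply: He; apply: norm_le_coord => [|i]; first exact: ltW.
have S y : `|e * sin y| <= e.
  by rewrite normrM gtr0_norm // ler_piMr ?(ltW e0) // ler_norml sin_geN1 sin_le1.
by rewrite mxE; case: ifP.
Qed.

Let SF : Sm setT F.
Proof.
by move=> k; apply: (Ck_comp_rV oT2 oO (O' := O)) => //; exact: Ck_sinmap.
Qed.

Let Fi i (x : 'rV[R]_2) : R := F x 0 i.
Let SFi i : Sm setT (Fi i). Proof. by move=> k; exact: ((Ck_coordP _ _ oT2).1 (SF k) i). Qed.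
Let dF x : differentiable F x. Proof. exact: (SF 1%N).1. Qed.
Let dFi i x : differentiable (Fi i) x. Proof. exact: (SFi i 1%N).1. Qed.

Let f i u v := Fi i (mkR2 u v).

Let DF x v : 'D_v F x = 'D_('D_v sg x) K (sg x).
Proof.
apply: derive_comp_rV; first exact: (Ck_sinmap e 1).1.
exact: ((SK 1%N).1 _ (Osg x)).
Qed.

Let Tf i : TCoo (f i).
Proof.
by apply: per_TCoo; [exact: SFi|exact: (sinmap_per e (fun y => K y 0 i))].
Qed.

Let fv0 i u f1 f2 : tay setT (f i) f1 f2 -> f2 u 0 = 0.
Proof.
move=> T; have [_ <-] := tay_derive2 u 0 T.
rewrite /f derive_slice2.
have -> : 'D_(delta_mx 0 1) (Fi i) (mkR2 u 0) = ('D_(delta_mx 0 1) F (mkR2 u 0)) 0 i.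
  by rewrite derive_coord //; exact: diff_derivable.
rewrite DF D_sinmap !mxE /= mulr0 mulr0 cos0 mulr1 mulr1.
have sE : sg (mkR2 u 0) = mkR2 (e * sin u) 0.
  by rewrite /sg sinmap_line2 sin0 mulr0.
rewrite sE; have -> : mkR2 0 e = e *: (delta_mx 0 1 : 'rV[R]_2).
  by rewrite mkR2_line2 mkR2_00 add0r.
have dK : differentiable K (mkR2 (e * sin u) 0) by apply: (SK 1%N).1; rewrite -sE.
rewrite deriveE // linearZ /= -deriveE // Kv0 ?scaler0 ?mxE //.
by rewrite -sE.
Qed.

Let gg_exists : exists gg : 'I_3 -> (R -> R -> R) * (R -> R -> R), forall i,
  [/\ TCoo (gg i).1, TCoo (gg i).2 &
    forall u v, f i u v = (gg i).1 u (v ^+ 2) + v ^+ 3 * (gg i).2 u (v ^+ 2)].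
Proof.
have /choice[gg Hgg] : forall i, exists g : (R -> R -> R) * (R -> R -> R), [/\ TCoo g.1, TCoo g.2 &
    forall u v, f i u v = g.1 u (v ^+ 2) + v ^+ 3 * g.2 u (v ^+ 2)].
  move=> i; have [f1 [f2 [_ _ T]]] := TCoo_tay (Tf i).
  have [ge [go [h1 h2 h3]]] := whitney_cusp (Tf i) T (fun u => fv0 u T).
  by exists (ge, go).
by exists gg.
Qed.

Section WithG.
Variable gg : 'I_3 -> (R -> R -> R) * (R -> R -> R).
Hypothesis Hgg : forall i, [/\ TCoo (gg i).1, TCoo (gg i).2 &
    forall u v, f i u v = (gg i).1 u (v ^+ 2) + v ^+ 3 * (gg i).2 u (v ^+ 2)].
Let ge i := (gg i).1.
Let go i := (gg i).2.

(* The target diffeomorphism: [F (u, v) = Psi (u, v ^ 2, v ^ 3)]. *)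
Let Psi (p : 'rV[R]_3) : 'rV[R]_3 :=
  \row_i (ge i (p 0 0) (p 0 1) + p 0 ord_max * go i (p 0 0) (p 0 1)).

Let oT3 : open [set: 'rV[R]_3]. Proof. exact: openT. Qed.

Let SPsi : Sm setT Psi.
Proof.
move=> k; apply/(Ck_coordP _ _ oT3) => i.
have Cc j : Ck k setT (fun p : 'rV[R]_3 => p 0 j : R).
  exact (Ck_linear (f := coordm j) k setT (@coordm_continuous R 2 j)).
have Cm : Ck k setT (fun p : 'rV[R]_3 => mkR2 (p 0 0) (p 0 1) : 'rV[R]_2).
  apply/(Ck_coordP _ _ oT3) => j.
  case: j => [[|[|//]] h]; [apply: Ck_eq (Cc 0)|apply: Ck_eq (Cc 1)] => // p _; rewrite mxE //.
have C2 (g : R -> R -> R) : TCoo g -> Ck k setT (fun p : 'rV[R]_3 => g (p 0 0) (p 0 1)).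
  move=> Tg; have := Ck_comp_rV1 oT3 (fun _ _ => I) Cm (TC_Ck (Tg k.+1)).
  by apply: Ck_eq => // p _; rewrite /= mkR2_0 mkR2_1.
have [T1 T2 _] := Hgg i.
have C := CkD oT3 (C2 _ T1) (CkM oT3 (Cc ord_max) (C2 _ T2)).
by apply: Ck_eq C => // p _; rewrite mxE.
Qed.

Let dPsi p : differentiable Psi p. Proof. exact: (SPsi 1%N).1. Qed.

Let Psi_edge p : Psi (cuspidal_edge_model p) = F p.
Proof.
apply/rowP => i; rewrite mxE /cuspidal_edge_model mkR3_0 mkR3_1 mkR3_2 /u_ /v_ cr0E cr1E.
have [_ _ H] := Hgg i.
by rewrite -H /f /Fi mkR2E.
Qed.

Let edge0 : @cuspidal_edge_model R 0 = 0.
Proof.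
apply/rowP; rewrite /cuspidal_edge_model /u_ /v_ cr0E cr1E; apply: I3_ind;
  by rewrite ?mkR3_0 ?mkR3_1 ?mkR3_2 !mxE // expr0n.
Qed.

Let Psi0 : Psi 0 = K 0.
Proof. by rewrite -edge0 Psi_edge /F /= /sg sinmap0. Qed.

Let DPsi_coord w i : ('D_w Psi 0) 0 i = 'D_1 (fun s : R => Psi (s *: w) 0 i) (0 : R).
Proof.
rewrite derive_coord; last exact: diff_derivable.
have H := derive_lineE (fun p => Psi p 0 i : R) 0 w 0.
rewrite scale0r addr0 in H; rewrite -H.
by congr ('D_1 _ (0 : R)); apply/funext => s; rewrite add0r.
Qed.

Let DPsi0 : 'D_(delta_mx 0 0) Psi 0 = e *: 'D_(delta_mx 0 0) K 0.
Proof.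
apply/rowP => i; rewrite DPsi_coord.
have -> : (fun s : R => Psi (s *: delta_mx 0 0) 0 i) = (fun s : R => Fi i (mkR2 s 0)).
  apply/funext => s; rewrite /Fi -Psi_edge; congr (Psi _ 0 i).
  apply/rowP; rewrite /cuspidal_edge_model /u_ /v_ cr0E cr1E mkR2_0 mkR2_1; apply: I3_ind;
  by rewrite ?mkR3_0 ?mkR3_1 ?mkR3_2 !mxE /= ?mulr1 ?mulr0 ?expr0n.
rewrite derive_slice1 mkR2_00.
have -> : 'D_(delta_mx 0 0) (Fi i) 0 = ('D_(delta_mx 0 0) F 0) 0 i.
  by rewrite derive_coord //; exact: diff_derivable.
rewrite DF D_sinmap /sg sinmap0 !mxE /= cos0 !mulr1 !mulr0.
have -> : mkR2 e 0 = e *: (delta_mx 0 0 : 'rV[R]_2).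
  by rewrite mkR2_line1 mkR2_00 add0r.
have dK : differentiable K 0 by exact: (SK 1%N).1.
by rewrite deriveE // linearZ /= -deriveE // mxE.
Qed.

(** The i-th coordinate on u = 0 has two third order expansions in v: one from the even and odd
    parts of Whitney's decomposition, one from the assumed jet of K along v |-> e sin v. Comparing
    them identifies the partial derivatives of [Psi]. *)
Let coefs i : ('D_(delta_mx 0 1) Psi 0) 0 i = e ^+ 2 * a 0 i /\
  ('D_(delta_mx 0 ord_max) Psi 0) 0 i = e ^+ 3 * b 0 i.
Proof.
have [T1 T2 H] := Hgg i.
have [g1 [g2 [_ _ T]]] := TCoo_tay T1.
have D1 : ('D_(delta_mx 0 1) Psi 0) 0 i = g2 0 0.
  rewrite DPsi_coord; have [_ <-] := tay_derive2 0 0 T.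
  congr ('D_1 _ (0 : R)); apply/funext => s.
  by rewrite !mxE /= ?mulr1 ?mulr0 mul0r addr0.
have D2 : ('D_(delta_mx 0 ord_max) Psi 0) 0 i = go i 0 0.
  rewrite DPsi_coord.
  have D : is_derive (0 : R) 1 (fun s : R => Psi (s *: delta_mx 0 ord_max) 0 i) (go i 0 0).
    apply: (@quad_is_derive _ _ _ _ 0) => d.
    rewrite !mxE /= !mulr1 !mulr0; move: (ge i 0 0) (go i 0 0) => x y.
    have -> : x + (0 + d) * y - (x + 0 * y) - d * y = 0 by ring.
    by rewrite normr0 mul0r.
  by have [_ ->] := D.
have [C C0 S] := tay_slices T.
have [L L0 HL] := TC_lip (T2 1%N).
(* The even part is expanded to first order in v^2 and the odd factor is Lipschitz in v^2: the error
   is O(v^4). *)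
have E1 : o3 (fun v => f i 0 v - f i 0 0 - (v ^+ 2 * g2 0 0 + v ^+ 3 * go i 0 0)).
  apply: (@o3_of_le4 _ _ (C + L)) => [|v v1]; first exact: addr_ge0.
  have [_ S1] := S 0 0 (v ^+ 2); rewrite add0r in S1.
  have L1 := HL 0 0 0 (v ^+ 2) I I; rewrite !subrr normr0 add0r subr0 in L1.
  rewrite !H expr0n /= [0 ^+ 3]expr0n /= mul0r addr0.
  have -> : (gg i).1 0 (v ^+ 2) + v ^+ 3 * (gg i).2 0 (v ^+ 2) - (gg i).1 0 0 - (v ^+ 2 * g2 0 0 + v ^+ 3 * go i 0 0)
    = ((gg i).1 0 (v ^+ 2) - (gg i).1 0 0 - v ^+ 2 * g2 0 0) + v ^+ 3 * ((gg i).2 0 (v ^+ 2) - (gg i).2 0 0).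
    by rewrite /go; ring.
  apply: (le_trans (ler_normD _ _)); rewrite mulrDl lerD //.
    have v4 : (v ^+ 2) ^+ 2 = `|v| ^+ 4 by rewrite (exprM `|v| 2 2) real_normK ?num_real.
    by rewrite -v4.
  rewrite normrX in L1; rewrite normrM normrX; apply: (le_trans (ler_wpM2l (exprn_ge0 3 (normr_ge0 v)) L1)).
  rewrite mulrCA ler_wpM2l // -exprD -[leRHS]mul1r exprS ler_wpM2r ?exprn_ge0 //.
have E2 : o3 (fun v => f i 0 v - f i 0 0 - (v ^+ 2 * (e ^+ 2 * a 0 i) + v ^+ 3 * (e ^+ 3 * b 0 i))).
  have A := o3_comp_sin e0 (Kexp i).
  (* As sin v - v is O(v^3), replacing sin v by v in terms of degree two and three costs only
     O(v^4). *)
  have B : o3 (fun v => ((e * sin v) ^+ 2 * a 0 i + (e * sin v) ^+ 3 * b 0 i) -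
     (v ^+ 2 * (e ^+ 2 * a 0 i) + v ^+ 3 * (e ^+ 3 * b 0 i))).
    apply: (@o3_of_le4 _ _ (2 * (e ^+ 2 * `|a 0 i|) + 3 * (e ^+ 3 * `|b 0 i|))).
      by rewrite addr_ge0 // !mulr_ge0 // ?exprn_ge0 // ltW.
    move=> v v1; have s1 := sin_sub_le v; have s2 := abs_sin_le v.
    move: (sin v) s1 s2 => s s1 s2.
    have -> : (e * s) ^+ 2 * a 0 i + (e * s) ^+ 3 * b 0 i - (v ^+ 2 * (e ^+ 2 * a 0 i) + v ^+ 3 * (e ^+ 3 * b 0 i)) =
      (s - v) * (s + v) * (e ^+ 2 * a 0 i) + (s - v) * (s ^+ 2 + s * v + v ^+ 2) * (e ^+ 3 * b 0 i) by ring.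
    have nE n x : `|e ^+ n * x| = e ^+ n * `|x|.
      by rewrite normrM (ger0_norm (exprn_ge0 n (ltW e0))).
    rewrite -!nE; move: (e ^+ 2 * a 0 i) (e ^+ 3 * b 0 i) => x y.
    have P1 : `|s + v| <= 2 * `|v| by rewrite mulr_natl mulr2n; apply: (le_trans (ler_normD _ _)); exact: lerD.
    have P2 : `|s ^+ 2 + s * v + v ^+ 2| <= 3 * `|v| ^+ 2.
      have k1 := ler_normD (s ^+ 2 + s * v) (v ^+ 2).
      have k2 := ler_normD (s ^+ 2) (s * v).
      have h1 : `|s ^+ 2| <= `|v| ^+ 2 by rewrite normrX lerXn2r.
      have h2 : `|s * v| <= `|v| ^+ 2 by rewrite normrM expr2 ler_wpM2r.
      have h3 : `|v ^+ 2| <= `|v| ^+ 2 by rewrite normrX.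
      have -> : 3 * `|v| ^+ 2 = `|v| ^+ 2 + `|v| ^+ 2 + `|v| ^+ 2 by ring.
      exact: (le_trans k1 (lerD (le_trans k2 (lerD h1 h2)) h3)).
    have Q1 : `|(s - v) * (s + v)| <= 2 * `|v| ^+ 4.
      rewrite normrM; apply: (le_trans (ler_pM (normr_ge0 _) (normr_ge0 _) s1 P1)).
      by rewrite le_eqVlt; apply/orP; left; apply/eqP; ring.
    have Q2 : `|(s - v) * (s ^+ 2 + s * v + v ^+ 2)| <= 3 * `|v| ^+ 4.
      rewrite normrM; apply: (le_trans (ler_pM (normr_ge0 _) (normr_ge0 _) s1 P2)).
      have v4 : `|v| ^+ 5 <= `|v| ^+ 4 by rewrite exprS ler_piMl ?exprn_ge0.
      have -> : `|v| ^+ 3 * (3 * `|v| ^+ 2) = 3 * `|v| ^+ 5 by ring.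
      by rewrite ler_wpM2l.
    have e1 := ler_normD ((s - v) * (s + v) * x) ((s - v) * (s ^+ 2 + s * v + v ^+ 2) * y).
    apply: (le_trans e1); rewrite [leRHS]mulrDl; apply: lerD.
      by rewrite normrM; apply: (le_trans (ler_wpM2r (normr_ge0 x) Q1)); rewrite mulrAC.
    by rewrite normrM; apply: (le_trans (ler_wpM2r (normr_ge0 y) Q2)); rewrite mulrAC.
  apply: eq_o3 (o3D A B) => v /=.
  have fE t : f i 0 t = K (mkR2 0 (e * sin t)) 0 i.
    by rewrite /f /Fi /F /= /sg sinmap_line2 sin0 mulr0.
  rewrite !fE sin0 mulr0 mkR2_00 !mxE; ring.
have E := o3D E1 (o3N E2).
have {}E : o3 (fun v => v ^+ 2 * (e ^+ 2 * a 0 i - g2 0 0) + v ^+ 3 * (e ^+ 3 * b 0 i - go i 0 0)).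
  by apply: eq_o3 E => v /=; ring.
have [z1 z2] := o3_coef E.
by split; [exact (etrans D1 (esym (subr0_eq z1)))|exact (etrans D2 (esym (subr0_eq z2)))].
Qed.

Let Psi_germ : diffeo_germ Psi 0 (K 0).
Proof.
rewrite -Psi0; apply: (@inverse_function R 2 Psi setT 0 oT3 I SPsi) => w.
rewrite derive_sum3 // DPsi0.
have -> : 'D_(delta_mx 0 1) Psi 0 = e ^+ 2 *: a by apply/rowP => i; rewrite (coefs i).1 mxE.
have -> : 'D_(delta_mx 0 ord_max) Psi 0 = e ^+ 3 *: b by apply/rowP => i; rewrite (coefs i).2 mxE.
rewrite !scalerA => /Kind[z0 z1 z2].
have Z n x : x * e ^+ n = 0 -> x = 0.
  by move/eqP; rewrite mulf_eq0 [e ^+ n == 0]gt_eqF ?exprn_gt0 // orbF => /eqP.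
apply/rowP; apply: I3_ind; rewrite [RHS]mxE; [exact: (Z 1%N _ z0)|exact: (Z _ _ z1)|exact: (Z _ _ z2)].
Qed.

(** Since [Psi] composed with the model is [F], the inverse germ of [Psi] and the identity of the
    source form an equivalence. *)
Lemma edge_equiv_aux : A_equiv K 0 (@cuspidal_edge_model R) 0.
Proof.
apply: (A_equiv_source (sinmap_germ e0)).
have [Phi DPhi [H _]] := diffeo_germ_inv Psi_germ.
exists idfun, Phi; split.
- split=> //; exists setT, setT, idfun; split=> //; apply/smooth_onP; split=> // k;
  by apply: Ck_linear; exact: linear_rV_continuous.
- by rewrite /= -/sg /sg sinmap0 edge0.
have Ec : {for (0 : 'rV[R]_2), continuous (@cuspidal_edge_model R)}.
  have C : Ck 0 setT (@cuspidal_edge_model R).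
    apply/(Ck_coordP _ _ oT2); rewrite /cuspidal_edge_model.
    have Cc j : Ck 0 setT (fun p : 'rV[R]_2 => p 0 j : R).
      exact (Ck_linear (f := coordm j) 0 setT (@coordm_continuous R 1 j)).
    have C2 := CkM oT2 (Cc 1) (Cc 1). have C3 := CkM oT2 C2 (Cc 1).
    apply: I3_ind.
    + by apply: Ck_eq (Cc 0) => // p _; rewrite mkR3_0 /u_ cr0E.
    + by apply: Ck_eq C2 => // p _; rewrite mkR3_1 /v_ cr1E expr2.
    + by apply: Ck_eq C3 => // p _; rewrite mkR3_2 /v_ cr1E !exprS expr0 mulr1 mulrA.
  exact: C.
have H0 : nbhs (@cuspidal_edge_model R 0) (fun x => Phi (Psi x) = x) by rewrite edge0.
have N : \forall x \near (0 : 'rV[R]_2), Phi (Psi (cuspidal_edge_model x)) = cuspidal_edge_model x := Ec _ H0.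
by apply: filterS N => x; rewrite Psi_edge.
Qed.

End WithG.

Lemma edge_equiv : A_equiv K 0 (@cuspidal_edge_model R) 0.
Proof. by have [gg Hgg] := gg_exists; exact: edge_equiv_aux Hgg. Qed.

End Construct.

(** The vanishing of the v-derivative on v = 0 makes every coordinate a smooth function of (u, v^2,
    v^3). Up to powers of the scale of the substitution, K_u, a and b are the partial derivatives of
    that function at 0, so their independence is what the inverse function theorem requires. *)
Theorem edge_criterion (O : set 'rV[R]_2) (K : 'rV[R]_2 -> 'rV[R]_3) (a b : 'rV[R]_3) :
  open O -> O 0 -> Sm O K ->
  (forall u, O (mkR2 u 0) -> 'D_(delta_mx 0 1) K (mkR2 u 0) = 0) ->
  (forall i, o3 (fun v => (K (mkR2 0 v) - K 0) 0 i - (v ^+ 2 * a 0 i + v ^+ 3 * b 0 i))) ->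
  (forall x y z : R, x *: 'D_(delta_mx 0 0) K 0 + y *: a + z *: b = 0 -> [/\ x = 0, y = 0 & z = 0]) ->
  A_equiv K 0 (@cuspidal_edge_model R) 0.
Proof.
move=> oO O0 SK Kv0 Kexp Kind.
have /nbhs_ballP[d /= d0 Hd] := open_nbhs_nbhs (conj oO O0).
have e0 : 0 < d / 2 by rewrite divr_gt0.
apply: (edge_equiv oO O0 SK Kv0 Kexp Kind e0) => x xd.
apply: Hd; rewrite -ball_normE /ball_ /= sub0r normrN; apply: (le_lt_trans xd).
by rewrite ltr_pdivrMr // ltr_pMr // ltr1n.
Qed.

End EdgeMain.

(** * Minkowski space *)

Section Lorentz.
Variable R : realType.
Implicit Types (x y z : 'rV[R]_4).

Lemma cr_mkR4 (x0 x1 x2 x3 : R) k : (k < 4)%N -> cr (mkR4 x0 x1 x2 x3) k = [:: x0; x1; x2; x3]`_k.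
Proof. by move=> k4; rewrite /cr mxE inordK. Qed.

Lemma crD x y k : cr (x + y) k = cr x k + cr y k. Proof. by rewrite /cr mxE. Qed.
Lemma crZ (c : R) x k : cr (c *: x) k = c * cr x k. Proof. by rewrite /cr mxE. Qed.
Lemma crN x k : cr (- x) k = - cr x k. Proof. by rewrite /cr mxE. Qed.

Lemma cr_inj x y : (forall k, (k < 4)%N -> cr x k = cr y k) -> x = y.
Proof.
move=> H; apply/rowP => j; have := H j (ltn_ord j); rewrite /cr.
by rewrite (_ : inord j = j) //; apply/val_inj; rewrite /= inordK.
Qed.

Lemma lorC x y : lor x y = lor y x. Proof. rewrite /lor; ring. Qed.
Lemma lorDl x y z : lor (x + y) z = lor x z + lor y z.
Proof. rewrite /lor !crD; ring. Qed.
Lemma lorDr x y z : lor z (x + y) = lor z x + lor z y.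
Proof. by rewrite lorC lorDl ![lor _ z]lorC. Qed.
Lemma lorZl c x z : lor (c *: x) z = c * lor x z.
Proof. rewrite /lor !crZ; ring. Qed.
Lemma lorZr c x z : lor z (c *: x) = c * lor z x.
Proof. by rewrite lorC lorZl lorC. Qed.
Lemma lorNl x z : lor (- x) z = - lor x z.
Proof. rewrite /lor !crN; ring. Qed.
Lemma lor0l z : lor 0 z = 0.
Proof. by rewrite -(scale0r (0 : 'rV[R]_4)) lorZl mul0r. Qed.

Lemma wedge_orth1 x y z : lor (wedge x y z) x = 0.
Proof. rewrite /lor /wedge !cr_mkR4 //= /det3; ring. Qed.
Lemma wedge_orth2 x y z : lor (wedge x y z) y = 0.
Proof. rewrite /lor /wedge !cr_mkR4 //= /det3; ring. Qed.
Lemma wedge_orth3 x y z : lor (wedge x y z) z = 0.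
Proof. rewrite /lor /wedge !cr_mkR4 //= /det3; ring. Qed.

(** The Lorentzian Gram identity. The Gram matrix of gamma, v1, v2 is diagonal with entries -1, 1,
    1, so [mu] comes out as a unit spacelike vector. *)
Lemma wedge_norm x y z : lor (wedge x y z) (wedge x y z) =
  - det3 (lor x x) (lor x y) (lor x z) (lor x y) (lor y y) (lor y z) (lor x z) (lor y z) (lor z z).
Proof.
rewrite /lor /wedge !cr_mkR4 //= /det3.
move: (cr x 0) (cr x 1) (cr x 2) (cr x 3) (cr y 0) (cr y 1) (cr y 2) (cr y 3)
  (cr z 0) (cr z 1) (cr z 2) (cr z 3) => *; ring.
Qed.

Record lframe (e0 e1 e2 e3 : 'rV[R]_4) : Prop := LFrame {
  lf00 : lor e0 e0 = -1; lf11 : lor e1 e1 = 1; lf22 : lor e2 e2 = 1; lf33 : lor e3 e3 = 1;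
  lf01 : lor e0 e1 = 0; lf02 : lor e0 e2 = 0; lf03 : lor e0 e3 = 0;
  lf12 : lor e1 e2 = 0; lf13 : lor e1 e3 = 0; lf23 : lor e2 e3 = 0 }.

Let eta : 'M[R]_4 := diag_mx (mkR4 (-1) 1 1 1).

Let lorE x y : lor x y = (x *m eta *m y^T) 0 0.
Proof.
rewrite /lor /eta mul_mx_diag mxE !big_ord_recl big_ord0 !mxE /= /cr.
have i0 : inord 0 = ord0 :> 'I_4 by apply/val_inj; rewrite /= inordK.
have i1 : inord 1 = lift ord0 ord0 :> 'I_4 by apply/val_inj; rewrite /= inordK.
have i2 : inord 2 = lift ord0 (lift ord0 ord0) :> 'I_4 by apply/val_inj; rewrite /= inordK.
have i3 : inord 3 = lift ord0 (lift ord0 (lift ord0 ord0)) :> 'I_4 by apply/val_inj; rewrite /= inordK.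
by rewrite i0 i1 i2 i3; ring.
Qed.

Lemma I4_ind (P : 'I_4 -> Prop) : P (inord 0) -> P (inord 1) -> P (inord 2) -> P (inord 3) -> forall i, P i.
Proof.
move=> p0 p1 p2 p3 i; rewrite (_ : i = inord i); last by apply/val_inj; rewrite /= inordK.
by case: i => [[|[|[|[|//]]]] h].
Qed.

(** The matrix B with the frame as rows satisfies B eta B^T = eta, hence is invertible, and the four
    products with y are the entries of y eta B^T. *)
Lemma lframe_nondeg e0 e1 e2 e3 : lframe e0 e1 e2 e3 -> forall y,
  lor y e0 = 0 -> lor y e1 = 0 -> lor y e2 = 0 -> lor y e3 = 0 -> y = 0.
Proof.
move=> [h00 h11 h22 h33 h01 h02 h03 h12 h13 h23] y y0 y1 y2 y3.
pose e (i : 'I_4) : 'rV[R]_4 := nth 0 [:: e0; e1; e2; e3] i.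
pose B : 'M[R]_4 := \matrix_i e i.
have rB i : row i B = e i by rewrite rowK.
have eB x i : (x *m eta *m B^T) 0 i = lor x (e i).
  rewrite lorE -rB tr_row !mxE; apply: eq_bigr => j _; by rewrite !mxE.
have G : B *m eta *m B^T = eta.
  apply/matrixP => i j.
  have -> : (B *m eta *m B^T) i j = lor (e i) (e j).
    by rewrite -eB -(rB i) -!row_mul !mxE; apply: eq_bigr => k _; rewrite !mxE.
  by move: i j; apply: I4_ind; apply: I4_ind; rewrite /e /eta !mxE !inordK //=
     ?(lorC e1 e0) ?(lorC e2 e0) ?(lorC e3 e0) ?(lorC e2 e1) ?(lorC e3 e1) ?(lorC e3 e2)
     ?h00 ?h11 ?h22 ?h33 ?h01 ?h02 ?h03 ?h12 ?h13 ?h23 -val_eqE /= !inordK.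
have ee : eta *m eta = 1%:M.
  rewrite /eta mulmx_diag; apply/matrixP => i j; rewrite !mxE.
  case: eqP => [->|_]; last by rewrite mulr0n.
  by move: j; apply: I4_ind; rewrite !inordK //= ?mulrNN !mulr1.
have inv : B *m (eta *m B^T *m eta) = 1%:M by rewrite !mulmxA G ee.
have inv' := mulmx1C inv.
have yB : y *m eta *m B^T = 0.
  apply/rowP => i; rewrite eB mxE; move: i; apply: I4_ind; by rewrite /e inordK.
by rewrite -(mulmx1 y) -inv' !mulmxA yB !mul0mx.
Qed.

Lemma lframe_expand e0 e1 e2 e3 : lframe e0 e1 e2 e3 -> forall x,
  x = - lor x e0 *: e0 + lor x e1 *: e1 + lor x e2 *: e2 + lor x e3 *: e3.
Proof.
move=> H x; have [h00 h11 h22 h33 h01 h02 h03 h12 h13 h23] := H.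
apply/eqP; rewrite -subr_eq0; apply/eqP; apply: (lframe_nondeg H).
all: rewrite lorDl lorNl !lorDl !lorZl ?(lorC e1 e0) ?(lorC e2 e0) ?(lorC e3 e0)
  ?(lorC e2 e1) ?(lorC e3 e1) ?(lorC e3 e2) ?h00 ?h11 ?h22 ?h33 ?h01 ?h02 ?h03 ?h12 ?h13 ?h23; ring.
Qed.

End Lorentz.

(** * Calculus for vector functions and Lorentzian products *)

Section VecDerive.
Variable R : realType.

Lemma is_derive_vec (U : normedModType R) n (f : U -> 'rV[R]_n.+1) (t v : U) (df : 'rV[R]_n.+1) :
  is_derive t v f df <-> forall i, is_derive t v (fun t => f t 0 i : R) (df 0 i).
Proof.
split=> [[d <-] i|H].
  by apply: DeriveDef; [exact: derivable_coord|rewrite derive_coord].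
have d : derivable f t v.
  by apply/derivable_mxP => i j; rewrite ord1; have [] := H j.
apply: DeriveDef => //; apply/rowP => i; rewrite derive_coord //.
by have [_ ->] := H i.
Qed.

Lemma is_derive_scal n (h : R -> R) (f : R -> 'rV[R]_n.+1) (t dh : R) df :
  is_derive t 1 h dh -> is_derive t 1 f df ->
  is_derive t 1 (fun t => h t *: f t) (dh *: f t + h t *: df).
Proof.
move=> Dh /is_derive_vec Df; apply/is_derive_vec => i.
have D := is_deriveM (Dh) (Df i).
have -> : (fun t => (h t *: f t) 0 i) = h * (fun t => f t 0 i).
  by apply/funext => s; rewrite mxE.
by apply: is_derive_eq D _; rewrite !mxE /GRing.scale /=; ring.
Qed.

Lemma is_derive_add n (f g : R -> 'rV[R]_n.+1) (t : R) df dg :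
  is_derive t 1 f df -> is_derive t 1 g dg -> is_derive t 1 (fun t => f t + g t) (df + dg).
Proof. by move=> Df Dg; exact: is_deriveD. Qed.

Lemma is_derive_lor (f g : R -> 'rV[R]_4) (t : R) df dg :
  is_derive t 1 f df -> is_derive t 1 g dg ->
  is_derive t 1 (fun t => lor (f t) (g t)) (lor df (g t) + lor (f t) dg).
Proof.
move=> /is_derive_vec Df /is_derive_vec Dg.
have P k : is_derive t 1 (fun t => cr (f t) k * cr (g t) k) (cr df k * cr (g t) k + cr (f t) k * cr dg k).
  have D := is_deriveM (Df (inord k)) (Dg (inord k)).
  by apply: is_derive_eq D _; rewrite /GRing.scale /= /cr; ring.
have D := is_deriveD (is_deriveD (is_deriveD (is_deriveN (P 0%N)) (P 1%N)) (P 2%N)) (P 3%N).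
have -> : (fun t => lor (f t) (g t)) = - (fun t => cr (f t) 0 * cr (g t) 0) + (fun t => cr (f t) 1 * cr (g t) 1)
   + (fun t => cr (f t) 2 * cr (g t) 2) + (fun t => cr (f t) 3 * cr (g t) 3).
  by apply/funext => s; rewrite /lor !fctE mulNr.
by apply: is_derive_eq D _; rewrite /lor; ring.
Qed.

Lemma is_derive_unique (V : normedModType R) (f : R -> V) (t : R) a b :
  is_derive t 1 f a -> is_derive t 1 f b -> a = b.
Proof. by move=> [_ <-] [_ <-]. Qed.

Lemma is_derive_const_on (V : normedModType R) (O : set R) (f : R -> V) (c : V) (t : R) df :
  open O -> O t -> (forall s, O s -> f s = c) -> is_derive t 1 f df -> df = 0.
Proof.
move=> oO Ot H [_ <-]; by rewrite (@derive_eq_on R R V O f (cst c) t 1 oO Ot H) derive_cst.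
Qed.

Lemma Sm_is_derive (V : normedModType R) (O : set R) (f : R -> V) (t : R) :
  Sm O f -> O t -> is_derive t 1 f (derive1 f t).
Proof.
move=> Sf Ot; apply: DeriveDef; last by rewrite derive1E.
by apply/derivable1_diffP; exact: (Sf 1%N).1.
Qed.

Lemma Sm_derive1 (V : normedModType R) (O : set R) (f : R -> V) : Sm O f -> Sm O (derive1 f).
Proof.
move=> Sf k; have := (Sf k.+1).2 1.
by rewrite (_ : derive1 f = 'D_1 f) //; apply/funext => t; rewrite derive1E.
Qed.

Section SmAlg.
Variables (U : normedModType R) (O : set U).
Hypothesis oO : open O.
Lemma SmD (f g : U -> R) : Sm O f -> Sm O g -> Sm O (fun t => f t + g t).
Proof. by move=> Sf Sg k; exact: CkD. Qed.
Lemma SmM (f g : U -> R) : Sm O f -> Sm O g -> Sm O (fun t => f t * g t).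
Proof. by move=> Sf Sg k; exact: CkM. Qed.
Lemma SmC (c : R) : Sm O (fun=> c). Proof. by move=> k; exact: Ck_cst. Qed.
Lemma SmN (f : U -> R) : Sm O f -> Sm O (fun t => - f t).
Proof.
move=> Sf k; apply: Ck_eq (CkZ (-1) oO (Sf k)) => // t _.
by rewrite fctE scaleN1r.
Qed.
Lemma SmV (f : U -> R) : (forall t, O t -> f t != 0) -> Sm O f -> Sm O (fun t => (f t)^-1).
Proof. by move=> f0 Sf k; exact: CkV. Qed.
Lemma Sm_vec n (f : U -> 'rV[R]_n.+1) : Sm O f <-> forall i, Sm O (fun t => f t 0 i : R).
Proof.
split=> [Sf i k|H k]; first exact: ((Ck_coordP _ _ oO).1 (Sf k) i).
by apply/(Ck_coordP _ _ oO) => i; exact: (H i k).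
Qed.
Lemma Sm_cr n (f : U -> 'rV[R]_n.+1) k : Sm O f -> Sm O (fun t => cr (f t) k).
Proof. by move=> /Sm_vec; exact. Qed.
Lemma Sm_lor (f g : U -> 'rV[R]_4) : Sm O f -> Sm O g -> Sm O (fun t => lor (f t) (g t)).
Proof.
move=> Sf Sg; have P k := SmM (Sm_cr k Sf) (Sm_cr k Sg).
have Q := SmD (SmD (SmD (SmN (P 0%N)) (P 1%N)) (P 2%N)) (P 3%N).
move=> k; apply: Ck_eq (Q k) => // t _; rewrite /lor mulNr //.
Qed.
Lemma Sm_scal n (h : U -> R) (f : U -> 'rV[R]_n.+1) : Sm O h -> Sm O f -> Sm O (fun t => h t *: f t).
Proof.
move=> Sh /Sm_vec Sf; apply/Sm_vec => i k.
by apply: Ck_eq (SmM Sh (Sf i) k) => // t _; rewrite mxE.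
Qed.
Lemma Sm_add n (f g : U -> 'rV[R]_n.+1) : Sm O f -> Sm O g -> Sm O (fun t => f t + g t).
Proof. by move=> Sf Sg k; exact: CkD. Qed.
Lemma Sm_eq (V : normedModType R) (f g : U -> V) : (forall t, O t -> f t = g t) -> Sm O f -> Sm O g.
Proof. by move=> E Sf k; apply: Ck_eq (Sf k). Qed.
Lemma Sm_wedge (f g h : U -> 'rV[R]_4) : Sm O f -> Sm O g -> Sm O h ->
  Sm O (fun t => wedge (f t) (g t) (h t)).
Proof.
move=> Sf Sg Sh; have F k := Sm_cr k Sf; have G k := Sm_cr k Sg; have H k := Sm_cr k Sh.
have D i j k : Sm O (fun t => det3 (cr (f t) i) (cr (f t) j) (cr (f t) k) (cr (g t) i) (cr (g t) j) (cr (g t) k)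
                      (cr (h t) i) (cr (h t) j) (cr (h t) k)).
  have M2 a b : Sm O (fun t => cr (g t) a * cr (h t) b - cr (g t) b * cr (h t) a).
    by apply: SmD; [exact: SmM|apply: SmN; exact: SmM].
  apply: SmD; [apply: SmD; [exact: SmM|apply: SmN; exact: SmM]|exact: SmM].
apply/Sm_vec; apply: I4_ind.
- by apply: Sm_eq (SmN (D 1 2 3)%N) => t _; rewrite -[RHS]/(cr _ 0) cr_mkR4.
- by apply: Sm_eq (SmN (D 0 2 3)%N) => t _; rewrite -[RHS]/(cr _ 1) cr_mkR4.
- by apply: Sm_eq (D 0 1 3)%N => t _; rewrite -[RHS]/(cr _ 2) cr_mkR4.
- by apply: Sm_eq (SmN (D 0 1 2)%N) => t _; rewrite -[RHS]/(cr _ 3) cr_mkR4.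
Qed.
End SmAlg.
End VecDerive.

(** * The constant-angle frame of the focal surface *)

Section FocalFrame.
Variable R : realType.

(* The focal surface is [cosh th *: E t + sinh th *: n t]; the constant [M / A] makes [(E, P)] a rotation of [(gamma, n_1)] by a constant hyperbolic angle. *)
Record focal_frame (I : set R) (E n P mu : R -> 'rV[R]_4) (N w : R -> R) (c s : R) : Prop := FocalFrame {
  ff_open : open I;
  ff_E : Sm I E; ff_n : Sm I n; ff_P : Sm I P; ff_mu : Sm I mu; ff_N : Sm I N; ff_w : Sm I w;
  ff_s : 0 < s;
  ff_w0 : forall t, I t -> w t != 0;
  ff_frame : forall t, I t -> lframe (E t) (n t) (P t) (mu t);
  ff_dE : forall t, I t -> is_derive t (1 : R) E (- (c * N t) *: n t);
  ff_dn : forall t, I t -> is_derive t (1 : R) n (- N t *: (c *: E t + s *: P t));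
  ff_dP : forall t, I t -> is_derive t (1 : R) P ((s * N t) *: n t + w t *: mu t) }.

Lemma is_derive_mul (U : normedModType R) (f g : U -> R) (t v : U) (df dg : R) :
  is_derive t v f df -> is_derive t v g dg ->
  is_derive t v (fun t => f t * g t) (df * g t + f t * dg).
Proof.
by move=> Df Dg; apply: is_derive_eq (is_deriveM Df Dg) _; rewrite /GRing.scale /=; ring.
Qed.

Lemma is_derive_eq_on (V : normedModType R) (O : set R) (f h : R -> V) (t : R) df :
  open O -> O t -> (forall s, O s -> f s = h s) -> is_derive t 1 f df -> is_derive t 1 h df.
Proof.
move=> oO Ot E [d <-]; apply: DeriveDef; first exact: (derivable_eq_on oO Ot E).
by rewrite (@derive_eq_on R R V O f h t 1 oO Ot E).
Qed.

Lemma const_on_interval (I : set R) (f : R -> R) : is_interval I ->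
  (forall t, I t -> is_derive t (1 : R) f 0) -> forall t u, I t -> I u -> f t = f u.
Proof.
move=> iI D t u It Iu.
have J (s : R) : 0 <= s <= 1 -> I (t + s *: (u - t)).
  move=> s01; have [tu|ut] := leP t u.
    apply: (iI t u) => //; rewrite /GRing.scale /=; move: s01 tu => /andP[]; clear; nra.
  apply: (iI u t) => //; rewrite /GRing.scale /=; move: s01 ut => /andP[]; clear; nra.
have dl (s : R) : 0 <= s <= 1 -> derivable f (t + s *: (u - t)) (u - t).
  by move=> /J /D [d _]; apply: diff_derivable; apply/derivable1_diffP.
have [s s01] := MVT_unit dl.
have [d e] := D _ (J s s01).
rewrite derive_R1 ?e ?scaler0; last exact/derivable1_diffP.
by rewrite (addrC t) subrK => /eqP; rewrite subr_eq0 => /eqP ->.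
Qed.

Section Curve.
Variables (I : set R) (g v1 v2 : R -> 'rV[R]_4).
Hypothesis iI : is_interval I.
Hypothesis I0 : I !=set0.
Hypothesis hfc : hyperbolic_framed_curve I g v1 v2.
Hypothesis hab : forall t, I t -> a_ g v1 v2 t ^+ 2 + b_ g v1 v2 t ^+ 2 != 0.
Hypothesis hAM : forall t, I t -> bigA g v1 v2 t ^+ 2 > bigM g v1 v2 t ^+ 2.
Hypothesis hMA : forall t, I t -> bigM g v1 v2 t * derive1 (bigA g v1 v2) t
                    - derive1 (bigM g v1 v2) t * bigA g v1 v2 t = 0.

Local Notation mu := (mu g v1 v2).
Local Notation m := (m_ g v1 v2).
Local Notation n := (n_ v1 v2).
Local Notation a := (a_ g v1 v2).
Local Notation b := (b_ g v1 v2).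
Local Notation A := (bigA g v1 v2).

Let oI : open I. Proof. by have [[]] := hfc. Qed.
Let Sg : Sm I g. Proof. by have [/smooth_on_Sm_R] := hfc. Qed.
Let Sv1 : Sm I v1. Proof. by have [_ /smooth_on_Sm_R] := hfc. Qed.
Let Sv2 : Sm I v2. Proof. by have [_ _ /smooth_on_Sm_R] := hfc. Qed.
Let Smu : Sm I mu. Proof. exact: (Sm_wedge oI Sg Sv1 Sv2). Qed.
Let Sm_m : Sm I m. Proof. exact: (Sm_lor oI (Sm_derive1 Sg) Smu). Qed.
Let Sn : Sm I n. Proof. exact: (Sm_lor oI (Sm_derive1 Sv1) Sv2). Qed.
Let Sa : Sm I a. Proof. exact: (Sm_lor oI (Sm_derive1 Sv1) Smu). Qed.
Let Sb : Sm I b. Proof. exact: (Sm_lor oI (Sm_derive1 Sv2) Smu). Qed.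

Let fr t : I t -> lframe (g t) (v1 t) (v2 t) (mu t).
Proof.
move=> It; have [_ _ _ /(_ t It)[h00 h11 h22 h12 [h01 h02 _ _]]] := hfc.
split => //; rewrite ?(lorC _ (mu t)) /Defs.mu ?wedge_orth1 ?wedge_orth2 ?wedge_orth3 //.
rewrite wedge_norm h00 h11 h22 h12 h01 h02 /det3; ring.
Qed.

Let lor_der (f h : R -> 'rV[R]_4) (k : R) t : Sm I f -> Sm I h -> (forall t, I t -> lor (f t) (h t) = k) ->
  I t -> lor (derive1 f t) (h t) + lor (f t) (derive1 h t) = 0.
Proof.
move=> Sf Sh H It.
exact: (is_derive_const_on oI It H (is_derive_lor (Sm_is_derive Sf It) (Sm_is_derive Sh It))).
Qed.

Let lor_der0 (f : R -> 'rV[R]_4) (k : R) t : Sm I f -> (forall t, I t -> lor (f t) (f t) = k) ->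
  I t -> lor (derive1 f t) (f t) = 0.
Proof.
move=> Sf H It; have := lor_der Sf Sf H It; rewrite [lor (f t) _]lorC.
by lra.
Qed.

(** Derivatives of the frame vectors are found by expanding them in the frame; the vanishing and
    skew coefficients come from differentiating the constant products. *)
Let dg t : I t -> is_derive t (1 : R) g (m t *: mu t).
Proof.
move=> It; apply: is_derive_eq (Sm_is_derive Sg It) _.
have [_ _ _ /(_ t It)[_ _ _ _ [_ _ h1 h2]]] := hfc.
rewrite [LHS](lframe_expand (fr It)) h1 h2 (lor_der0 Sg (fun t It => lf00 (fr It)) It).
by rewrite oppr0 !scale0r !add0r.
Qed.

Let dv1 t : I t -> is_derive t (1 : R) v1 (n t *: v2 t + a t *: mu t).
Proof.
move=> It; apply: is_derive_eq (Sm_is_derive Sv1 It) _.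
rewrite [LHS](lframe_expand (fr It)) (lor_der0 Sv1 (fun t It => lf11 (fr It)) It).
have [_ _ _ /(_ t It)[_ _ _ _ [_ _ h1 h2]]] := hfc.
have := lor_der Sg Sv1 (fun t It => lf01 (fr It)) It; rewrite h1 add0r lorC => ->.
by rewrite oppr0 !scale0r !add0r.
Qed.

Let dv2 t : I t -> is_derive t (1 : R) v2 (- n t *: v1 t + b t *: mu t).
Proof.
move=> It; apply: is_derive_eq (Sm_is_derive Sv2 It) _.
rewrite [LHS](lframe_expand (fr It)) (lor_der0 Sv2 (fun t It => lf22 (fr It)) It).
have [_ _ _ /(_ t It)[_ _ _ _ [_ _ h1 h2]]] := hfc.
have := lor_der Sg Sv2 (fun t It => lf02 (fr It)) It; rewrite h2 add0r lorC => ->.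
have := lor_der Sv1 Sv2 (fun t It => lf12 (fr It)) It => /eqP; rewrite addrC addr_eq0 [lor (v1 t) _]lorC => /eqP ->.
by rewrite oppr0 !scale0r !add0r addr0.
Qed.

Let ab_gt0 t : I t -> 0 < a t ^+ 2 + b t ^+ 2.
Proof. by move=> It; rewrite lt_def hab // addr_ge0 ?sqr_ge0. Qed.

Let A_gt0 t : I t -> 0 < A t.
Proof. by move=> It; rewrite sqrtr_gt0 ab_gt0. Qed.

Let A_sq t : I t -> A t ^+ 2 = a t ^+ 2 + b t ^+ 2.
Proof. by move=> It; rewrite sqr_sqrtr // (ltW (ab_gt0 It)). Qed.

Let SA : Sm I A.
Proof.
have S := SmD oI (SmM oI Sa Sa) (SmM oI Sb Sb).
have P t : I t -> [set x : R | 0 < x] (a t * a t + b t * b t).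
  by move=> It; rewrite /= -!expr2; exact: ab_gt0.
by move=> k; exact: (Ck_comp_R oI P (S k) (@Ck_sqrt R k)).
Qed.

Let SAV : Sm I (fun t => (A t)^-1).
Proof. by apply: SmV => // t It; rewrite gt_eqF ?A_gt0. Qed.

(** Cosine and sine of the rotation from (v1, v2) to (n1, n2), kept as a smooth pair so that no
    angle function has to be chosen. *)
Let p t := a t * (A t)^-1.
Let r t := b t * (A t)^-1.
Let Sp : Sm I p. Proof. exact: SmM. Qed.
Let Sr : Sm I r. Proof. exact: SmM. Qed.

Let apA t : I t -> a t = p t * A t.
Proof. by move=> It; rewrite /p mulfVK // gt_eqF ?A_gt0. Qed.
Let brA t : I t -> b t = r t * A t.
Proof. by move=> It; rewrite /r mulfVK // gt_eqF ?A_gt0. Qed.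

Let pr1 t : I t -> p t * p t + r t * r t = 1.
Proof.
move=> It; have A0 : A t != 0 by rewrite gt_eqF ?A_gt0.
apply: (mulIf (expf_neq0 2 A0)); rewrite mul1r [in RHS](A_sq It) (apA It) (brA It); ring.
Qed.

(** The derivative of the rotation angle; added to the rotation n of (v1, v2) it gives the curvature
    N of the rotated frame. *)
Let K t := p t * derive1 r t - r t * derive1 p t.
Let N t := K t + n t.
Let SN : Sm I N.
Proof.
apply: SmD => //; apply: SmD => //; first by apply: SmM => //; exact: Sm_derive1.
by apply: SmN => //; apply: SmM => //; exact: Sm_derive1.
Qed.

Let pp0 t : I t -> p t * derive1 p t + r t * derive1 r t = 0.
Proof.
move=> It; have Dp := Sm_is_derive Sp It; have Dr := Sm_is_derive Sr It.
have := is_derive_const_on oI It pr1 (is_deriveD (is_derive_mul Dp Dp) (is_derive_mul Dr Dr)).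
move: (derive1 p t) (derive1 r t) (p t) (r t) => x y P Q h.
by rewrite -[RHS](mulr0 (2^-1 : R)) -h; field.
Qed.

Let dp t : I t -> is_derive t (1 : R) p (- r t * K t).
Proof.
move=> It; apply: is_derive_eq (Sm_is_derive Sp It) _.
rewrite /K; have := pp0 It; have := pr1 It.
move: (derive1 p t) (derive1 r t) (p t) (r t) => x y P Q h1 h2.
by rewrite -[LHS]mul1r -h1; transitivity (P * (P * x + Q * y) - Q * (P * y - Q * x)); [ring|rewrite h2; ring].
Qed.

Let dr t : I t -> is_derive t (1 : R) r (p t * K t).
Proof.
move=> It; apply: is_derive_eq (Sm_is_derive Sr It) _.
rewrite /K; have := pp0 It; have := pr1 It.
move: (derive1 p t) (derive1 r t) (p t) (r t) => x y P Q h1 h2.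
by rewrite -[LHS]mul1r -h1; transitivity (Q * (P * x + Q * y) + P * (P * y - Q * x)); [ring|rewrite h2; ring].
Qed.

Let bigNE t : I t -> bigN g v1 v2 t = N t.
Proof.
move=> It; rewrite /bigN /f_ -(A_sq It).
have Da := is_derive_unique (Sm_is_derive Sa It)
  (is_derive_eq_on oI It (fun s Is => esym (apA Is)) (is_derive_mul (Sm_is_derive Sp It) (Sm_is_derive SA It))).
have Db := is_derive_unique (Sm_is_derive Sb It)
  (is_derive_eq_on oI It (fun s Is => esym (brA Is)) (is_derive_mul (Sm_is_derive Sr It) (Sm_is_derive SA It))).
rewrite Da Db [in X in X * _](apA It) [in X in _ - X](brA It) /N /K.
have : A t != 0 by rewrite gt_eqF ?A_gt0.
move: (derive1 A t) (derive1 r t) (derive1 p t) => x y z A0.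
by field.
Qed.

Let e1 t := p t *: v1 t + r t *: v2 t.
Let e2 t := - r t *: v1 t + p t *: v2 t.
Let Se1 : Sm I e1. Proof. by apply: Sm_add => //; exact: Sm_scal. Qed.
Let Se2 : Sm I e2.
Proof. by apply: Sm_add => //; apply: Sm_scal => //; exact: SmN. Qed.

Let de2 t : I t -> is_derive t (1 : R) e2 (- N t *: e1 t).
Proof.
move=> It.
have D := is_derive_add (is_derive_scal (is_deriveN (dr It)) (dv1 It)) (is_derive_scal (dp It) (dv2 It)).
apply: is_derive_eq D _; rewrite /e1 /N (apA It) (brA It).
rewrite -[(- r) t]/(- r t).
move: (K t) (p t) (r t) (n t) (A t) (v1 t) (v2 t) (mu t) => x1 x2 x3 x4 x5 y1 y2 y3.
apply/rowP => i; rewrite !mxE; ring.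
Qed.

Let de1 t : I t -> is_derive t (1 : R) e1 (N t *: e2 t + A t *: mu t).
Proof.
move=> It.
have D := is_derive_add (is_derive_scal (dp It) (dv1 It)) (is_derive_scal (dr It) (dv2 It)).
apply: is_derive_eq D _; rewrite -[A t]mul1r -(pr1 It) /e2 /N {1}(apA It) {1}(brA It).
move: (K t) (p t) (r t) (n t) (A t) (v1 t) (v2 t) (mu t) => x1 x2 x3 x4 x5 y1 y2 y3.
apply/rowP => i; rewrite !mxE; ring.
Qed.

Let n1E t : n1 g v1 v2 t = e1 t.
Proof. by rewrite /n1 /e1 scalerDr !scalerA /p /r ![_^-1 * _]mulrC. Qed.

Let n2E t : n2 g v1 v2 t = e2 t.
Proof. by rewrite /n2 /e2 scalerDr !scalerA /p /r -mulNr ![_^-1 * _]mulrC. Qed.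

Let fr12 t : I t -> lframe (g t) (e1 t) (e2 t) (mu t).
Proof.
move=> It; have := fr It; have := pr1 It; rewrite /e1 /e2.
move: (g t) (v1 t) (v2 t) (mu t) (p t) (r t) => x0 x1 x2 x3 P Q h [h00 h11 h22 h33 h01 h02 h03 h12 h13 h23].
split => //; rewrite !(lorDl, lorDr, lorZl, lorZr) ?(lorC x2 x1) ?h11 ?h22 ?h01 ?h02 ?h12 ?h13 ?h23; nra.
Qed.

(** Up to sign the hypothesis on M A' - M' A is A^2 times the derivative of M / A, and A^2 > M^2 at
    one point bounds the constant. *)
Let mA_const : exists2 k, k ^+ 2 < 1 & forall t, I t -> m t = k * A t.
Proof.
have [t0 It0] := I0.
pose q t := m t * (A t)^-1.
have Sq : Sm I q by exact: SmM.
have mE t : I t -> q t * A t = m t by move=> It; rewrite /q mulfVK // gt_eqF ?A_gt0.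
have D t : I t -> is_derive t (1 : R) q 0.
  move=> It; have Dq := Sm_is_derive Sq It; apply: is_derive_eq Dq _.
  have Dm := is_derive_unique (Sm_is_derive Sm_m It)
    (is_derive_eq_on oI It mE (is_derive_mul (Sm_is_derive Sq It) (Sm_is_derive SA It))).
  have := hMA It; rewrite -[derive1 (bigM _ _ _) t]/(derive1 m t) Dm -[bigM _ _ _ t]/(m t) -(mE t It).
  have := A_gt0 It; move: (derive1 A t) (A t) (derive1 q t) (q t) => a' a1 q' q0 a0 H.
  have /eqP : q' * a1 ^+ 2 = 0 by rewrite -[RHS]oppr0 -H; ring.
  by rewrite mulf_eq0 expf_eq0 /= (gt_eqF a0) orbF => /eqP.
exists (m t0 / A t0) => [|t It].
  have := hAM It0; rewrite /bigM expr_div_n ltr_pdivrMr ?mul1r //.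
  by rewrite exprn_gt0 // A_gt0.
by rewrite -[m t0 / A t0]/(q t0) -(const_on_interval iI D It It0) mE.
Qed.

Lemma focal_frame_exists : exists E n P mu N w c s,
  [/\ focal_frame I E n P mu N w c s,
    forall x, I (cr x 0) -> focal_h g v1 v2 x = coshR (cr x 1) *: E (cr x 0) + sinhR (cr x 1) *: n (cr x 0),
    forall t, I t -> bigN g v1 v2 t = N t,
    forall t, I t -> (bigM g v1 v2 t = 0 <-> c = 0) &
    forall t, I t -> N t = 0 -> (derive1 (ANsq g v1 v2) t = 0 <-> derive1 N t = 0)].
Proof.
have [k k1 mk] := mA_const.
pose s := (Num.sqrt (1 - k ^+ 2))^-1.
have sq0 : 0 < Num.sqrt (1 - k ^+ 2) by rewrite sqrtr_gt0 subr_gt0.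
have s0 : 0 < s by rewrite invr_gt0.
have sV : s^-1 = s * (1 - k ^+ 2).
  rewrite -[1 - k ^+ 2]sqr_sqrtr ?subr_ge0 ?(ltW k1) // /s invrK expr2 mulKf //.
  by rewrite gt_eqF.
have ss : s * s * (1 - k ^+ 2) = 1 by rewrite -mulrA -sV divff // gt_eqF.
have sqE t : I t -> Num.sqrt (A t ^+ 2 - bigM g v1 v2 t ^+ 2) = A t * s^-1.
  move=> It; rewrite -[bigM _ _ _ t]/(m t) (mk t It) exprMn -{1}[A t ^+ 2]mul1r -mulrBl.
  rewrite sqrtrM; last by rewrite subr_ge0 ltW.
  by rewrite sqrtr_sqr (ger0_norm (ltW (A_gt0 It))) mulrC /s invrK.
(* With k = M / A the tanh of the angle, s is its cosh and s k its sinh. In E' the [mu] terms s m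
   and - s k A cancel because m = k A, and cE + sP gives back n_1, since s^2 (1 - k^2) = 1; what
   remains of [mu] in P' is A / s. *)
exists (fun t => s *: g t + (- (s * k)) *: e1 t), e2, (fun t => s *: e1 t + (- (s * k)) *: g t), mu, N,
  (fun t => s^-1 * A t), (k * s), s; split.
- split.
  + exact: oI.
  + by apply: Sm_add => //; apply: Sm_scal => //; exact: SmC.
  + exact: Se2.
  + by apply: Sm_add => //; apply: Sm_scal => //; exact: SmC.
  + exact: Smu.
  + exact: SN.
  + by apply: SmM => //; exact: SmC.
  + exact: s0.
  + by move=> t It; rewrite mulf_neq0 ?invr_eq0 ?gt_eqF ?A_gt0.
  + move=> t It; have := fr12 It.
    move: (g t) (e1 t) (e2 t) (mu t) => x0 x1 x2 x3 [h00 h11 h22 h33 h01 h02 h03 h12 h13 h23].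
    split => //; rewrite !(lorDl, lorDr, lorZl, lorZr) ?(lorC x1 x0) ?(lorC x2 x0) ?(lorC x2 x1)
      ?h00 ?h11 ?h22 ?h33 ?h01 ?h02 ?h03 ?h12 ?h13 ?h23; lra.
  + move=> t It.
    have D := is_derive_add (is_deriveZ s (dg It)) (is_deriveZ (- (s * k)) (de1 It)).
    apply: is_derive_eq D _; rewrite (mk t It); move: (N t) (A t) (e2 t) (mu t) => x1 x2 y1 y2.
    apply/rowP => i; rewrite !mxE; ring.
  + move=> t It; apply: is_derive_eq (de2 It) _; congr (_ *: _); move: ss (e1 t) (g t) => ss x y; apply/rowP => i; rewrite !mxE.
    by rewrite -[LHS]mul1r -ss; ring.
  + move=> t It.
    have D := is_derive_add (is_deriveZ s (de1 It)) (is_deriveZ (- (s * k)) (dg It)).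
    apply: is_derive_eq D _; rewrite (mk t It) sV; move: (N t) (A t) (e2 t) (mu t) => x1 x2 y1 y2.
    apply/rowP => i; rewrite !mxE; ring.
- move=> x It; rewrite /focal_h (sqE _ It) n2E n1E -[bigM _ _ _ _]/(m _) (mk _ It); congr (_ + _).
  have : A (cr x 0) != 0 by rewrite gt_eqF ?A_gt0.
  have : s != 0 by rewrite gt_eqF.
  move: (A _) => y s1 y0.
  by apply/rowP => i; rewrite !mxE; field; rewrite y0 s1.
- exact: bigNE.
- move=> t It; rewrite -[bigM _ _ _ _]/(m _) (mk _ It); split=> /eqP; rewrite mulf_eq0.
    by rewrite (gt_eqF (A_gt0 It)) orbF => /eqP ->; rewrite mul0r.
  by rewrite (gt_eqF s0) orbF => /eqP ->; rewrite mul0r.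
- move=> t It Nt.
  (* [ANsq] is N times A^2 / s, so at a zero of N its derivative is N' times a nonvanishing
     factor. *)
  have Sh : Sm I (fun t => A t * (A t * s^-1)).
    by apply: SmM => //; apply: SmM => //; exact: SmC.
  have H u : I u -> N u * (A u * (A u * s^-1)) = ANsq g v1 v2 u.
    by move=> Iu; rewrite /ANsq (sqE u Iu) (bigNE Iu); ring.
  have [_ D] := is_derive_eq_on oI It H (is_derive_mul (Sm_is_derive SN It) (Sm_is_derive Sh It)).
  rewrite derive1E D Nt mul0r addr0; split=> [/eqP|->]; last by rewrite mul0r.
  by rewrite !mulf_eq0 (gt_eqF (A_gt0 It)) invr_eq0 (gt_eqF s0) !orbF => /eqP.
Qed.

End Curve.
End FocalFrame.

(** * Obstructions to equivalence with the models *)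

Section Germs.
Variable R : realType.

Section Data.
Variables n m : nat.
Implicit Types (G g : 'rV[R]_n.+1 -> 'rV[R]_m.+1) (phi psi : 'rV[R]_n.+1 -> 'rV[R]_n.+1).

(** What the obstructions retain of an equivalence: a source diffeomorphism under which kernels of
    the differential and fibres correspond, and a one-sided comparison of distances in the target.
    The target diffeomorphism itself no longer appears. *)
Record germ_equiv G p g q phi psi (O O2 : set 'rV[R]_n.+1) : Prop := GermEquiv {
  ge_openO : open O; ge_Op : O p; ge_openO2 : open O2;
  ge_p : phi p = q;
  ge_phi : Sm O phi; ge_psi : Sm O2 psi;
  ge_phiO : forall x, O x -> O2 (phi x);
  ge_psiO : forall y, O2 y -> O (psi y);
  ge_phiK : forall x, O x -> psi (phi x) = x;
  ge_psiK : forall y, O2 y -> phi (psi y) = y;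
  ge_ker : forall x v, O x -> 'D_('D_v phi x) g (phi x) = 0 <-> 'D_v G x = 0;
  ge_fib : forall x y, O x -> O y -> G x = G y <-> g (phi x) = g (phi y);
  ge_lip : exists C, \forall x \near p, `|g (phi x) - g q| <= C * `|G x - G p| }.

Lemma diff_lipschitz (U V : normedModType R) (f : U -> V) x : differentiable f x ->
  exists C, \forall y \near x, `|f y - f x| <= C * `|y - x|.
Proof.
move=> df; have [C C0 HC] : exists2 C, 0 < C & forall h, `|'d f x h| <= C * `|h|.
  have /linear_boundedP /pinfty_ex_gt0 [C C0 HC] : bounded_near ('d f x) (nbhs (0 : U)).
    by apply: continuous_linear_bounded; exact: (diff_continuous df).
  by exists C.
exists (1 + C).
have H := diff_approx df ltr01.
near=> y; rewrite mulrDl.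
have -> : f y - f x = (f (x + (y - x)) - f x - 'd f x (y - x)) + 'd f x (y - x).
  by rewrite subrK [x + _]addrC subrK.
apply: (le_trans (ler_normD _ _)); rewrite lerD //.
near: y.
have T : (fun y => y - x) @ x --> 0.
  by rewrite -(subrr x); apply: cvgB; [exact: cvg_id|exact: cvg_cst].
exact: (T _ H).
Unshelve. all: by end_near.
Qed.

(** Everything is shrunk to a common open set, where the chain rule for the target diffeomorphism
    and for its inverse transports kernels in both directions; its differentiability gives
    [ge_lip]. *)
Lemma A_equiv_germ G p g q D : open D -> D p -> Sm D G -> (forall x, differentiable g x) ->
  A_equiv G p g q -> exists phi psi O O2, germ_equiv G p g q phi psi O O2 /\ O `<=` D.
Proof.
move=> oD Dp SG dg [phi [Phi [[phip [ O1 [ O2 [psi [[ O1p O2q] /smooth_onP[ oO1 S1] /smooth_onP[ oO2 S2] H1 H2]]]]] 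
  [PhiG [P1 [P2 [Psi [[P1G P2g] /smooth_onP[oP1 T1] /smooth_onP[oP2 T2] K1 K2]]]]] /nbhs_interior]]].
set E := interior _ => nE.
have oE : open E by exact: open_interior.
have Ep : E p by exact: nbhs_singleton.
have EP x : E x -> Phi (G x) = g (phi x) by move=> /interior_subset.
pose D' := D `&` O1 `&` E.
have oD' : open D' by apply: openI => //; exact: openI.
have GC x : D' x -> {for x, continuous G} by move=> [[Dx _] _]; exact: (Ck_continuous (SG 0%N)).
pose O := [set x | D' x /\ P1 (G x)].
have oO : open O by exact: open_preimage.
pose O2' := [set y | O2 y /\ O (psi y)].
have oO2' : open O2' by apply: open_preimage => // y O2y; exact: (Ck_continuous (S2 0%N)).
have dG x : O x -> differentiable G x by move=> [[[Dx _] _] _]; exact: (SG 1%N).1.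
have dphi x : O x -> differentiable phi x by move=> [[[_ Dx] _] _]; exact: (S1 1%N).1.
have dPhi y : P1 y -> differentiable Phi y by move=> Py; exact: (T1 1%N).1.
have dPsi y : P2 y -> differentiable Psi y by move=> Py; exact: (T2 1%N).1.
have Op : O p by [].
exists phi, psi, O, O2'; split; last by move=> x [[[]]].
split => //.
- by move=> k; apply: Ck_subset (S1 k) => x [[[]]].
- by move=> k; apply: Ck_subset (S2 k) => x [].
- by move=> x Ox; have [[[_ O1x] _] _] := Ox; have [] := H1 x O1x => h1 h2; split=> //; rewrite h2.
- by move=> y [].
- by move=> x [[[_ /H1[]]]].
- by move=> y [/H2[]].
- move=> x v Ox; have [_ P1x] := Ox.
  have E1 : 'D_('D_v phi x) g (phi x) = 'D_('D_v G x) Phi (G x).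
    rewrite -(derive_comp_rV _ (dphi x Ox) (dg _)) -(derive_comp_rV _ (dG x Ox) (dPhi _ P1x)).
    by apply: (@derive_eq_on _ _ _ O (g \o phi) (Phi \o G) x v oO Ox) => y [[_ Ey] _]; rewrite /= EP.
  have E2 : 'D_('D_('D_v G x) Phi (G x)) Psi (Phi (G x)) = 'D_v G x.
    rewrite -(derive_comp_rV _ (dPhi _ P1x) (dPsi _ (K1 _ P1x).1)).
    rewrite (@derive_eq_on _ _ _ P1 (Psi \o Phi) id _ _ oP1 P1x) ?derive_id //.
    by move=> y /K1[].
  rewrite E1; split=> h; last by rewrite h derive0.
  by rewrite -E2 h derive0.
- move=> x y [[_ Ex] Px] [[_ Ey] Py]; rewrite -(EP _ Ex) -(EP _ Ey); split=> [->//|h].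
  by rewrite -(K1 _ Px).2 h (K1 _ Py).2.
- have [C HC] := diff_lipschitz (dPhi _ P1G); exists C.
  have C1 : nbhs p (G @^-1` [set y | `|Phi y - Phi (G p)| <= C * `|y - G p|]) := GC p Op.1 _ HC.
  have nO : nbhs p O := open_nbhs_nbhs (conj oO Op).
  by apply: filterS2 C1 nO => x /= H [[_ /EP <-] _]; rewrite -PhiG.
Qed.

Lemma A_equiv_congr G G' p g q : (\forall x \near p, G x = G' x) -> A_equiv G p g q -> A_equiv G' p g q.
Proof.
move=> E [phi [Phi [Dphi DPhi H]]]; have Ep := nbhs_singleton E.
exists phi, Phi; split=> //; first by rewrite -Ep.
by apply: filterS2 E H => x ->.
Qed.

Lemma A_equiv_sm_inj G p g q phi psi O O2 : germ_equiv G p g q phi psi O O2 ->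
  forall x v, O x -> 'D_v phi x = 0 -> v = 0.
Proof.
move=> H x v Ox Dv.
have dphi : differentiable phi x by exact: (ge_phi H 1%N).1.
have dpsi : differentiable psi (phi x) by apply: (ge_psi H 1%N).1; exact: (ge_phiO H).
have := derive_comp_rV v dphi dpsi; rewrite Dv derive0.
rewrite (@derive_eq_on _ _ _ O (psi \o phi) id _ _ (ge_openO H) Ox) ?derive_id //.
by move=> y Oy; rewrite /= (ge_phiK H).
Qed.

End Data.
End Germs.

(** * The normal forms: local injectivity and differentials *)

Section Models.
Variable R : realType.
Implicit Types (x w : 'rV[R]_2).

Definition loc_inj (U V : normedModType R) (f : U -> V) (p : U) :=
  exists O, [/\ open O, O p & forall a b, O a -> O b -> f a = f b -> a = b].

Lemma germ_equiv_loc_inj n m (G g : 'rV[R]_n.+1 -> 'rV[R]_m.+1) p q phi psi O O2 :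
  germ_equiv G p g q phi psi O O2 -> loc_inj G p <-> loc_inj g q.
Proof.
move=> H; have oO := ge_openO H; have Op := ge_Op H; have oO2 := ge_openO2 H.
have pK (x : 'rV[R]_n.+1) : O x -> psi (phi x) = x := ge_phiK H (x := x).
have cphi (x : 'rV[R]_n.+1) : O x -> {for x, continuous phi} := Ck_continuous (ge_phi H 0%N) (x := x).
have cpsi (x : 'rV[R]_n.+1) : O2 x -> {for x, continuous psi} := Ck_continuous (ge_psi H 0%N) (x := x).
split=> -[W [oW Wp Winj]].
- exists [set y | O2 y /\ W (psi y)]; split.
  + exact: open_preimage.
  + by rewrite -(ge_p H); split; [exact: (ge_phiO H)|rewrite /= pK].
  + move=> y y' [Oy Wy] [Oy' Wy'] E; rewrite -(ge_psiK H Oy) -(ge_psiK H Oy'); congr phi.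
    apply: Winj => //; apply/(ge_fib H); [exact: (ge_psiO H)|exact: (ge_psiO H)|].
    by rewrite (ge_psiK H Oy) (ge_psiK H Oy').
- exists [set x | O x /\ W (phi x)]; split.
  + exact: open_preimage.
  + by split=> //=; rewrite (ge_p H).
  + move=> x y [Ox Wx] [Oy Wy] /(ge_fib H Ox Oy) E; rewrite -(pK _ Ox) -(pK _ Oy); congr psi.
    exact: Winj.
Qed.

Lemma u_0 : u_ (0 : 'rV[R]_2) = 0. Proof. by rewrite /u_ /cr mxE. Qed.
Lemma v_0 : v_ (0 : 'rV[R]_2) = 0. Proof. by rewrite /v_ /cr mxE. Qed.
Lemma u_mk (a b : R) : u_ (mkR2 a b) = a. Proof. by rewrite /u_ cr0E mxE. Qed.
Lemma v_mk (a b : R) : v_ (mkR2 a b) = b. Proof. by rewrite /v_ cr1E mxE. Qed.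

Lemma uv_inj x w : u_ x = u_ w -> v_ x = v_ w -> x = w.
Proof.
by rewrite /u_ /v_ !cr0E !cr1E => a b; rewrite -(mkR2E x) -(mkR2E w) a b.
Qed.

Lemma mkR3_inj (a b c a' b' c' : R) : mkR3 a b c = mkR3 a' b' c' -> [/\ a = a', b = b' & c = c'].
Proof.
by move=> E; split; [rewrite -(mkR3_0 a b c)|rewrite -(mkR3_1 a b c)|rewrite -(mkR3_2 a b c)]; rewrite E mxE.
Qed.

Lemma exp3_inj (a b : R) : a ^+ 3 = b ^+ 3 -> a = b.
Proof.
wlog ab : a b / a <= b => [H|].
  by have [/H//|/ltW /H + /esym] := leP a b => /[apply].
rewrite le_eqVlt in ab; case/orP: ab => [/eqP//|ab] E; exfalso.
have q0 : 0 < a ^+ 2 + a * b + b ^+ 2.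
  have -> : a ^+ 2 + a * b + b ^+ 2 = (3 * (a + b) ^+ 2 + (b - a) ^+ 2) / 4 by field.
  apply: divr_gt0 => //; apply: ltr_wpDl; first by rewrite mulr_ge0 ?sqr_ge0.
  by apply: exprn_gt0; rewrite subr_gt0.
have : 0 < b ^+ 3 - a ^+ 3.
  have -> : b ^+ 3 - a ^+ 3 = (b - a) * (a ^+ 2 + a * b + b ^+ 2) by ring.
  by rewrite mulr_gt0 // subr_gt0.
by rewrite E subrr ltxx.
Qed.

Lemma edge_loc_inj : loc_inj (@cuspidal_edge_model R) 0.
Proof.
exists setT; split => //; first exact: openT.
by move=> x y _ _ /mkR3_inj [e1 _ /exp3_inj e2]; exact: uv_inj.
Qed.

Lemma small_points (O : set 'rV[R]_2) : open O -> O 0 ->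
  exists2 e : R, 0 < e & forall a b, `|a| < e -> `|b| < e -> O (mkR2 a b).
Proof.
move=> oO O0; have /nbhs_ballP [e /= e0 He] := open_nbhs_nbhs (conj oO O0).
exists e => // a b ae be; apply: He; rewrite -ball_normE /ball_ /= sub0r normrN.
have [ab|ba] := leP `|a| `|b|.
  apply: (le_lt_trans _ be); apply: norm_le_coord => // i; rewrite mxE; by case: ifP.
apply: (le_lt_trans _ ae); apply: norm_le_coord => // i; rewrite mxE; case: ifP => // _; exact: ltW.
Qed.

Lemma crosscap_not_loc_inj : ~ loc_inj (@cuspidal_crosscap_model R) 0.
Proof.
move=> [ O [ oO O0 inj]]; have [e e0 He] := small_points oO O0.
have e2 : `|e / 2| < e by rewrite ger0_norm ?divr_ge0 ?(ltW e0) //; lra.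
(* On u = 0 the cross cap depends on v^2 only. *)
have := inj (mkR2 0 (e / 2)) (mkR2 0 (- (e / 2))).
move=> /(_ (He _ _ _ e2)); rewrite normr0 => /(_ e0) /(_ (He _ _ _ _)); rewrite normr0 normrN => /(_ e0 e2).
rewrite /cuspidal_crosscap_model !u_mk !v_mk sqrrN !mul0r => /(_ erefl) /(congr1 (@v_ R)); rewrite !v_mk; lra.
Qed.

Lemma swallowtail_not_loc_inj : ~ loc_inj (@swallowtail_model R) 0.
Proof.
move=> [ O [ oO O0 inj]]; have [e e0 He] := small_points oO O0.
(* On u = - 2 v^2, the double curve, the second coordinate vanishes and the others are even in v.
   The bound 1/3 keeps 2 d^2 below e. *)
pose d := Num.min (e / 2) (1 / 3).
have d0 : 0 < d by rewrite lt_min !divr_gt0.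
have de : d <= e / 2 by rewrite ge_min lexx.
have d1 : d <= 1 / 3 by rewrite ge_min lexx orbT.
have D1 : `|d| < e by rewrite gtr0_norm //; lra.
have D2 : `|- (2 * d ^+ 2)| < e by rewrite normrN gtr0_norm ?mulr_gt0 ?exprn_gt0 //; nra.
have D3 : `|- d| < e by rewrite normrN.
have := inj _ _ (He _ _ D2 D1) (He _ _ D2 D3).
rewrite /swallowtail_model !u_mk !v_mk => H.
have /(congr1 (@v_ R)) : mkR2 (- (2 * d ^+ 2)) d = mkR2 (- (2 * d ^+ 2)) (- d).
  by apply: H; congr mkR3; ring.
by rewrite !v_mk; lra.
Qed.

Lemma is_derive_u x w : is_derive x w (@u_ R) (u_ w).
Proof.
have d : differentiable (coordm (0 : 'I_2)) x by apply: linear_differentiable; exact: coordm_continuous.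
have -> : @u_ R = coordm 0 by apply/funext => y; rewrite /u_ cr0E.
apply: DeriveDef; first exact: diff_derivable.
by rewrite deriveE // diff_lin //; exact: coordm_continuous.
Qed.

Lemma is_derive_v x w : is_derive x w (@v_ R) (v_ w).
Proof.
have d : differentiable (coordm (1 : 'I_2)) x by apply: linear_differentiable; exact: coordm_continuous.
have -> : @v_ R = coordm 1 by apply/funext => y; rewrite /v_ cr1E.
apply: DeriveDef; first exact: diff_derivable.
by rewrite deriveE // diff_lin //; exact: coordm_continuous.
Qed.

Lemma is_derive_mkR3 (U : normedModType R) (f1 f2 f3 : U -> R) (x w : U) d1 d2 d3 :
  is_derive x w f1 d1 -> is_derive x w f2 d2 -> is_derive x w f3 d3 ->
  is_derive x w (fun p => mkR3 (f1 p) (f2 p) (f3 p)) (mkR3 d1 d2 d3).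
Proof.
move=> D1 D2 D3; apply/is_derive_vec; apply: I3_ind.
- by rewrite mkR3_0 (_ : (fun t => _) = f1) //; apply/funext => t; rewrite mkR3_0.
- by rewrite mkR3_1 (_ : (fun t => _) = f2) //; apply/funext => t; rewrite mkR3_1.
- by rewrite mkR3_2 (_ : (fun t => _) = f3) //; apply/funext => t; rewrite mkR3_2.
Qed.

Lemma Sm_u : Sm setT (@u_ R).
Proof.
move=> k; have C := @Ck_linear R _ _ k setT _ (@coordm_continuous R 1 0).
by apply: Ck_eq C => [|y _]; [exact: openT|rewrite /u_ cr0E].
Qed.

Lemma Sm_v : Sm setT (@v_ R).
Proof.
move=> k; have C := @Ck_linear R _ _ k setT _ (@coordm_continuous R 1 1).
by apply: Ck_eq C => [|y _]; [exact: openT|rewrite /v_ cr1E].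
Qed.

Lemma Sm_mkR3 (U : normedModType R) (O : set U) (f1 f2 f3 : U -> R) : open O ->
  Sm O f1 -> Sm O f2 -> Sm O f3 -> Sm O (fun p => mkR3 (f1 p) (f2 p) (f3 p)).
Proof.
move=> oO D1 D2 D3; apply/(Sm_vec oO); apply: I3_ind.
- by apply: (Sm_eq oO _ D1) => p _; rewrite mkR3_0.
- by apply: (Sm_eq oO _ D2) => p _; rewrite mkR3_1.
- by apply: (Sm_eq oO _ D3) => p _; rewrite mkR3_2.
Qed.

Lemma SmX (U : normedModType R) (O : set U) (f : U -> R) k : open O -> Sm O f -> Sm O (fun p => f p ^+ k).
Proof.
move=> oO Sf; elim: k => [|k IH]; first exact (SmC O (1 : R)).
by apply: (Sm_eq oO _ (SmM oO Sf IH)) => p _; rewrite exprS.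
Qed.

(** Beaks and lips differ by the sign s only, so fibres and differentials are computed once. *)
Definition beaks_lips (s : R) (p : 'rV[R]_2) : 'rV[R]_3 :=
  mkR3 (u_ p) (2 * v_ p ^+ 3 + s * (u_ p ^+ 2 * v_ p)) (3 * v_ p ^+ 4 + s * (u_ p ^+ 2 * v_ p ^+ 2)).

Lemma beaksE : @cuspidal_beaks_model R = beaks_lips (-1).
Proof. by apply/funext => p; rewrite /beaks_lips !mulN1r. Qed.
Lemma lipsE : @cuspidal_lips_model R = beaks_lips 1.
Proof. by apply/funext => p; rewrite /beaks_lips !mul1r. Qed.

Lemma edge_diff x : differentiable (@cuspidal_edge_model R) x.
Proof.
have S : Sm setT (@cuspidal_edge_model R).
  apply: Sm_mkR3; [exact: openT|exact: Sm_u|..]; apply: SmX; (exact: openT || exact: Sm_v).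
exact: (S 1%N).1.
Qed.

Lemma crosscap_diff x : differentiable (@cuspidal_crosscap_model R) x.
Proof.
have oT := @openT 'rV[R]_2; have Su := Sm_u; have Sv := Sm_v.
have S : Sm setT (@cuspidal_crosscap_model R).
  by apply: Sm_mkR3 => //; [exact: SmX|apply: SmM => //; exact: SmX].
exact: (S 1%N).1.
Qed.

Lemma swallowtail_diff x : differentiable (@swallowtail_model R) x.
Proof.
have oT := @openT 'rV[R]_2; have Su := Sm_u; have Sv := Sm_v.
have SC c := @SmC R _ [set: 'rV[R]_2] c.
have S : Sm setT (@swallowtail_model R).
  apply: Sm_mkR3 => //; apply: SmD => //; do ?[apply: SmM => //]; exact: SmX.
exact: (S 1%N).1.
Qed.

Lemma beaks_lips_diff s x : differentiable (beaks_lips s) x.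
Proof.
have oT := @openT 'rV[R]_2; have Su := Sm_u; have Sv := Sm_v.
have SC c := @SmC R _ [set: 'rV[R]_2] c.
have S : Sm setT (beaks_lips s).
  apply: Sm_mkR3 => //; apply: SmD => //; do ?[apply: SmM => //]; exact: SmX.
exact: (S 1%N).1.
Qed.

Lemma is_derive_u2 x w : is_derive x w (fun p => u_ p ^+ 2) (2 * u_ x * u_ w).
Proof.
by apply: is_derive_eq (is_derive_mul (is_derive_u x w) (is_derive_u x w)) _; ring.
Qed.
Lemma is_derive_v2 x w : is_derive x w (fun p => v_ p ^+ 2) (2 * v_ x * v_ w).
Proof.
by apply: is_derive_eq (is_derive_mul (is_derive_v x w) (is_derive_v x w)) _; ring.
Qed.
Lemma is_derive_v3 x w : is_derive x w (fun p => v_ p ^+ 3) (3 * v_ x ^+ 2 * v_ w).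
Proof.
by apply: is_derive_eq (is_derive_mul (is_derive_v x w) (is_derive_v2 x w)) _; ring.
Qed.
Lemma is_derive_v4 x w : is_derive x w (fun p => v_ p ^+ 4) (4 * v_ x ^+ 3 * v_ w).
Proof.
by apply: is_derive_eq (is_derive_mul (is_derive_v x w) (is_derive_v3 x w)) _; ring.
Qed.

Lemma derive_edge x w : 'D_w (@cuspidal_edge_model R) x =
  mkR3 (u_ w) (2 * v_ x * v_ w) (3 * v_ x ^+ 2 * v_ w).
Proof.
by have [_ ->] := is_derive_mkR3 (is_derive_u x w) (is_derive_v2 x w) (is_derive_v3 x w).
Qed.

Lemma derive_crosscap x w : 'D_w (@cuspidal_crosscap_model R) x =
  mkR3 (u_ w) (2 * v_ x * v_ w) (u_ w * v_ x ^+ 3 + u_ x * (3 * v_ x ^+ 2 * v_ w)).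
Proof.
by have [_ ->] := is_derive_mkR3 (is_derive_u x w) (is_derive_v2 x w)
  (is_derive_mul (is_derive_u x w) (is_derive_v3 x w)).
Qed.

Lemma derive_swallowtail x w : 'D_w (@swallowtail_model R) x =
  mkR3 (u_ w) (12 * v_ x ^+ 2 * v_ w + 2 * u_ w * v_ x + 2 * u_ x * v_ w)
    (12 * v_ x ^+ 3 * v_ w + u_ w * v_ x ^+ 2 + 2 * u_ x * v_ x * v_ w).
Proof.
have C (c : R) := is_derive_cst c x w.
have [_ ->] := is_derive_mkR3 (is_derive_u x w)
  (is_deriveD (is_derive_mul (C 4) (is_derive_v3 x w)) (is_derive_mul (is_derive_mul (C 2) (is_derive_u x w)) (is_derive_v x w)))
  (is_deriveD (is_derive_mul (C 3) (is_derive_v4 x w)) (is_derive_mul (is_derive_u x w) (is_derive_v2 x w))).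
by congr mkR3; rewrite /cst; ring.
Qed.

Lemma derive_beaks_lips s x w : 'D_w (beaks_lips s) x =
  mkR3 (u_ w) (6 * v_ x ^+ 2 * v_ w + s * (2 * u_ x * u_ w * v_ x + u_ x ^+ 2 * v_ w))
    (12 * v_ x ^+ 3 * v_ w + s * (2 * u_ x * u_ w * v_ x ^+ 2 + 2 * u_ x ^+ 2 * v_ x * v_ w)).
Proof.
have C (c : R) := is_derive_cst c x w.
have [_ ->] := is_derive_mkR3 (is_derive_u x w)
  (is_deriveD (is_derive_mul (C 2) (is_derive_v3 x w)) (is_derive_mul (C s) (is_derive_mul (is_derive_u2 x w) (is_derive_v x w))))
  (is_deriveD (is_derive_mul (C 3) (is_derive_v4 x w)) (is_derive_mul (C s) (is_derive_mul (is_derive_u2 x w) (is_derive_v2 x w)))).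
by congr mkR3; rewrite /cst; ring.
Qed.

End Models.

(** * The focal surface *)

Section Hyperbolic.
Variable R : realType.

Lemma is_derive_expN (x : R) : is_derive x 1 (fun x => expR (- x)) (- expR (- x)).
Proof.
have D1 : is_derive x (1 : R) (fun x : R => - x) (-1) by apply: is_deriveN.
have D2 : is_derive (- x) (1 : R) (@expR R) (expR (- x)) by exact: is_derive_expR.
by apply: is_derive_eq (is_derive1_comp D2 D1) _; rewrite /GRing.scale /=; ring.
Qed.

Lemma is_derive_coshR (x : R) : is_derive x (1 : R) (@coshR R) (sinhR x).
Proof.
have D := is_derive_mul (is_deriveD (is_derive_expR x) (is_derive_expN x)) (is_derive_cst (2^-1 : R) x 1).
by apply: is_derive_eq D _; rewrite /sinhR mulr0 addr0.
Qed.

Lemma is_derive_sinhR (x : R) : is_derive x (1 : R) (@sinhR R) (coshR x).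
Proof.
have D := is_derive_mul (is_deriveB (is_derive_expR x) (is_derive_expN x)) (is_derive_cst (2^-1 : R) x 1).
by apply: is_derive_eq D _; rewrite /coshR mulr0 addr0 opprK.
Qed.

Lemma Sm_cosh_sinh : Sm setT (@coshR R) /\ Sm setT (@sinhR R).
Proof.
suff H k : Ck k setT (@coshR R) /\ Ck k setT (@sinhR R) by split=> k; have [] := H k.
elim: k => [|k [IH1 IH2]].
  split=> x _; apply: differentiable_continuous; apply/derivable1_diffP.
    by have [] := is_derive_coshR x.
  by have [] := is_derive_sinhR x.
split.
  exact (Ck_is_derive openT (fun x _ => is_derive_coshR x) IH2).
exact (Ck_is_derive openT (fun x _ => is_derive_sinhR x) IH1).
Qed.

Lemma coshR_gt0 (x : R) : 0 < coshR x.
Proof. by rewrite divr_gt0 // addr_gt0 // expR_gt0. Qed.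

Lemma cosh2_sinh2 (x : R) : coshR x ^+ 2 - sinhR x ^+ 2 = 1.
Proof.
have := expRN x; have := expR_gt0 x; rewrite /coshR /sinhR.
by move: (expR x) (expR (- x)) => a b a0 ->; field; rewrite gt_eqF.
Qed.

Lemma sinhR_eq0 (x : R) : (sinhR x == 0) = (x == 0).
Proof.
rewrite /sinhR mulf_eq0 invr_eq0 pnatr_eq0 orbF subr_eq0.
by apply/eqP/eqP => [/expR_inj|->]; [lra|rewrite oppr0].
Qed.

Lemma sinhR0 : sinhR (0 : R) = 0. Proof. by apply/eqP; rewrite sinhR_eq0. Qed.

End Hyperbolic.

(** * Derivatives and kernels of the surface *)

Section Surface.
Variable R : realType.
Variables (I : set R) (E n P mu : R -> 'rV[R]_4) (N w : R -> R) (c s : R).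
Hypothesis ff : focal_frame I E n P mu N w c s.
Implicit Types (x v : 'rV[R]_2).

Definition surf (E n : R -> 'rV[R]_4) x : 'rV[R]_4 := coshR (v_ x) *: E (u_ x) + sinhR (v_ x) *: n (u_ x).
Definition vth (E n : R -> 'rV[R]_4) x : 'rV[R]_4 := sinhR (v_ x) *: E (u_ x) + coshR (v_ x) *: n (u_ x).
Local Notation F := (surf E n).
Local Notation T := (vth E n).
Local Notation G := (@chartH R \o surf E n).
Definition dom (I : set R) : set 'rV[R]_2 := [set x | I (u_ x)].
Local Notation D := (dom I).

Lemma open_dom : open D.
Proof.
have H := @open_preimage R _ _ setT (@u_ R) I openT.
rewrite (_ : D = [set x | [set: 'rV[R]_2] x /\ I (u_ x)]); last by apply/seteqP; split=> x //= -[].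
by apply: H (ff_open ff) => x _; apply: (Ck_continuous (@Sm_u R 0%N)).
Qed.

Lemma is_derive_comp_R (U V : normedModType R) (f : U -> R) (h : R -> V) (x v : U) df dh :
  differentiable f x -> is_derive x v f df -> is_derive (f x) (1 : R) h dh ->
  is_derive x v (h \o f) (df *: dh).
Proof.
move=> Df [_ <-] [Dh <-].
have dh' : differentiable h (f x) by apply/derivable1_diffP.
apply: DeriveDef; first by apply: diff_derivable; exact: differentiable_comp.
rewrite deriveE; last exact: differentiable_comp.
by rewrite diff_comp //= -!deriveE // derive_R1.
Qed.

Let du x : differentiable (@u_ R) x. Proof. exact: ((@Sm_u R) 1%N).1. Qed.
Let dv x : differentiable (@v_ R) x. Proof. exact: ((@Sm_v R) 1%N).1. Qed.

Lemma is_derive_hyp (f h : R -> R) (X Y : R -> 'rV[R]_4) x v df dh dX dY :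
  is_derive (v_ x) (1 : R) f df -> is_derive (v_ x) (1 : R) h dh ->
  is_derive (u_ x) (1 : R) X dX -> is_derive (u_ x) (1 : R) Y dY ->
  is_derive x v (fun x => f (v_ x) *: X (u_ x) + h (v_ x) *: Y (u_ x))
    (v_ v *: (df *: X (u_ x) + dh *: Y (u_ x)) + u_ v *: (f (v_ x) *: dX + h (v_ x) *: dY)).
Proof.
move=> Df Dh DX DY.
have Df' := is_derive_comp_R (dv x) (is_derive_v x v) Df.
have Dh' := is_derive_comp_R (dv x) (is_derive_v x v) Dh.
have DX' := is_derive_comp_R (du x) (is_derive_u x v) DX.
have DY' := is_derive_comp_R (du x) (is_derive_u x v) DY.
move: Df' Dh' DX' DY' => Df' Dh' /is_derive_vec DX' /is_derive_vec DY'.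
apply/is_derive_vec => i.
have -> : (fun t => (f (v_ t) *: X (u_ t) + h (v_ t) *: Y (u_ t)) 0 i) =
    (fun x => (f \o @v_ R) x * (X \o @u_ R) x 0 i) + (fun x => (h \o @v_ R) x * (Y \o @u_ R) x 0 i).
  by apply/funext => t; rewrite !mxE.
apply: is_derive_eq (is_deriveD (is_derive_mul Df' (DX' i)) (is_derive_mul Dh' (DY' i))) _.
by rewrite !mxE /=; rewrite /GRing.scale /=; ring.
Qed.

(** The t-derivative of the surface is [- N t] times this vector: it is the velocity with the common
    factor taken out, which stays smooth and explicit where N vanishes. *)
Definition ntg c s (E n P : R -> 'rV[R]_4) (x : 'rV[R]_2) : 'rV[R]_4 := c *: vth E n x + (s * sinhR (v_ x)) *: P (u_ x).

Lemma is_derive_surf x v : D x ->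
  is_derive x v F (v_ v *: T x - (u_ v * N (u_ x)) *: ntg c s E n P x).
Proof.
move=> Dx.
have H := is_derive_hyp v (is_derive_coshR (v_ x)) (is_derive_sinhR (v_ x)) (ff_dE ff Dx) (ff_dn ff Dx).
apply: is_derive_eq H _; rewrite /ntg /vth.
by move: (E _) (n _) (P _) => a b d; apply/rowP => i; rewrite !mxE; ring.
Qed.

Lemma chartHD (a b : 'rV[R]_4) : chartH (a + b) = chartH a + chartH b.
Proof. by apply/rowP; apply: I3_ind; rewrite /chartH !mxE /= !crD. Qed.
Lemma chartHZ (k : R) (a : 'rV[R]_4) : chartH (k *: a) = k *: chartH a.
Proof. by apply/rowP; apply: I3_ind; rewrite /chartH !mxE /= !crZ. Qed.

Lemma chartH0 : chartH (0 : 'rV[R]_4) = 0.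
Proof. by rewrite -(scale0r (0 : 'rV[R]_4)) chartHZ scale0r. Qed.

Lemma is_derive_chartH (U : normedModType R) (f : U -> 'rV[R]_4) (x v : U) d :
  is_derive x v f d -> is_derive x v (@chartH R \o f) (chartH d).
Proof.
move=> /is_derive_vec H.
by apply: is_derive_mkR3; exact: H.
Qed.

Lemma Sm_chartH (U : normedModType R) (O : set U) (f : U -> 'rV[R]_4) : open O ->
  Sm O f -> Sm O (@chartH R \o f).
Proof. by move=> oO Sf; apply: Sm_mkR3 => //; exact: Sm_cr. Qed.

Lemma Sm_comp_u V (X : R -> 'rV[R]_V.+1) : Sm I X -> Sm D (X \o @u_ R).
Proof.
move=> /(Sm_vec (ff_open ff)) SX; apply/(Sm_vec open_dom) => i.
have S : Sm D (@u_ R) by move=> k; apply: Ck_subset (@Sm_u R k).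
by move=> k; exact: (Ck_comp_R open_dom _ (S k) (SX i k)).
Qed.

Lemma Sm_comp_v (f : R -> R) : Sm setT f -> Sm D (f \o @v_ R).
Proof.
move=> Sf k.
have S : Sm D (@v_ R) by move=> k'; apply: Ck_subset (@Sm_v R k').
exact: (Ck_comp_R open_dom _ (S k) (Sf k)).
Qed.

Lemma Sm_surf : Sm D F.
Proof.
have [Sc Ss] := @Sm_cosh_sinh R.
apply: Sm_add; first exact: open_dom.
  apply: Sm_scal; [exact: open_dom|exact: (Sm_comp_v Sc)|exact: (Sm_comp_u (ff_E ff))].
apply: Sm_scal; [exact: open_dom|exact: (Sm_comp_v Ss)|exact: (Sm_comp_u (ff_n ff))].
Qed.

Lemma Sm_G : Sm D G.
Proof. exact: (Sm_chartH open_dom Sm_surf). Qed.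

Lemma derive_G x v : D x ->
  'D_v G x = chartH (v_ v *: T x - (u_ v * N (u_ x)) *: ntg c s E n P x).
Proof. by move=> Dx; have [_ ->] := is_derive_chartH (is_derive_surf v Dx). Qed.

(* [F], [T], [P], [mu] is a Lorentz frame whose first vector is timelike, so its [x_0] coordinate does not vanish and the chart is injective on the span of the others. *)
Lemma surf_frame x : D x -> lframe (F x) (T x) (P (u_ x)) (mu (u_ x)).
Proof.
move=> Dx; have := ff_frame ff Dx; have := cosh2_sinh2 (v_ x); rewrite /surf /vth.
move: (E _) (n _) (P _) (mu _) (coshR _) (sinhR _) => x0 x1 x2 x3 C S h [h00 h11 h22 h33 h01 h02 h03 h12 h13 h23].
split => //; rewrite !(lorDl, lorDr, lorZl, lorZr) ?(lorC x1 x0) ?h00 ?h11 ?h22 ?h33 ?h01 ?h02 ?h03 ?h12 ?h13 ?h23; lra.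
Qed.

Lemma chart_inj e0 e1 e2 e3 : lframe e0 e1 e2 e3 -> forall a b d : R,
  chartH (a *: e1 + b *: e2 + d *: e3) = 0 -> [/\ a = 0, b = 0 & d = 0].
Proof.
move=> [h00 h11 h22 h33 h01 h02 h03 h12 h13 h23] a b d; set X := _ + _ => HX.
have LX : lor X e0 = 0 by rewrite /X !(lorDl, lorZl) (lorC e1) (lorC e2) (lorC e3) h01 h02 h03; ring.
have [X1 X2 X3] : [/\ cr X 1 = 0, cr X 2 = 0 & cr X 3 = 0].
  by move: HX; rewrite /chartH => /rowP HX; split; [have := HX 0|have := HX 1|have := HX ord_max]; rewrite !mxE.
have e00 : cr e0 0 != 0.
  apply: contra_eq_neq h00 => h; rewrite /lor h.
  by apply/eqP; have := sqr_ge0 (cr e0 1); have := sqr_ge0 (cr e0 2); have := sqr_ge0 (cr e0 3); nra.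
have X0 : cr X 0 = 0.
  move: LX; rewrite /lor X1 X2 X3 !mul0r !addr0 mulNr => /eqP.
  by rewrite oppr_eq0 mulf_eq0 (negbTE e00) orbF => /eqP.
have {}HX : X = 0.
  apply: cr_inj => -[|[|[|[|//]]]] _; rewrite ?X0 ?X1 ?X2 ?X3 /cr mxE //.
split; [have := lor0l e1|have := lor0l e2|have := lor0l e3]; rewrite -HX /X !(lorDl, lorZl)
  ?(lorC e2 e1) ?(lorC e3 e1) ?(lorC e3 e2) ?h11 ?h22 ?h33 ?h12 ?h13 ?h23; lra.
Qed.

Lemma derive_G_eq0 x v : D x ->
  'D_v G x = 0 <-> v_ v = u_ v * N (u_ x) * c /\ u_ v * N (u_ x) * sinhR (v_ x) = 0.
Proof.
move=> Dx; rewrite derive_G // /ntg.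
have -> : v_ v *: T x - (u_ v * N (u_ x)) *: (c *: T x + (s * sinhR (v_ x)) *: P (u_ x)) =
   (v_ v - u_ v * N (u_ x) * c) *: T x + (- (u_ v * N (u_ x) * sinhR (v_ x) * s)) *: P (u_ x) + 0 *: mu (u_ x).
  by move: (T x) (P _) (mu _) => a b d; apply/rowP => i; rewrite !mxE; ring.
split=> [/(chart_inj (surf_frame Dx)) [/eqP e1 /eqP e2 _]|[-> ->]].
  split; first by apply/eqP; rewrite -subr_eq0.
  by apply/eqP; move: e2; rewrite oppr_eq0 mulf_eq0 (gt_eqF (ff_s ff)) orbF.
by rewrite subrr mul0r oppr0 !scale0r !addr0 chartH0.
Qed.

Lemma surf_singular x : D x -> singular_point F x -> N (u_ x) * sinhR (v_ x) = 0.
Proof.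
move=> Dx [c1 [c2 [c0]]].
have [_ ->] := is_derive_surf (e2_1 R) Dx; have [_ ->] := is_derive_surf (e2_2 R) Dx.
rewrite /e2_1 /e2_2 !u_mk !v_mk /ntg => H.
have : chartH (c1 *: (0 *: T x - (1 * N (u_ x)) *: (c *: T x + (s * sinhR (v_ x)) *: P (u_ x))) +
     c2 *: (1 *: T x - (0 * N (u_ x)) *: (c *: T x + (s * sinhR (v_ x)) *: P (u_ x)))) = 0.
  by rewrite H chartH0.
rewrite (_ : _ + _ = (c2 - c1 * N (u_ x) * c) *: T x + (- (c1 * N (u_ x) * sinhR (v_ x) * s)) *: P (u_ x) + 0 *: mu (u_ x)); last first.
  by move: (T x) (P _) (mu _) => a b d; apply/rowP => i; rewrite !mxE; ring.
move=> /(chart_inj (surf_frame Dx)) [/eqP e1 /eqP + _].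
rewrite oppr_eq0 mulf_eq0 (gt_eqF (ff_s ff)) orbF -mulrA mulf_eq0 => /orP[/eqP c10|/eqP//].
move: e1 c0; rewrite c10 !mul0r subr0 => /eqP ->.
by rewrite eqxx => -[].
Qed.

End Surface.

(** * Curves of singular points *)

Section Negative.
Variable R : realType.

Lemma near0_pick (Q : R -> Prop) : (\forall t \near (0 : R), Q t) -> forall d, 0 < d ->
  exists t, [/\ 0 < t, t < d & Q t].
Proof.
move=> /nbhs_ballP [e /= e0 He] d d0; exists (Num.min e d / 2).
have m0 : 0 < Num.min e d by rewrite lt_min e0.
have me : Num.min e d <= e by rewrite ge_min lexx.
have md : Num.min e d <= d by rewrite ge_min lexx orbT.
split; [lra|lra|apply: He].
by rewrite /ball /= sub0r normrN ger0_norm; lra.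
Qed.

Lemma near_and (A B : R -> Prop) : (\forall t \near (0 : R), A t) -> (\forall t \near (0 : R), B t) ->
  \forall t \near (0 : R), A t /\ B t.
Proof. by move=> HA HB; apply: filterS2 HA HB. Qed.

Lemma near0_imp (A B : R -> Prop) : (forall t, A t -> B t) -> (\forall t \near (0 : R), A t) ->
  \forall t \near (0 : R), B t.
Proof. exact: filterS. Qed.

Lemma small_all (a C : R) : (forall e, 0 < e -> a <= C * e) -> a <= 0.
Proof.
move=> H; have [//|a0] := leP a 0.
have := H (a / (2 * (`|C| + 1))) _; have C1 : 0 < 2 * (`|C| + 1) by rewrite mulr_gt0 // ltr_wpDl.
rewrite divr_gt0 // => /(_ isT); rewrite mulrA ler_pdivlMr // => h.
have := ler_norm C; have := normr_ge0 C; move: (`|C|) h C1 => D h C1 D0 CD.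
have : C * a <= D * a by rewrite ler_wpM2r // ltW.
nra.
Qed.

Lemma derive0_small (f : R -> R) d : is_derive (0 : R) (1 : R) f d -> f 0 = 0 ->
  (forall e, 0 < e -> \forall t \near (0 : R), `|f t| <= e * `|t|) -> d = 0.
Proof.
move=> [df <-] f0 H.
have dfr : differentiable f 0 by apply/derivable1_diffP.
have fE t : 'd f 0 t = t * 'D_1 f 0 by rewrite -deriveE // derive_R1.
apply/eqP; rewrite -normr_le0; apply: (@small_all _ 2) => e e0.
have A := diff_approx dfr e0; have B := H e e0.
have C := near_and A B.
have [t [t0 _ [/= A1 B1]]] := near0_pick C ltr01.
move: A1 B1; rewrite add0r f0 subr0 fE (gtr0_norm t0).
move: ('D_1 f 0) => D A1 B1.
rewrite -(ler_pM2r t0) -[in leLHS](gtr0_norm t0) -normrM.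
have -> : D * t = f t - (f t - t * D) by ring.
by apply: (le_trans (ler_normB _ _)); lra.
Qed.

Lemma small_of_derive0 (f : R -> R) : is_derive (0 : R) (1 : R) f 0 -> f 0 = 0 ->
  forall e, 0 < e -> \forall t \near (0 : R), `|f t| <= e * `|t|.
Proof.
move=> [df dE] f0 e e0.
have dfr : differentiable f 0 by apply/derivable1_diffP.
have A := diff_approx dfr e0; apply: filterS A => t.
by rewrite add0r f0 subr0 -deriveE // derive_R1 // dE scaler0 subr0.
Qed.

Lemma line_cvg (p v : 'rV[R]_2) : (fun t : R => p + t *: v) @ 0 --> p.
Proof.
rewrite -[X in _ --> X]addr0 -(scale0r v); apply: cvgD; first exact: cvg_cst.
by apply: cvgZr_tmp; exact: cvg_id.
Qed.

Lemma near_line (O : set 'rV[R]_2) p v : open O -> O p -> \forall t \near (0 : R), O (p + t *: v).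
Proof. by move=> oO Op; exact: (@line_cvg p v _ (open_nbhs_nbhs (conj oO Op))). Qed.

Lemma u_e1 : u_ (e2_1 R) = 1. Proof. exact: u_mk. Qed.
Lemma v_e1 : v_ (e2_1 R) = 0. Proof. exact: v_mk. Qed.
Lemma u_e2 : u_ (e2_2 R) = 0. Proof. exact: u_mk. Qed.
Lemma v_e2 : v_ (e2_2 R) = 1. Proof. exact: v_mk. Qed.
Lemma e1_neq0 : e2_1 R != 0.
Proof. by apply/eqP => /(congr1 (@u_ R)); rewrite u_e1 u_0 => /eqP; rewrite oner_eq0. Qed.

Lemma uD (x y : 'rV[R]_2) : u_ (x + y) = u_ x + u_ y. Proof. by rewrite /u_ /cr mxE. Qed.
Lemma vD (x y : 'rV[R]_2) : v_ (x + y) = v_ x + v_ y. Proof. by rewrite /v_ /cr mxE. Qed.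
Lemma uZ a (x : 'rV[R]_2) : u_ (a *: x) = a * u_ x. Proof. by rewrite /u_ /cr mxE. Qed.
Lemma vZ a (x : 'rV[R]_2) : v_ (a *: x) = a * v_ x. Proof. by rewrite /v_ /cr mxE. Qed.

Lemma is_derive_line (U V : normedModType R) (f : U -> V) (p v : U) (t : R) :
  differentiable f (p + t *: v) -> is_derive t (1 : R) (fun s => f (p + s *: v)) ('D_v f (p + t *: v)).
Proof.
move=> df; apply: DeriveDef; first by apply: derivable_lineE; exact: diff_derivable.
by rewrite derive_lineE.
Qed.

Lemma derive_lin (U V : normedModType R) (f : U -> V) (x v w : U) (a b : R) :
  differentiable f x -> 'D_(a *: v + b *: w) f x = a *: 'D_v f x + b *: 'D_w f x.
Proof. by move=> df; rewrite !deriveE // linearD !linearZ. Qed.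

Lemma mkR3_eq0 (a b c : R) : mkR3 a b c = 0 -> [/\ a = 0, b = 0 & c = 0].
Proof.
move=> E; split; [rewrite -(mkR3_0 a b c)|rewrite -(mkR3_1 a b c)|rewrite -(mkR3_2 a b c)]; by rewrite E mxE.
Qed.

Section Equiv.
Variables (G : 'rV[R]_2 -> 'rV[R]_3) (g : 'rV[R]_2 -> 'rV[R]_3) (p : 'rV[R]_2).
Variables (phi psi : 'rV[R]_2 -> 'rV[R]_2) (O O2 : set 'rV[R]_2).
Hypothesis H : germ_equiv G p g 0 phi psi O O2.

Let dphi x : O x -> differentiable phi x. Proof. by move=> Ox; exact: (ge_phi H 1%N).1. Qed.
Let inj := A_equiv_sm_inj H.

Let dline (v : 'rV[R]_2) (t : R) : O (p + t *: v) ->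
  is_derive t (1 : R) (fun s => u_ (phi (p + s *: v))) (u_ ('D_v phi (p + t *: v))) /\
  is_derive t (1 : R) (fun s => v_ (phi (p + s *: v))) (v_ ('D_v phi (p + t *: v))).
Proof.
move=> Ox; have /is_derive_vec D := is_derive_line (dphi Ox).
by split; apply: D.
Qed.

Let D1 (v : 'rV[R]_2) : is_derive (0 : R) (1 : R) (fun s => u_ (phi (p + s *: v))) (u_ ('D_v phi p)) /\
  is_derive (0 : R) (1 : R) (fun s => v_ (phi (p + s *: v))) (v_ ('D_v phi p)).
Proof. by have := @dline v 0; rewrite scale0r addr0; apply; exact: (ge_Op H). Qed.

Let phi0 (v : 'rV[R]_2) : phi (p + (0 : R) *: v) = 0.
Proof. by rewrite scale0r addr0 (ge_p H). Qed.

Let neq0 x v : O x -> v != 0 -> 'D_v phi x != 0.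
Proof. by move=> Ox; apply: contra_neq; exact: inj. Qed.

Let e1_contra : u_ ('D_(e2_1 R) phi p) = 0 -> v_ ('D_(e2_1 R) phi p) = 0 -> False.
Proof.
move=> h1 h2; have /eqP := neq0 (ge_Op H) e1_neq0; apply.
by apply: uv_inj; rewrite ?u_0 ?v_0.
Qed.

(** A segment along which the differential kills the direction of the segment is mapped to a point,
    whereas the fibre of the model through 0 is a single point. *)
Lemma no_flat_curve : (forall x, g x = g 0 -> x = 0) -> Sm O G ->
  (\forall t \near (0 : R), 'D_(e2_1 R) G (p + t *: e2_1 R) = 0) -> False.
Proof.
move=> g0 SG /(near_and (near_line (e2_1 R) (ge_openO H) (ge_Op H))) /nbhs_ballP [e /= e0 He].
have {}He (t : R) : `|t| < e -> O (p + t *: e2_1 R) /\ 'D_(e2_1 R) G (p + t *: e2_1 R) = 0.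
  by move=> te; apply: He; rewrite /ball /= sub0r normrN.
have e2 : `|e / 2| < e by rewrite ger0_norm; lra.
have Oe := (He _ e2).1.
have : G (p + (e / 2) *: e2_1 R) = G p.
  apply/rowP => i; apply/eqP; rewrite -subr_eq0.
  have dGi (t : R) : `|t| <= `|e / 2| -> differentiable G (p + t *: e2_1 R).
    by move=> te; apply: (SG 1%N).1; apply: (He _ (le_lt_trans te e2)).1.
  have [|t te ->] := @MVT_line R _ (fun x => G x 0 i) p (e2_1 R) (e / 2).
    by move=> t te; apply: derivable_coord; apply: diff_derivable; exact: dGi.
  rewrite -derive_coord; last by apply: diff_derivable; exact: dGi.
  by rewrite (He _ (le_lt_trans te e2)).2 mxE mulr0.
move=> /(ge_fib H Oe (ge_Op H)); rewrite (ge_p H) => /g0 h.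
have : p + (e / 2) *: e2_1 R = p.
  by rewrite -(ge_phiK H Oe) h -(ge_phiK H (ge_Op H)) (ge_p H).
move=> /(congr1 (@u_ R)); rewrite uD uZ u_e1; lra.
Qed.

(** At t = 0 the kernel is tangent to the curve of singular points, so the image curve in the model
    has velocity with zero u-component; as it stays in |v| <= |u|, its v-component vanishes too, and
    [phi] would not be immersive. *)
Lemma kernel_along_curve (k : R -> R) : k 0 = 0 ->
  (forall x v, 'D_v g x = 0 -> v != 0 -> u_ v = 0 /\ `|v_ x| <= `|u_ x|) ->
  (\forall t \near (0 : R), 'D_(mkR2 1 (k t)) G (p + t *: e2_1 R) = 0) -> False.
Proof.
move=> k0 gK Hk.
have ne t : mkR2 1 (k t) != 0 :> 'rV[R]_2.
  by apply/eqP => /(congr1 (@u_ R)); rewrite u_mk u_0 => /eqP; rewrite oner_eq0.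
have nO := near_line (e2_1 R) (ge_openO H) (ge_Op H).
have vu : \forall t \near (0 : R), `|v_ (phi (p + t *: e2_1 R))| <= `|u_ (phi (p + t *: e2_1 R))|.
  apply: near0_imp (near_and nO Hk) => t [Ot Ht]; have Dg := (ge_ker H _ Ot).2 Ht.
  by have [] := gK _ _ Dg (neq0 Ot (ne t)).
have u1 : u_ ('D_(e2_1 R) phi p) = 0.
  have Hk0 := nbhs_singleton Hk; rewrite k0 scale0r addr0 in Hk0.
  have Dg := (ge_ker H (e2_1 R) (ge_Op H)).2 Hk0.
  by have [] := gK _ _ Dg (neq0 (ge_Op H) e1_neq0).
have [Du Dv] := D1 (e2_1 R).
apply: e1_contra => //; apply: (derive0_small Dv); first by rewrite phi0 v_0.
rewrite u1 in Du; have := small_of_derive0 Du; rewrite phi0 u_0 => /(_ erefl) Hu e e0.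
have Hue := Hu e e0; apply: filterS2 vu Hue => t; exact: le_trans.
Qed.

(** Under equivalence the model also moves by o(t^2) along the image curve. As it controls |u| and
    v^2, both coordinates are o(t), and [phi] would kill the direction of the line. *)
Lemma flat_to_second_order : (forall x, `|u_ x| <= `|g x - g 0| /\ v_ x ^+ 2 <= `|g x - g 0|) ->
  (forall e, 0 < e -> \forall t \near (0 : R), `|G (p + t *: e2_1 R) - G p| <= e * t ^+ 2) -> False.
Proof.
move=> gb Gf; have [C HC] := ge_lip H.
have [C' C'0 {}HC] : exists2 C', 0 < C' & \forall x \near p, `|g (phi x) - g 0| <= C' * `|G x - G p|.
  exists (`|C| + 1); first by rewrite ltr_wpDl.
  apply: filterS HC => x /le_trans; apply; rewrite ler_wpM2r //.
  by apply: (le_trans (ler_norm _)); rewrite lerDl.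
have [Du Dv] := D1 (e2_1 R).
have HC' : \forall t \near (0 : R), `|g (phi (p + t *: e2_1 R)) - g 0| <= C' * `|G (p + t *: e2_1 R) - G p|.
  exact: (@line_cvg p (e2_1 R) _ HC).
have bound e : 0 < e -> \forall t \near (0 : R), `|g (phi (p + t *: e2_1 R)) - g 0| <= e * t ^+ 2.
  move=> e0; have Ge := Gf (e / C') (divr_gt0 e0 C'0); apply: filterS2 HC' Ge => t h1 h2.
  apply: (le_trans h1); rewrite -(ler_pM2l C'0) in h2; apply: (le_trans h2).
  have C'1 : C' != 0 by rewrite gt_eqF.
  have -> : C' * (e / C' * t ^+ 2) = e * t ^+ 2 by field.
  exact: lexx.
apply: e1_contra.
- apply: (derive0_small Du); first by rewrite phi0 u_0.
  move=> e e0; have B := bound e e0; have S := near0_lt (@ltr01 R); have BS := near_and B S; apply: filterS BS => t [{}B {}S].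
  apply: (le_trans (gb _).1); apply: (le_trans B); rewrite ler_wpM2l ?(ltW e0) //.
  by rewrite -real_normK ?num_real // expr2 ler_piMr // ltW.
- apply: (derive0_small Dv); first by rewrite phi0 v_0.
  move=> e e0; have B := bound (e ^+ 2) (exprn_gt0 2 e0); apply: filterS B => t B.
  have := le_trans (gb (phi (p + t *: e2_1 R))).2 B.
  rewrite -exprMn -ler_sqrt ?sqr_ge0 // !sqrtr_sqr normrM (gtr0_norm e0).
  by [].
Qed.

(** The singular set of the lips is 6 v^2 + u^2 = 0, an isolated point. *)
Lemma lips_no_singular_curve : g = beaks_lips 1 ->
  (\forall t \near (0 : R), 'D_(e2_1 R) G (p + t *: e2_2 R) = 0) -> False.
Proof.
move=> gE Hk; have nO := near_line (e2_2 R) (ge_openO H) (ge_Op H).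
have [t [t0 _ [Ot Ht]]] := near0_pick (near_and nO Hk) ltr01.
have := (ge_ker H (e2_1 R) Ot).2 Ht.
have := neq0 Ot e1_neq0.
have Eq : p + t *: e2_2 R <> p by move=> /(congr1 (@v_ R)); rewrite vD vZ v_e2; lra.
have := ge_phiK H Ot; move: (phi _) ('D__ _ _) => y X pK X0.
rewrite gE derive_beaks_lips => /mkR3_eq0[uX E1 _].
have vX : v_ X != 0 by apply: contra_neq X0 => vX; apply: uv_inj; rewrite ?u_0 ?v_0.
have : (6 * v_ y ^+ 2 + u_ y ^+ 2) * v_ X == 0 by apply/eqP; rewrite -E1 uX; ring.
rewrite mulf_eq0 (negbTE vX) orbF => /eqP E2.
have := sqr_ge0 (v_ y); have := sqr_ge0 (u_ y) => u20 v20.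
have /eqP : v_ y ^+ 2 = 0 by lra.
have /eqP : u_ y ^+ 2 = 0 by lra.
rewrite !expf_eq0 /= => /eqP uy /eqP vy.
apply: Eq; rewrite -pK -(ge_phiK H (ge_Op H)) (ge_p H); congr psi.
by apply: uv_inj; rewrite ?u_0 ?v_0.
Qed.

(** The swallowtail is singular on u = - 6 v^2 with kernel d/dv, and at 0 the parabola is tangent to
    the kernel. On the surface side kernel and curve are transverse, so two independent vectors
    would be sent by [phi] to multiples of d/dv. *)
Lemma swallowtail_singular_curve : g = @swallowtail_model R ->
  (\forall t \near (0 : R), 'D_(e2_1 R) G (p + t *: e2_2 R) = 0) -> False.
Proof.
move=> gE Hk; have nO := near_line (e2_2 R) (ge_openO H) (ge_Op H).
have keyP t : O (p + t *: e2_2 R) /\ 'D_(e2_1 R) G (p + t *: e2_2 R) = 0 ->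
   u_ ('D_(e2_1 R) phi (p + t *: e2_2 R)) = 0 /\
   u_ (phi (p + t *: e2_2 R)) = - 6 * v_ (phi (p + t *: e2_2 R)) ^+ 2.
  move=> [Ot Dg]; have := (ge_ker H (e2_1 R) Ot).2 Dg.
  have := neq0 Ot e1_neq0; move: (phi _) ('D__ _ _) => y X X0.
  rewrite gE derive_swallowtail => /mkR3_eq0[uX E1 _].
  split=> //.
  have vX : v_ X != 0 by apply: contra_neq X0 => vX; apply: uv_inj; rewrite ?u_0 ?v_0.
  have : (6 * v_ y ^+ 2 + u_ y) * v_ X == 0 by apply/eqP; rewrite -[RHS](mulr0 (2^-1 : R)) -E1 uX; field.
  by rewrite mulf_eq0 (negbTE vX) orbF addr_eq0 => /eqP E2; rewrite -[LHS]opprK -E2 mulNr.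
have key := near0_imp keyP (near_and nO Hk).
have [u1 _] := nbhs_singleton key; rewrite scale0r addr0 in u1.
have u2 : u_ ('D_(e2_2 R) phi p) = 0.
  have [Du Dv] := D1 (e2_2 R).
  have D2 := is_derive_mul (is_derive_cst (- 6 : R) (0 : R) (1 : R)) (is_derive_mul Dv Dv).
  have [_ h1] := Du; have [_ h2] := D2; rewrite -h1.
  pose h (t : R) : R := - 6 * (v_ (phi (p + t *: e2_2 R)) * v_ (phi (p + t *: e2_2 R))).
  have E : \forall t \near (0 : R), u_ (phi (p + t *: e2_2 R)) = h t.
    by apply: near0_imp key => t [_ ->]; rewrite /h expr2.
  transitivity ('D_1 h (0 : R)); first by apply: near_eq_derive => //; exact: oner_neq0.
  by rewrite [LHS]h2 !phi0 v_0; rewrite /cst; ring.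
have : v_ ('D_(e2_2 R) phi p) *: e2_1 R + (- v_ ('D_(e2_1 R) phi p)) *: e2_2 R = 0.
  apply: (inj (ge_Op H)); rewrite derive_lin; last exact: (dphi (ge_Op H)).
  move: u1 u2; move: ('D_(e2_1 R) phi p) ('D_(e2_2 R) phi p) => X Y uX uY.
  apply: uv_inj; first by rewrite uD !uZ uX uY u_0 !mulr0 addr0.
  by rewrite vD !vZ v_0 mulNr mulrC subrr.
move=> /(congr1 (@v_ R)); rewrite vD !vZ v_e1 v_e2 v_0 mulr0 add0r mulr1 => /eqP.
by rewrite oppr_eq0 => /eqP; exact: e1_contra.
Qed.

End Equiv.
End Negative.

(** * The branches of the singular set of the beaks *)

Section Beaks.
Variable R : realType.

(** Close to 0 the remainder is at most half of the linear term, so f moves by at least |d| h / 2 to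
    either side; the intermediate value theorem fills the gap. *)
Lemma local_surj (f : R -> R) (d e : R) : 0 < e ->
  (forall v : R, `|v| < e -> {for v, continuous f}) -> is_derive (0 : R) (1 : R) f d -> d != 0 ->
  exists2 k, 0 < k & forall t, `|t| < k -> exists2 v, `|v| < e & f v = f 0 + t.
Proof.
move=> e0 cf [df dE] d0.
have dfr : differentiable f 0 by apply/derivable1_diffP.
have d2 : 0 < `|d| / 2 by rewrite divr_gt0 // normr_gt0.
have /nbhs_ballP [r /= r0 Hr] := diff_approx dfr d2.
have {}Hr (t : R) : `|t| < r -> `|f t - f 0 - t * d| <= `|d| / 2 * `|t|.
  move=> tr; have := Hr t; rewrite /ball /= sub0r normrN => /(_ tr).
  by rewrite add0r -deriveE // derive_R1 // dE.
pose h := Num.min r e / 2.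
have m0 : 0 < Num.min r e by rewrite lt_min r0.
have mr : Num.min r e <= r by rewrite ge_min lexx.
have me : Num.min r e <= e by rewrite ge_min lexx orbT.
have h0 : 0 < h by rewrite /h; lra.
have hr : h < r by rewrite /h; lra.
have he : h < e by rewrite /h; lra.
have ah : `|h| = h by rewrite gtr0_norm.
have anh : `|- h| = h by rewrite normrN.
exists (`|d| / 2 * h); first by rewrite mulr_gt0.
move=> t tk.
have H1 := Hr h; have H2 := Hr (- h); rewrite anh in H2; rewrite ah in H1.
have {}H1 := H1 hr; have {}H2 := H2 hr.
have hh : - h <= h by lra.
have [||c] := @IVT R f (- h) h (f 0 + t) hh.
- by apply: continuous_in_subspaceT => v; rewrite inE /= in_itv /= => /andP[v1 v2]; apply: cf; rewrite ltr_norml; lra.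
- move: H1 H2 tk; rewrite !ler_norml ltr_norml ge_min le_max.
  have [dp|dn] := leP 0 d.
    rewrite (ger0_norm dp) => /andP[a1 a2] /andP[b1 b2] /andP[c1 c2].
    by apply/andP; split; apply/orP; [left|right]; nra.
  rewrite (ltr0_norm dn) => /andP[a1 a2] /andP[b1 b2] /andP[c1 c2].
  by apply/andP; split; apply/orP; [right|left]; nra.
- rewrite in_itv /= => /andP[v1 v2] fc; exists c => //.
  by rewrite ltr_norml; lra.
Qed.

Variables (G : 'rV[R]_2 -> 'rV[R]_3) (p : 'rV[R]_2).
Variables (phi psi : 'rV[R]_2 -> 'rV[R]_2) (O O2 : set 'rV[R]_2).
Hypothesis H : germ_equiv G p (beaks_lips (-1)) 0 phi psi O O2.

(* The singular set of the beaks is the cross [u ^ 2 = 6 * v ^ 2]; one of its two branches is pulled back to a curve transverse to the lines [t = const]. *)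
Lemma beaks_double_curve (N : R -> R) : 
  (forall x v, O x -> v != 0 -> 'D_v G x = 0 -> N (u_ x) = 0) ->
  \forall t \near (0 : R), N (u_ p + t) = 0.
Proof.
move=> HN.
have O20 : O2 0 by rewrite -(ge_p H); exact: (ge_phiO H (ge_Op H)).
have psi0 : psi 0 = p by rewrite -(ge_p H) (ge_phiK H (ge_Op H)).
have dpsi y : O2 y -> differentiable psi y by move=> Oy; exact: (ge_psi H 1%N).1.
have dphi x : O x -> differentiable phi x by move=> Ox; exact: (ge_phi H 1%N).1.
have c6 : Num.sqrt (6 : R) ^+ 2 = 6 by rewrite sqr_sqrtr.
have c60 : Num.sqrt (6 : R) != 0 by rewrite gt_eqF // sqrtr_gt0.
have branch k : k ^+ 2 = 6 -> u_ ('D_(mkR2 k 1) psi 0) != 0 -> \forall t \near (0 : R), N (u_ p + t) = 0.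
  move=> k6 Du.
  have /nbhs_ballP [e /= e0 He] := near_line (mkR2 k 1) (ge_openO2 H) O20.
  have {}He (v : R) : `|v| < e -> O2 (0 + v *: mkR2 k 1).
    by move=> ve; apply: He; rewrite /ball /= sub0r normrN.
  pose f (v : R) := u_ (psi (0 + v *: mkR2 k 1)).
  have Df (v : R) : `|v| < e -> is_derive v (1 : R) f (u_ ('D_(mkR2 k 1) psi (0 + v *: mkR2 k 1))).
    move=> ve; have /is_derive_vec D := is_derive_line (dpsi _ (He _ ve)); exact: D.
  have D0 : is_derive (0 : R) (1 : R) f (u_ ('D_(mkR2 k 1) psi 0)).
    by have := Df 0; rewrite normr0 scale0r addr0; apply.
  have cf (v : R) : `|v| < e -> {for v, continuous f}.
    move=> ve; apply: differentiable_continuous; apply/derivable1_diffP.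
    by have [] := Df v ve.
  have [r r0 Hr] := local_surj e0 cf D0 Du.
  have f0 : f 0 = u_ p by rewrite /f scale0r addr0 psi0.
  apply: near0_imp (near0_lt r0) => t tr; have [v ve] := Hr t tr.
  rewrite f0 => <-; rewrite /f; have Oy := He v ve; move: Oy; set y := 0 + _ => Oy.
  have Ox := ge_psiO H Oy.
  apply: (HN _ ('D_(e2_2 R) psi y)) => //.
    apply/eqP => w0.
    have := derive_comp_rV (e2_2 R) (dpsi _ Oy) (dphi _ Ox); rewrite w0 derive0.
    rewrite (@derive_eq_on _ _ _ O2 (phi \o psi) id _ _ (ge_openO2 H) Oy) ?derive_id.
      by move=> /(congr1 (@v_ R)); rewrite v_e2 v_0; apply/eqP; exact: oner_neq0.
    by move=> z Oz; exact: (ge_psiK H).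
  apply: (ge_ker H ('D_(e2_2 R) psi y) Ox).1; rewrite -(derive_comp_rV (e2_2 R) (dpsi _ Oy) (dphi _ Ox)).
  rewrite (@derive_eq_on _ _ _ O2 (phi \o psi) id _ _ (ge_openO2 H) Oy) ?derive_id; last first.
    by move=> z Oz; exact: (ge_psiK H).
  rewrite (ge_psiK H Oy) derive_beaks_lips u_e2 v_e2.
  have -> : u_ y = k * v_ y by rewrite /y uD vD !uZ !vZ u_mk v_mk u_0 v_0; ring.
  rewrite !exprMn k6; apply/rowP; apply: I3_ind; rewrite !mxE /=; ring.
(* The two branch directions span the plane, so they cannot both be sent by the invertible
   differential of [psi] to vectors with zero u-component. *)
have [D1|] := eqVneq (u_ ('D_(mkR2 (Num.sqrt 6) 1) psi 0)) 0; last exact: branch.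
have [D2|] := eqVneq (u_ ('D_(mkR2 (- Num.sqrt 6) 1) psi 0)) 0; last by apply: branch; rewrite sqrrN.
exfalso.
have := derive_comp_rV (e2_1 R) (dphi _ (ge_Op H)); rewrite (ge_p H) => /(_ _ _ (dpsi _ O20)).
rewrite (@derive_eq_on _ _ _ O (psi \o phi) id _ _ (ge_openO H) (ge_Op H)) ?derive_id; last first.
  by move=> z Oz; exact: (ge_phiK H).
move: ('D__ phi p) => X.
have -> : X = ((v_ X + u_ X / Num.sqrt 6) / 2) *: mkR2 (Num.sqrt 6) 1 + ((v_ X - u_ X / Num.sqrt 6) / 2) *: mkR2 (- Num.sqrt 6) 1.
  by apply: uv_inj; rewrite ?uD ?vD ?uZ ?vZ ?u_mk ?v_mk; field.
rewrite derive_lin; last exact: dpsi.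
have aux a b (A B : 'rV[R]_2) : u_ A = 0 -> u_ B = 0 -> u_ (a *: A + b *: B) = 0.
  by move=> hA hB; rewrite uD !uZ hA hB !mulr0 addr0.
move=> h; have : u_ (e2_1 R) = 0 by rewrite h; exact (aux _ _ _ _ D1 D2).
by rewrite u_e1 => /eqP; rewrite oner_eq0.
Qed.

End Beaks.

(** * Types excluded for the surface *)

Section SurfaceNegative.
Variable R : realType.
Variables (I : set R) (E n P mu : R -> 'rV[R]_4) (N w : R -> R) (c s : R).
Hypothesis ff : focal_frame I E n P mu N w c s.
Variable p : 'rV[R]_2.
Hypothesis Ip : I (u_ p).
Local Notation G := (@chartH R \o surf E n).
Local Notation D := (dom I).

Let germ g : (forall x, differentiable g x) -> A_equiv G p g 0 ->
  exists phi psi O O2, germ_equiv G p g 0 phi psi O O2 /\ O `<=` D.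
Proof. by apply: (A_equiv_germ (open_dom ff) Ip (Sm_G ff)). Qed.

Let nearD v : \forall t \near (0 : R), D (p + t *: v).
Proof. exact: (near_line v (open_dom ff) Ip). Qed.

Let line1 (t : R) : u_ (p + t *: e2_1 R) = u_ p + t /\ v_ (p + t *: e2_1 R) = v_ p.
Proof. by rewrite uD vD uZ vZ u_e1 v_e1 mulr1 mulr0 addr0. Qed.

Let line2 (t : R) : u_ (p + t *: e2_2 R) = u_ p.
Proof. by rewrite uD uZ u_e2 mulr0 addr0. Qed.

(** At a zero of N the t-derivative vanishes on the whole line t = t0: a curve of singular points
    transverse to its kernel. *)
Let cross_line : N (u_ p) = 0 -> \forall t \near (0 : R), 'D_(e2_1 R) G (p + t *: e2_2 R) = 0.
Proof.
move=> N0; apply: near0_imp (nearD (e2_2 R)) => t Dt.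
by apply/(derive_G_eq0 ff _ Dt); rewrite line2 N0 !mulr0 !mul0r v_e1.
Qed.

Lemma surf_not_swallowtail : N (u_ p) = 0 -> ~ A_equiv G p (@swallowtail_model R) 0.
Proof.
move=> N0 /(germ (@swallowtail_diff R)) [phi [psi [ O [ O2 [H _]]]]].
exact: (swallowtail_singular_curve H erefl (cross_line N0)).
Qed.

Lemma surf_not_lips : N (u_ p) = 0 -> ~ A_equiv G p (@cuspidal_lips_model R) 0.
Proof.
rewrite lipsE => N0 /(germ (@beaks_lips_diff R 1)) [phi [psi [ O [ O2 [H _]]]]].
exact: (lips_no_singular_curve H erefl (cross_line N0)).
Qed.

Let flat (g : 'rV[R]_2 -> 'rV[R]_3) : (forall x, differentiable g x) -> (forall x, g x = g 0 -> x = 0) ->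
  (\forall t \near (0 : R), 'D_(e2_1 R) G (p + t *: e2_1 R) = 0) -> ~ A_equiv G p g 0.
Proof.
move=> dg g0 Hf /(germ dg) [phi [psi [ O [ O2 [H OD]]]]].
apply: (no_flat_curve H g0 _ Hf) => k; exact: Ck_subset OD (Sm_G ff k).
Qed.

Lemma edge_fib0 x : @cuspidal_edge_model R x = cuspidal_edge_model 0 -> x = 0.
Proof.
move=> /mkR3_inj[uE _ /exp3_inj vE]; exact: uv_inj.
Qed.
Lemma crosscap_fib0 x : @cuspidal_crosscap_model R x = cuspidal_crosscap_model 0 -> x = 0.
Proof.
move=> /mkR3_inj[uE + _]; rewrite v_0 expr0n /= => /eqP; rewrite expf_eq0 /= => /eqP vE.
by apply: uv_inj; rewrite ?v_0.
Qed.
Lemma swallowtail_fib0 x : @swallowtail_model R x = swallowtail_model 0 -> x = 0.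
Proof.
move=> /mkR3_inj[uE + _]; rewrite u_0 in uE; rewrite uE u_0 v_0 !mulr0 !mul0r expr0n /= mulr0 !addr0.
move=> /eqP; rewrite mulf_eq0 pnatr_eq0 expf_eq0 /= => /eqP vE.
by apply: uv_inj; rewrite ?v_0 ?u_0.
Qed.
Lemma beaks_lips_fib0 k x : beaks_lips k x = beaks_lips k 0 -> x = 0 :> 'rV[R]_2.
Proof.
move=> /mkR3_inj[uE + _]; rewrite u_0 in uE; rewrite uE u_0 v_0 !expr0n /= !mul0r !mulr0 !addr0.
move=> /eqP; rewrite mulf_eq0 pnatr_eq0 expf_eq0 /= => /eqP vE.
by apply: uv_inj; rewrite ?v_0 ?u_0.
Qed.

Lemma surf_cone_not (g : 'rV[R]_2 -> 'rV[R]_3) : (forall x, differentiable g x) -> (forall x, g x = g 0 -> x = 0) ->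
  c = 0 -> v_ p = 0 -> ~ A_equiv G p g 0.
Proof.
move=> dg g0 c0 p0; apply: flat => //.
apply: near0_imp (nearD (e2_1 R)) => t Dt.
by apply/(derive_G_eq0 ff _ Dt); rewrite (line1 t).2 p0 sinhR0 c0 !mulr0 v_e1.
Qed.

(** Away from th = 0 singular points occur only at zeros of N. The branches of the beaks would then
    force N to vanish on an interval, so that lines th = const collapse to points, against the
    one-point fibre of the model. *)
Lemma surf_not_beaks_th : v_ p != 0 -> ~ A_equiv G p (@cuspidal_beaks_model R) 0.
Proof.
rewrite beaksE => p0 B; have dbl := @beaks_lips_diff R (-1).
pose W := [set x : 'rV[R]_2 | D x /\ [set r : R | r != 0] (v_ x)].
have oW : open W.
  apply: open_preimage; [exact: (open_dom ff)| |exact: open_neq].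
  by move=> x _; apply: (Ck_continuous (@Sm_v R 0%N)).
have SW : Sm W G by move=> k; apply: Ck_subset (Sm_G ff k) => x [].
have [phi [psi [ O [ O2 [H OW]]]]] := A_equiv_germ oW (conj Ip p0) SW dbl B.
have N0 : \forall t \near (0 : R), N (u_ p + t) = 0.
  apply: (beaks_double_curve H) => x v /OW [Dx vx] v0 /(derive_G_eq0 ff _ Dx) [e1 /eqP].
  rewrite mulf_eq0 sinhR_eq0 (negbTE vx) orbF mulf_eq0 => /orP[/eqP uv|/eqP//].
  case/eqP: v0; apply: uv_inj; rewrite ?u_0 ?v_0 // e1 uv !mul0r //.
apply: (flat dbl (@beaks_lips_fib0 (-1)) _ B).
apply: near0_imp (near_and N0 (nearD (e2_1 R))) => t [Nt Dt].
by apply/(derive_G_eq0 ff _ Dt); rewrite (line1 t).1 Nt mulr0 !mul0r v_e1.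
Qed.

(** The line th = 0 consists of singular points with kernel (1, c N), which at a zero of N is
    tangent to that line. *)
Let kernel_th0 (g : 'rV[R]_2 -> 'rV[R]_3) : (forall x, differentiable g x) ->
  (forall x v, 'D_v g x = 0 -> v != 0 -> u_ v = 0 /\ `|v_ x| <= `|u_ x|) ->
  N (u_ p) = 0 -> v_ p = 0 -> ~ A_equiv G p g 0.
Proof.
move=> dg gK N0 p0 /(germ dg) [phi [psi [ O [ O2 [H _]]]]].
apply: (kernel_along_curve H (k := fun t => N (u_ p + t) * c)) => //; first by rewrite addr0 N0 mul0r.
apply: near0_imp (nearD (e2_1 R)) => t Dt.
by apply/(derive_G_eq0 ff _ Dt); rewrite (line1 t).1 (line1 t).2 p0 sinhR0 u_mk v_mk mul1r mulr0.
Qed.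

Let unz (v : 'rV[R]_2) : v != 0 -> u_ v = 0 -> v_ v != 0.
Proof. by move=> v0 uv; apply: contra_neq v0 => vv; apply: uv_inj; rewrite ?u_0 ?v_0. Qed.

Lemma surf_th0_not_edge : N (u_ p) = 0 -> v_ p = 0 -> ~ A_equiv G p (@cuspidal_edge_model R) 0.
Proof.
apply: kernel_th0; first exact: edge_diff.
move=> x v; rewrite derive_edge => /mkR3_eq0[uv /eqP vE _] v0; split=> //.
move: vE; rewrite mulf_eq0 (negbTE (unz v0 uv)) orbF mulf_eq0 pnatr_eq0 /= => /eqP ->.
by rewrite normr0.
Qed.

Lemma surf_th0_not_crosscap : N (u_ p) = 0 -> v_ p = 0 -> ~ A_equiv G p (@cuspidal_crosscap_model R) 0.
Proof.
apply: kernel_th0; first exact: crosscap_diff.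
move=> x v; rewrite derive_crosscap => /mkR3_eq0[uv /eqP vE _] v0; split=> //.
move: vE; rewrite mulf_eq0 (negbTE (unz v0 uv)) orbF mulf_eq0 pnatr_eq0 /= => /eqP ->.
by rewrite normr0.
Qed.

Lemma surf_th0_not_beaks : N (u_ p) = 0 -> v_ p = 0 -> ~ A_equiv G p (@cuspidal_beaks_model R) 0.
Proof.
rewrite beaksE; apply: kernel_th0; first exact: beaks_lips_diff.
move=> x v; rewrite derive_beaks_lips => /mkR3_eq0[uv h _] v0; split=> //.
have vv := unz v0 uv; rewrite uv in h.
have /eqP : (6 * v_ x ^+ 2 - u_ x ^+ 2) * v_ v = 0 by rewrite -h; ring.
rewrite mulf_eq0 (negbTE vv) orbF subr_eq0 => /eqP h2.
rewrite -ler_sqr ?nnegrE // !real_normK ?num_real // -h2.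
by have := sqr_ge0 (v_ x); lra.
Qed.

Lemma Sm_ntg : Sm D (fun x => chartH (ntg c s E n P x)).
Proof.
have oD := open_dom ff; have [Sc Ss] := @Sm_cosh_sinh R.
have S : Sm D (ntg c s E n P).
  apply: (Sm_add oD); apply: (Sm_scal oD).
  - exact: SmC.
  - apply: (Sm_add oD); apply: (Sm_scal oD); [exact: (Sm_comp_v ff Ss)|exact: (Sm_comp_u ff (ff_E ff))|
      exact: (Sm_comp_v ff Sc)|exact: (Sm_comp_u ff (ff_n ff))].
  - apply: (SmM oD); [exact: SmC|exact: (Sm_comp_v ff Ss)].
  - exact: (Sm_comp_u ff (ff_P ff)).
exact: (Sm_chartH oD S).
Qed.

(** The velocity in t is - N times a bounded vector and N is o(t - t0) here; the mean value theorem
    gives a displacement of order o((t - t0)^2). *)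
Let second_order : N (u_ p) = 0 -> derive1 N (u_ p) = 0 ->
  forall e, 0 < e -> \forall t \near (0 : R), `|G (p + t *: e2_1 R) - G p| <= e * t ^+ 2.
Proof.
move=> N0 N1 e e0.
pose z x := chartH (ntg c s E n P x).
have [B B0 HB] : exists2 B, 0 < B & \forall t \near (0 : R), `|z (p + t *: e2_1 R)| <= B.
  exists (`|z p| + 1); first by rewrite ltr_wpDl.
  have cz : {for p, continuous z} := Ck_continuous (Sm_ntg 0%N) Ip.
  have nz : \forall x \near p, `|z x| <= `|z p| + 1.
    have : nbhs (z p) [set y | `|y| <= `|z p| + 1].
      apply/nbhs_ballP; exists 1 => //= y; rewrite -ball_normE /ball_ /= => yz.
      rewrite -[y](subrK (z p)) addrC; apply: (le_trans (ler_normD _ _)).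
      by rewrite lerD // distrC ltW.
    exact: cz.
  exact: (@line_cvg R p (e2_1 R) _ nz).
have DN : is_derive (0 : R) (1 : R) (fun t => N (u_ p + t *: (1 : R))) 0.
  have := @is_derive_line R R R N (u_ p) 1 0; rewrite scale0r addr0 -derive1E N1; apply.
  exact: (ff_N ff 1%N).1.
(* [B] bounds the vector multiplied by N, so N is asked to be at most (e / B) |t|. *)
have e2 : 0 < e / B by rewrite divr_gt0.
have HN := small_of_derive0 DN; rewrite scale0r addr0 N0 in HN.
have A := near_and (HN erefl _ e2) (near_and HB (nearD (e2_1 R))).
have /nbhs_ballP [r /= r0 Hr] := A.
apply/nbhs_ballP; exists r => //= t; rewrite /ball /= sub0r normrN => tr.
have {}Hr (a : R) : `|a| <= `|t| -> [/\ `|N (u_ p + a)| <= e / B * `|a|, `|z (p + a *: e2_1 R)| <= B & D (p + a *: e2_1 R)].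
  move=> ta; have [|h1 [h2 h3]] := Hr a; first by rewrite /ball /= sub0r normrN (le_lt_trans ta).
  by split=> //; rewrite -{1}[a]mulr1.
apply: norm_le_coord => [|i]; first by rewrite mulr_ge0 ?sqr_ge0 // ltW.
have dG a : `|a| <= `|t| -> differentiable G (p + a *: e2_1 R).
  by move=> at_; have [_ _ Da] := Hr a at_; exact: (Sm_G ff 1%N).1.
have [|a ta] := @MVT_line R _ (fun x => G x 0 i) p (e2_1 R) t.
  by move=> a ta; apply: derivable_coord; apply: diff_derivable; exact: dG.
have [h1 h2 Da] := Hr a ta.
rewrite -derive_coord; last by apply: diff_derivable; exact: dG.
rewrite (derive_G ff _ Da) u_e1 v_e1 (line1 a).1 scale0r add0r mul1r -scaleNr chartHZ -/(z _).
rewrite [X in X = _ -> _](_ : _ = (G (p + t *: e2_1 R) - G p) 0 i); last by rewrite !mxE.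
move=> ->; rewrite mxE !normrM normrN.
have h3 : `|z (p + a *: e2_1 R) 0 i| <= B by apply: (le_trans (coord_le_norm _ _)).
move: h1 h3 ta; rewrite -[t ^+ 2]real_normK ?num_real //.
move: (`|N _|) (`|z _ _ _|) (`|a|) (`|t|) (normr_ge0 (N (u_ p + a))) (normr_ge0 (z (p + a *: e2_1 R) 0 i)) (normr_ge0 a) (normr_ge0 t) => X Y a' t' X0 Y0 a0 t0 h1 h3 ta.
have h4 : X * Y <= e / B * t' * B.
  apply: ler_pM => //; apply: (le_trans h1); rewrite ler_wpM2l // ltW //.
have B1 : B != 0 by rewrite gt_eqF.
have h5 : e / B * t' * B = e * t' by field.
rewrite h5 in h4; have : t' * (X * Y) <= t' * (e * t') by rewrite ler_wpM2l.
by rewrite expr2 [e * (t' * t')]mulrCA.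
Qed.

Let second_order_not (g : 'rV[R]_2 -> 'rV[R]_3) : (forall x, differentiable g x) ->
  (forall x, `|u_ x| <= `|g x - g 0| /\ v_ x ^+ 2 <= `|g x - g 0|) ->
  N (u_ p) = 0 -> derive1 N (u_ p) = 0 -> ~ A_equiv G p g 0.
Proof.
move=> dg gb N0 N1 /(germ dg) [phi [psi [ O [ O2 [H _]]]]].
exact: (flat_to_second_order H gb (second_order N0 N1)).
Qed.

Let bound2 a b d (x : 'rV[R]_3) : x = mkR3 a (b ^+ 2) d -> `|a| <= `|x| /\ b ^+ 2 <= `|x|.
Proof.
move=> ->; split; first by have := coord_le_norm (mkR3 a (b ^+ 2) d) 0; rewrite mkR3_0.
have := coord_le_norm (mkR3 a (b ^+ 2) d) 1; rewrite mkR3_1; apply: le_trans; exact: ler_norm.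
Qed.

Lemma surf_flat_not_edge : N (u_ p) = 0 -> derive1 N (u_ p) = 0 -> ~ A_equiv G p (@cuspidal_edge_model R) 0.
Proof.
apply: second_order_not; first exact: edge_diff.
move=> x; apply: (@bound2 _ _ (v_ x ^+ 3)).
apply/rowP; apply: I3_ind; rewrite !mxE /= ?u_0 ?v_0 ?expr0n /= ?subr0 //.
Qed.

Lemma surf_flat_not_crosscap : N (u_ p) = 0 -> derive1 N (u_ p) = 0 -> ~ A_equiv G p (@cuspidal_crosscap_model R) 0.
Proof.
apply: second_order_not; first exact: crosscap_diff.
move=> x; apply: (@bound2 _ _ (u_ x * v_ x ^+ 3)).
apply/rowP; apply: I3_ind; rewrite !mxE /= ?u_0 ?v_0 ?expr0n /= ?mul0r ?subr0 //.
Qed.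

Lemma edge_excludes (g : 'rV[R]_2 -> 'rV[R]_3) : (forall x, differentiable g x) -> ~ loc_inj g 0 ->
  A_equiv G p (@cuspidal_edge_model R) 0 -> ~ A_equiv G p g 0.
Proof.
move=> dg gI /(germ (@edge_diff R)) [phi [psi [ O [ O2 [H _]]]]] /(germ dg) [phi' [psi' [ O' [ O2' [H' _]]]]].
by apply: gI; apply/(germ_equiv_loc_inj H')/(germ_equiv_loc_inj H); exact: edge_loc_inj.
Qed.

End SurfaceNegative.

(** * The cuspidal edges *)

Section Taylor3.
Variable R : realType.

Lemma small_integrate (f f' : R -> R) k : f 0 = 0 ->
  (\forall t \near (0 : R), is_derive t (1 : R) f (f' t)) ->
  (forall e, 0 < e -> \forall t \near (0 : R), `|f' t| <= e * `|t| ^+ k) ->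
  forall e, 0 < e -> \forall t \near (0 : R), `|f t| <= e * `|t| ^+ k.+1.
Proof.
move=> f0 Df Hf e e0; have /nbhs_ballP [r /= r0 Hr] := near_and Df (Hf e e0).
apply/nbhs_ballP; exists r => //= t; rewrite /ball /= sub0r normrN => tr.
have {}Hr (a : R) : `|a| <= `|t| -> is_derive a (1 : R) f (f' a) /\ `|f' a| <= e * `|a| ^+ k.
  by move=> ta; apply: Hr; rewrite /ball /= sub0r normrN (le_lt_trans ta).
have [a ta|a ta] := @MVT_line R R f 0 1 t.
  by have [[]] := Hr _ ta; rewrite add0r [_ *: 1]mulr1.
rewrite !add0r ![_ *: 1]mulr1 f0 subr0; have [[_ ->] h] := Hr _ ta => ->.
rewrite normrM exprS mulrCA ler_wpM2l //; apply: (le_trans h).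
by rewrite ler_wpM2l ?(ltW e0) // lerXn2r // nnegrE.
Qed.

Lemma taylor3 (f f1 f2 : R -> R) (d3 : R) :
  (\forall t \near (0 : R), is_derive t (1 : R) f (f1 t)) ->
  (\forall t \near (0 : R), is_derive t (1 : R) f1 (f2 t)) ->
  is_derive (0 : R) (1 : R) f2 d3 -> f1 0 = 0 ->
  o3 (fun t => f t - f 0 - (t ^+ 2 * (f2 0 / 2) + t ^+ 3 * (d3 / 6))).
Proof.
move=> D1 D2 D3 f10.
have Dm (a : R) (t : R) := is_derive_mul (is_derive_cst a t (1 : R)) (is_derive_id t (1 : R)).
have Dm2 (a : R) (t : R) := is_derive_mul (Dm a t) (is_derive_id t (1 : R)).
have Dm3 (a : R) (t : R) := is_derive_mul (Dm2 a t) (is_derive_id t (1 : R)).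
pose g2 (t : R) := f2 t - f2 0 - d3 * t.
pose g1 (t : R) := f1 t - f2 0 * t - d3 / 2 * t * t.
pose g0 (t : R) := f t - f 0 - f2 0 / 2 * t * t - d3 / 6 * t * t * t.
have E2 : is_derive (0 : R) (1 : R) g2 0.
  have D := is_deriveB (is_deriveB D3 (is_derive_cst (f2 0) (0 : R) (1 : R))) (Dm d3 0).
  by apply: is_derive_eq D _; rewrite /cst /=; ring.
have s2 : forall e, 0 < e -> \forall t \near (0 : R), `|g2 t| <= e * `|t| ^+ 1.
  move=> e e0; apply: small_of_derive0 => //; rewrite /g2; ring.
have E1 : \forall t \near (0 : R), is_derive t (1 : R) g1 (g2 t).
  apply: near0_imp D2 => t D2.
  have D := is_deriveB (is_deriveB D2 (Dm (f2 0) t)) (Dm2 (d3 / 2) t).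
  by apply: is_derive_eq D _; rewrite /g2 /cst /=; field.
have s1 := small_integrate _ E1 s2.
have E0 : \forall t \near (0 : R), is_derive t (1 : R) g0 (g1 t).
  apply: near0_imp D1 => t D1.
  have D := is_deriveB (is_deriveB (is_deriveB D1 (is_derive_cst (f 0) t (1 : R))) (Dm2 (f2 0 / 2) t)) (Dm3 (d3 / 6) t).
  by apply: is_derive_eq D _; rewrite /g1 /cst /=; field.
have s0 := small_integrate _ E0 (s1 _).
have := s0 _ _; rewrite /g0 /g1 f10 subrr !mulr0 !subr0 => /(_ erefl erefl) s.
by apply: eq_o3 s => t; ring.
Qed.

(** Because r and q vanish at 0, the second derivative of f involves only r', q' and the third only
    r'', q'' and the mixed products; second derivatives of x and y drop out. *)
Lemma taylor3_bilinear (J : set R) (f r q x y : R -> R) : open J -> J 0 ->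
  Sm J r -> Sm J q -> Sm J x -> Sm J y -> r 0 = 0 -> q 0 = 0 ->
  (forall t, J t -> is_derive t (1 : R) f (r t * x t + q t * y t)) ->
  o3 (fun t => f t - f 0 - (t ^+ 2 * ((derive1 r 0 * x 0 + derive1 q 0 * y 0) / 2) +
    t ^+ 3 * ((derive1 (derive1 r) 0 * x 0 + 2 * derive1 r 0 * derive1 x 0 +
      derive1 (derive1 q) 0 * y 0 + 2 * derive1 q 0 * derive1 y 0) / 6))).
Proof.
move=> oJ J0 Sr Sq Sx Sy r0 q0 D.
have nJ : \forall t \near (0 : R), J t := open_nbhs_nbhs (conj oJ J0).
pose f2 t := derive1 r t * x t + r t * derive1 x t + (derive1 q t * y t + q t * derive1 y t).
have Dm (a b : R -> R) t : Sm J a -> Sm J b -> J t -> is_derive t (1 : R) (fun t => a t * b t) (derive1 a t * b t + a t * derive1 b t).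
  by move=> Sa Sb Jt; exact: (is_derive_mul (Sm_is_derive Sa Jt) (Sm_is_derive Sb Jt)).
have Dr := Sm_derive1 Sr; have Dq := Sm_derive1 Sq; have Dx := Sm_derive1 Sx; have Dy := Sm_derive1 Sy.
have H1 : \forall t \near (0 : R), is_derive t (1 : R) f (r t * x t + q t * y t) by apply: near0_imp D nJ.
have H2 : \forall t \near (0 : R), is_derive t (1 : R) (fun t => r t * x t + q t * y t) (f2 t).
  by apply: near0_imp nJ => t Jt; exact: (is_deriveD (Dm _ _ _ Sr Sx Jt) (Dm _ _ _ Sq Sy Jt)).
have H3 := is_deriveD (is_deriveD (Dm _ _ _ Dr Sx J0) (Dm _ _ _ Sr Dx J0)) (is_deriveD (Dm _ _ _ Dq Sy J0) (Dm _ _ _ Sq Dy J0)).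
have z : r 0 * x 0 + q 0 * y 0 = 0 by rewrite r0 q0; ring.
have f20 : derive1 r 0 * x 0 + derive1 q 0 * y 0 = f2 0 by rewrite /f2 r0 q0 !mul0r !addr0.
rewrite f20; apply: (taylor3 H1 H2 _ z); apply: is_derive_eq H3 _; rewrite r0 q0.
move: (derive1 (derive1 r) 0) (derive1 (derive1 q) 0) (derive1 (derive1 x) 0) (derive1 (derive1 y) 0).
move: (derive1 r 0) (derive1 q 0) (derive1 x 0) (derive1 y 0) (x 0) (y 0) => *; ring.
Qed.

End Taylor3.

Section Positive.
Variable R : realType.
Variables (I : set R) (E n P mu : R -> 'rV[R]_4) (N w : R -> R) (c s : R).
Hypothesis ff : focal_frame I E n P mu N w c s.
Variable p : 'rV[R]_2.
Hypothesis Ip : I (u_ p).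
Local Notation G := (@chartH R \o surf E n).
Local Notation D := (dom I).
Local Notation t0 := (u_ p).
Local Notation th0 := (v_ p).
Local Notation T := (vth E n).

Lemma Sm_mkR2 (U : normedModType R) (O : set U) (f1 f2 : U -> R) : open O ->
  Sm O f1 -> Sm O f2 -> Sm O (fun x => mkR2 (f1 x) (f2 x)).
Proof.
move=> oO S1 S2; apply/(Sm_vec oO) => -[[|[|//]] h].
- by apply: (Sm_eq oO _ S1) => x _; rewrite mxE.
- by apply: (Sm_eq oO _ S2) => x _; rewrite mxE.
Qed.

Lemma is_derive_mkR2 (U : normedModType R) (f1 f2 : U -> R) (x v : U) d1 d2 :
  is_derive x v f1 d1 -> is_derive x v f2 d2 -> is_derive x v (fun x => mkR2 (f1 x) (f2 x)) (mkR2 d1 d2).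
Proof.
move=> D1 D2; apply/is_derive_vec => -[[|[|//]] h].
- rewrite (_ : (fun t => _) = f1); first by rewrite mxE.
  by apply/funext => t; rewrite mxE.
- rewrite (_ : (fun t => _) = f2); first by rewrite mxE.
  by apply/funext => t; rewrite mxE.
Qed.

Lemma Sm_line (x v : 'rV[R]_2) : Sm setT (fun t : R => x + t *: v).
Proof.
have oT := @openT R.
apply: (Sm_add oT); first by move=> k; exact: Ck_cst.
apply: (Sm_scal oT) => k; last exact: Ck_cst.
have D (t : R) : [set: R] t -> is_derive t (1 : R) (fun t : R => t) 1 by move=> _; exact: is_derive_id.
exact: CkS (Ck_is_derive oT D (Ck_cst k setT (1 : R))).
Qed.

(** The null vector at p. The expansion is taken along the straight line in this fixed direction. *)
Let d : 'rV[R]_2 := mkR2 1 (N t0 * c).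
Let J : set R := [set t | I (t0 + t)].

Let line_u t : u_ (p + t *: d) = t0 + t.
Proof. by rewrite uD uZ u_mk mulr1. Qed.

Let oJ : open J.
Proof.
have -> : J = [set t | [set: R] t /\ D (p + t *: d)].
  by apply/seteqP; split=> t /=; rewrite /dom /J /= line_u // => -[].
apply: open_preimage; [exact: openT| |exact: (open_dom ff)].
by move=> t _; exact: (Ck_continuous (Sm_line p d 0%N)).
Qed.

Let J0 : J 0. Proof. by rewrite /J /= addr0. Qed.

Let Sm_on_line (h : 'rV[R]_2 -> R) : Sm D h -> Sm J (fun t => h (p + t *: d)).
Proof.
move=> Sh k; apply: (Ck_comp_rV1 oJ _ _ (Sh k)) => [t Jt|]; first by rewrite /dom /= line_u.
exact: Ck_subset (Sm_line p d k).
Qed.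

Let derive1_on_line (h : 'rV[R]_2 -> R) dh : Sm D h -> is_derive p d h dh -> derive1 (fun t => h (p + t *: d)) 0 = dh.
Proof.
move=> Sh [_ <-]; have dh' : differentiable h (p + (0 : R) *: d).
  by rewrite scale0r addr0; exact: (Sh 1%N).1.
by have [_] := is_derive_line dh'; rewrite derive1E => ->; rewrite scale0r addr0.
Qed.

(** The coefficients of T and P in the derivative of the surface along [d]. Both vanish at p; [rho]
    appears because the null direction varies while [d] stays fixed. *)
Let rho (x : 'rV[R]_2) := c * (N t0 - N (u_ x)).
Let kap (x : 'rV[R]_2) := - (s * (N (u_ x) * sinhR (v_ x))).
Let X i (x : 'rV[R]_2) := chartH (T x) 0 i.
Let Y i (x : 'rV[R]_2) := chartH (P (u_ x)) 0 i.

Let oD := open_dom ff.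
Let Sc : Sm setT (@coshR R). Proof. by have [] := @Sm_cosh_sinh R. Qed.
Let Ss : Sm setT (@sinhR R). Proof. by have [] := @Sm_cosh_sinh R. Qed.

Let SNu : Sm D (fun x => N (u_ x)).
Proof.
have Su : Sm D (@u_ R) by move=> k; apply: Ck_subset (@Sm_u R k).
by move=> k; exact: (Ck_comp_R oD _ (Su k) (ff_N ff k)).
Qed.

Let Srho : Sm D rho.
Proof.
apply: (SmM oD); first exact: SmC.
by apply: (SmD oD); [exact: SmC|apply: (SmN oD)].
Qed.

Let Skap : Sm D kap.
Proof.
apply: (SmN oD); apply: (SmM oD); first exact: SmC.
by apply: (SmM oD) => //; exact: (Sm_comp_v ff Ss).
Qed.

Let SX i : Sm D (X i).
Proof.
have ST : Sm D T.
  apply: (Sm_add oD); apply: (Sm_scal oD); [exact: (Sm_comp_v ff Ss)|exact: (Sm_comp_u ff (ff_E ff))|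
      exact: (Sm_comp_v ff Sc)|exact: (Sm_comp_u ff (ff_n ff))].
exact: ((Sm_vec oD _).1 (Sm_chartH oD ST) i).
Qed.

Let SY i : Sm D (Y i).
Proof. exact: ((Sm_vec oD _).1 (Sm_chartH oD (Sm_comp_u ff (ff_P ff))) i). Qed.

Hypothesis N0 : N t0 * sinhR th0 = 0.

Let dkap : is_derive p d kap (- (s * (derive1 N t0 * sinhR th0 + N t0 * (N t0 * c * coshR th0)))).
Proof.
have DN := is_derive_comp_R ((@Sm_u R 1%N).1 p Logic.I) (is_derive_u p d) (Sm_is_derive (ff_N ff) Ip).
have Ds := is_derive_comp_R ((@Sm_v R 1%N).1 p Logic.I) (is_derive_v p d) (is_derive_sinhR th0).
have DD := is_deriveN (is_derive_mul (is_derive_cst s p d) (is_derive_mul DN Ds)).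
by apply: is_derive_eq DD _; rewrite /d u_mk v_mk /cst /GRing.scale /=; ring.
Qed.

Let dX i : is_derive p d (X i) (chartH (- (s * N t0 * coshR th0) *: P t0) 0 i).
Proof.
have H := is_derive_hyp d (is_derive_sinhR th0) (is_derive_coshR th0) (ff_dE ff Ip) (ff_dn ff Ip).
have /is_derive_vec HX := is_derive_chartH H.
apply: is_derive_eq (HX i) _; congr (chartH _ 0 i); rewrite /d u_mk v_mk.
by move: (E _) (n _) (P _) => a b e; apply/rowP => j; rewrite !mxE; ring.
Qed.

Let dY i : is_derive p d (Y i) (chartH ((s * N t0 * coshR th0) *: T p + w t0 *: mu t0) 0 i).
Proof.
have H := is_derive_comp_R ((@Sm_u R 1%N).1 p Logic.I) (is_derive_u p d) (ff_dP ff Ip).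
have /is_derive_vec HX := is_derive_chartH H.
apply: is_derive_eq (HX i) _; congr (chartH _ 0 i); rewrite /d u_mk scale1r; congr (_ + _).
(* At p the product N sinh th vanishes, so s N cosh th T has no E part and its coefficient on n
   reduces to s N. *)
rewrite /vth scalerDr !scalerA.
have -> : s * N t0 * coshR th0 * sinhR th0 = 0.
  by rewrite -[RHS](mulr0 (s * coshR th0)) -N0; ring.
rewrite scale0r add0r; congr (_ *: _).
have h := cosh2_sinh2 th0; rewrite -[LHS]mulr1 -h.
transitivity (s * N t0 * coshR th0 ^+ 2 - s * (N t0 * sinhR th0) * sinhR th0); first ring.
by rewrite N0; ring.
Qed.

Let q1 := - (s * (derive1 N t0 * sinhR th0 + N t0 * (N t0 * c * coshR th0))).

(** In the basis T, P, mu the decisive coefficients are q1 / 2 on P at order two and q1 w / 3 on mu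
    at order three. The numbers r1, r2, q2 only enter above the diagonal of the resulting triangular
    system and are left unspecified. *)
Lemma surf_expansion : exists r1 r2 q2 : R, forall i,
  o3 (fun t => (G (p + t *: d) - G p) 0 i -
    (t ^+ 2 * (2^-1 *: chartH (r1 *: T p + q1 *: P t0)) 0 i +
     t ^+ 3 * (6^-1 *: chartH (r2 *: T p + (2 * r1) *: (- (s * N t0 * coshR th0) *: P t0) + q2 *: P t0
       + (2 * q1) *: ((s * N t0 * coshR th0) *: T p + w t0 *: mu t0))) 0 i)).
Proof.
pose r (t : R) := rho (p + t *: d); pose q (t : R) := kap (p + t *: d).
exists (derive1 r 0), (derive1 (derive1 r) 0), (derive1 (derive1 q) 0) => i.
have r0 : r 0 = 0 by rewrite /r /rho scale0r addr0 subrr mulr0.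
have q0 : q 0 = 0 by rewrite /q /kap scale0r addr0 N0 mulr0 oppr0.
have Df t : J t -> is_derive t (1 : R) (fun t => G (p + t *: d) 0 i) (r t * X i (p + t *: d) + q t * Y i (p + t *: d)).
  move=> Jt; have Dt : D (p + t *: d) by rewrite /dom /= line_u.
  have /is_derive_vec H := is_derive_line ((Sm_G ff 1%N).1 _ Dt).
  apply: is_derive_eq (H i) _; rewrite (derive_G ff _ Dt) /d u_mk v_mk -/d.
  transitivity (chartH (r t *: T (p + t *: d) + q t *: P (u_ (p + t *: d))) 0 i); last first.
    by rewrite chartHD !chartHZ /X /Y; move: (chartH _) (chartH _) => a b; rewrite !mxE.
  congr (chartH _ 0 i); rewrite /r /q /rho /kap /ntg.
  by move: (T _) (P _) => a b; apply/rowP => j; rewrite !mxE; ring.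
have := taylor3_bilinear oJ J0 (Sm_on_line Srho) (Sm_on_line Skap) (Sm_on_line (SX i)) (Sm_on_line (SY i)) r0 q0 Df.
rewrite (derive1_on_line (SX i) (dX i)) (derive1_on_line (SY i) (dY i)) (derive1_on_line Skap dkap) -/q1 -/r -/q.
rewrite !scale0r !addr0; apply: eq_o3 => t.
rewrite /X /Y; move: (T p) (P t0) (mu t0) => a b e; rewrite !(chartHD, chartHZ).
move: (derive1 r 0) (derive1 (derive1 r) 0) (derive1 (derive1 q) 0) => x1 x2 x3.
move: (G (p + t *: d)) (G p) (chartH a) (chartH b) (chartH e) => y1 y2 {}a {}b {}e.
by rewrite !mxE; field.
Qed.

(** (al, be) directs a line of singular points through p. [ab] says that it is transverse to the
    null direction, and [q10] that N sinh th has a nonzero derivative along the null direction. *)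
Variables al be : R.
Hypothesis N0' : forall u, I (t0 + al * u) -> N (t0 + al * u) * sinhR (th0 + be * u) = 0.
Hypothesis ab : be - al * N t0 * c != 0.
Hypothesis q10 : derive1 N t0 * sinhR th0 + N t0 * (N t0 * c * coshR th0) != 0.

(* The singular set becomes [v = 0] and the null direction [d/dv]. *)
Let chi (x : 'rV[R]_2) : 'rV[R]_2 :=
  mkR2 (t0 + al * u_ x + v_ x) (th0 + be * u_ x + c * N (t0 + al * u_ x) * v_ x).
Let O : set 'rV[R]_2 := [set x | I (t0 + al * u_ x) /\ I (t0 + al * u_ x + v_ x)].

Let Sm_aff (a b : R) : Sm setT (fun x : 'rV[R]_2 => a + b * u_ x).
Proof.
have oT := @openT 'rV[R]_2.
apply: (SmD oT); first exact: SmC.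
by apply: (SmM oT); [exact: SmC|exact: Sm_u].
Qed.

Let oO : open O.
Proof.
have oT := @openT 'rV[R]_2.
have o1 : open [set x : 'rV[R]_2 | [set: 'rV[R]_2] x /\ I (t0 + al * u_ x)].
  apply: open_preimage => //; last exact: (ff_open ff).
  by move=> x _; exact: (Ck_continuous (Sm_aff t0 al 0%N)).
have -> : O = [set x | [set x : 'rV[R]_2 | [set: 'rV[R]_2] x /\ I (t0 + al * u_ x)] x /\ I (t0 + al * u_ x + v_ x)].
  by apply/seteqP; split=> x /=; [move=> []|move=> [[]]].
apply: open_preimage => //; last exact: (ff_open ff).
move=> x _; have S := SmD oT (Sm_aff t0 al) (@Sm_v R).
exact: (Ck_continuous (S 0%N)).
Qed.

Let SNal : Sm O (fun x => N (t0 + al * u_ x)).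
Proof.
have Su : Sm O (fun x : 'rV[R]_2 => t0 + al * u_ x) by move=> k; apply: Ck_subset (Sm_aff t0 al k).
move=> k; apply: (Ck_comp_R oO _ (Su k) (ff_N ff k)) => x [].
by [].
Qed.

Let Schi : Sm O chi.
Proof.
have sub (f : 'rV[R]_2 -> R) : Sm setT f -> Sm O f by move=> Sf k; apply: Ck_subset (Sf k).
apply: (Sm_mkR2 oO); apply: (SmD oO); try (apply: sub; (exact: Sm_aff || exact: Sm_v)).
apply: (SmM oO); last by apply: sub; exact: Sm_v.
by apply: (SmM oO) => //; exact: SmC.
Qed.

Let chi_D x : O x -> D (chi x). Proof. by move=> [_ h]; rewrite /dom /= u_mk. Qed.
Let O0 : O 0. Proof. by split; rewrite u_0 ?v_0 mulr0 ?addr0. Qed.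
Let chi0 : chi 0 = p.
Proof. by apply: uv_inj; rewrite ?u_mk ?v_mk u_0 v_0 !mulr0 !addr0. Qed.

Let dchi u v : O (mkR2 u 0) -> 'D_v chi (mkR2 u 0) = mkR2 (al * u_ v + v_ v) (be * u_ v + c * N (t0 + al * u) * v_ v).
Proof.
move=> Ou; set x := mkR2 u 0.
have Da (a b : R) : is_derive x v (fun x => a + b * u_ x) (b * u_ v).
  have DD := is_deriveD (is_derive_cst a x v) (is_derive_mul (is_derive_cst b x v) (is_derive_u x v)).
  by apply: is_derive_eq DD _; rewrite /cst; ring.
have DN : is_derive x v (fun x => N (t0 + al * u_ x)) ('D_v (fun x => N (t0 + al * u_ x)) x).
  by apply: DeriveDef => //; apply: diff_derivable; exact: (SNal 1%N).1.
have D1 := is_deriveD (Da t0 al) (is_derive_v x v).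
have D2 := is_deriveD (Da th0 be) (is_derive_mul (is_derive_mul (is_derive_cst c x v) DN) (is_derive_v x v)).
have [_ ->] := is_derive_mkR2 D1 D2.
congr mkR2; rewrite /x v_mk u_mk /cst mulr0 add0r //.
Qed.

Let dchi0 v : 'D_v chi 0 = mkR2 (al * u_ v + v_ v) (be * u_ v + c * N t0 * v_ v).
Proof. by have := @dchi 0 v; rewrite mkR2_00 mulr0 addr0; apply. Qed.

Theorem surf_edge : A_equiv G p (@cuspidal_edge_model R) 0.
Proof.
have Dchi : diffeo_germ chi 0 p.
  rewrite -[X in diffeo_germ _ _ X]chi0; apply: (inverse_function oO O0 Schi) => v.
  rewrite dchi0 => e.
  have e1 : al * u_ v + v_ v = 0 by rewrite -[LHS](u_mk _ (be * u_ v + c * N t0 * v_ v)) e u_0.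
  have e2 : be * u_ v + c * N t0 * v_ v = 0 by rewrite -[LHS](v_mk (al * u_ v + v_ v)) e v_0.
  have /eqP : (be - al * N t0 * c) * u_ v = 0.
    transitivity (be * u_ v + c * N t0 * v_ v - c * N t0 * (al * u_ v + v_ v)); first ring.
    by rewrite e1 e2; ring.
  rewrite mulf_eq0 (negbTE ab) /= => /eqP uv.
  by apply: uv_inj; rewrite ?u_0 ?v_0 //; move: e1; rewrite uv mulr0 add0r.
apply: (A_equiv_source Dchi).
have [r1 [r2 [q2 Hexp]]] := surf_expansion.
have diffG x : D x -> differentiable G x by move=> Dx; exact: (Sm_G ff 1%N).1.
have diffchi x : O x -> differentiable chi x by move=> Ox; exact: (Schi 1%N).1.
apply: (edge_criterion oO O0 (K := G \o chi) (a := 2^-1 *: chartH (r1 *: T p + q1 *: P t0))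
  (b := 6^-1 *: chartH (r2 *: T p + (2 * r1) *: (- (s * N t0 * coshR th0) *: P t0) + q2 *: P t0
       + (2 * q1) *: ((s * N t0 * coshR th0) *: T p + w t0 *: mu t0)))).
- by move=> k; exact: (Ck_comp_rV oO oD chi_D (Schi k) (Sm_G ff k)).
- move=> u Ou; rewrite (derive_comp_rV _ (diffchi _ Ou) (diffG _ (chi_D Ou))) dchi //.
  rewrite -e2_2E u_e2 v_e2; apply/(derive_G_eq0 ff _ (chi_D Ou)).
  rewrite !u_mk !v_mk !mulr0 !addr0 !mulr1 !add0r !mul1r; split; first by rewrite mulrC.
  by rewrite u_mk; apply: N0'; case: Ou; rewrite u_mk.
- move=> i; apply: eq_o3 (Hexp i) => t /=; rewrite chi0.
  (* The v-axis is sent to the line in direction [d], for which the expansion is known. *)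
  have -> : chi (mkR2 0 t) = p + t *: d.
    by apply: uv_inj; rewrite /chi /d ?uD ?vD ?uZ ?vZ !(u_mk, v_mk) !mulr0 !addr0 ?mulr1 //; ring.
  by [].
- move=> x y z; rewrite (derive_comp_rV _ (diffchi _ O0) (diffG _ (chi_D O0))).
  rewrite dchi0 -e2_1E u_e1 v_e1 !mulr0 !addr0 !mulr1 chi0 (derive_G ff _ Ip) u_mk v_mk => H.
  (* In the basis T, P, mu the vectors K_u, a, b are triangular with diagonal be - al N c, q1 / 2
     and q1 w / 3; K_u has no P part since N sinh th vanishes at p. *)
  have {H} : chartH ((x * (be - al * N t0 * c) + y / 2 * r1 + z / 6 * (r2 + 2 * q1 * (s * N t0 * coshR th0))) *: T p
     + (y / 2 * q1 + z / 6 * (q2 - 2 * r1 * (s * N t0 * coshR th0))) *: P t0 + (z / 3 * q1 * w t0) *: mu t0) = 0.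
    rewrite -[RHS]H -!chartHZ -!chartHD; congr chartH; rewrite /ntg.
    have -> : be *: T p - (al * N t0) *: (c *: T p + (s * sinhR th0) *: P t0) = (be - al * N t0 * c) *: T p.
      transitivity ((be - al * N t0 * c) *: T p - (al * s * (N t0 * sinhR th0)) *: P t0).
        by move: (T _) (P _) => a b; apply/rowP => j; rewrite !mxE; ring.
      by rewrite N0 mulr0 scale0r subr0.
    by move: (T _) (P _) (mu _) => a b e; apply/rowP => j; rewrite !mxE; field.
  have q1' : q1 != 0 by rewrite oppr_eq0 mulf_neq0 // gt_eqF // (ff_s ff).
  move=> /(chart_inj (surf_frame ff Ip)) [h1 h2 /eqP].
  rewrite mulf_eq0 (negbTE (ff_w0 ff Ip)) orbF mulf_eq0 (negbTE q1') orbF mulf_eq0 invr_eq0 pnatr_eq0 orbF => /eqP z0.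
  move: h2 => /eqP; rewrite z0 mul0r mul0r addr0 mulf_eq0 (negbTE q1') orbF mulf_eq0 invr_eq0 pnatr_eq0 orbF => /eqP y0.
  move: h1 => /eqP; rewrite z0 y0 !mul0r !addr0 mulf_eq0 (negbTE ab) orbF => /eqP x0.
  by split.
Qed.

End Positive.

Theorem mainTheorem13 (R : realType) (I : set R) (g v1 v2 : R -> 'rV[R]_4)
  (p0 : 'rV[R]_2) :
  open I -> is_interval I -> I !=set0 ->
  hyperbolic_framed_curve I g v1 v2 ->
  (forall t, I t -> a_ g v1 v2 t ^+ 2 + b_ g v1 v2 t ^+ 2 != 0) ->
  (forall t, I t -> bigA g v1 v2 t ^+ 2 > bigM g v1 v2 t ^+ 2) ->
  (forall t, I t -> bigM g v1 v2 t * derive1 (bigA g v1 v2) t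
                    - derive1 (bigM g v1 v2) t * bigA g v1 v2 t = 0) ->
  I (cr p0 0) ->
  singular_point (focal_h g v1 v2) p0 ->
  let t0 := cr p0 0 in let th0 := cr p0 1 in
  let F := focal_h g v1 v2 in
  (bigN g v1 v2 t0 != 0 ->
     (germ_type (@cuspidal_edge_model R) F p0 <-> bigM g v1 v2 t0 != 0) /\
     ~ germ_type (@swallowtail_model R) F p0 /\
     ~ germ_type (@cuspidal_crosscap_model R) F p0) /\
  (bigN g v1 v2 t0 = 0 ->
     (germ_type (@cuspidal_edge_model R) F p0 <->
        th0 != 0 /\ derive1 (ANsq g v1 v2) t0 != 0) /\
     ~ germ_type (@cuspidal_beaks_model R) F p0 /\
     ~ germ_type (@cuspidal_lips_model R) F p0 /\
     ~ germ_type (@swallowtail_model R) F p0 /\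
     ~ germ_type (@cuspidal_crosscap_model R) F p0).
Proof.
move=> oI iI I0 hfc hab hAM hMA It0 sing t0 th0 F.
have [E [n [P [mu [N [w [c [s [ff FE NE Mc AN]]]]]]]]] := focal_frame_exists iI I0 hfc hab hAM hMA.
have oD := open_dom ff.
have FS x : dom I x -> F x = surf E n x by exact: FE.
(* The formula in the adapted frame holds only over I, so the two surfaces are compared as germs. *)
have GT model : germ_type model F p0 <-> A_equiv (@chartH R \o surf E n) p0 model 0.
  have H x : dom I x -> (@chartH R \o F) x = (@chartH R \o surf E n) x by move=> /FS /= ->.
  have E1 : \forall x \near p0, (@chartH R \o F) x = (@chartH R \o surf E n) x := near_open oD It0 H.
  have E2 : \forall x \near p0, (@chartH R \o surf E n) x = (@chartH R \o F) x.
    by apply: filterS E1 => x ->.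
  by split; [exact: (A_equiv_congr E1)|exact: (A_equiv_congr E2)].
have Nsinh : N t0 * sinhR th0 = 0.
  apply: (surf_singular ff It0); case: sing => c1 [c2 [c0 e]]; exists c1, c2; split; first exact: c0.
  have dE v : 'D_v (surf E n) p0 = 'D_v F p0.
    by apply: (@derive_eq_on _ _ _ (dom I) (surf E n) F p0 v oD It0) => y /FS ->.
  by rewrite (dE (e2_1 R)) (dE (e2_2 R)) e.
rewrite (NE _ It0) -[cr p0 0]/t0; split=> [N0|N0].
  have th00 : th0 = 0.
    by move: Nsinh => /eqP; rewrite mulf_eq0 (negbTE N0) sinhR_eq0 => /eqP.
  (* Near p0 the singular set is the line th = 0, hence al = 1 and be = 0; it is transverse to the
     null direction because c N does not vanish. *)
  have edge : c != 0 -> A_equiv (@chartH R \o surf E n) p0 (@cuspidal_edge_model R) 0.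
    move=> c0; apply: (surf_edge ff It0 Nsinh (al := 1) (be := 0)) => //.
    - by move=> u _; rewrite -[v_ p0]/th0 th00 mul0r addr0 sinhR0 mulr0.
    - by rewrite sub0r oppr_eq0 mul1r mulf_neq0.
    - by rewrite -[v_ p0]/th0 th00 sinhR0 mulr0 add0r !mulf_neq0 // gt_eqF // coshR_gt0.
  (* If c = 0, the line th = 0 collapses to a point; if not, p0 is a cuspidal edge, which is locally
     injective unlike g'. *)
  have no g' : (forall x, differentiable g' x) -> (forall x, g' x = g' 0 -> x = 0) -> ~ loc_inj g' 0 ->
      ~ germ_type g' F p0.
    move=> dg g0 gi /GT A; have [c0|c0] := eqVneq c 0.
      exact: (surf_cone_not ff It0 dg g0 c0 th00).
    exact: (edge_excludes ff It0 dg gi (edge c0)).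
  split; last split.
  - split=> [/GT A|M0]; last by apply/GT/edge; apply: contra_neq M0 => /(Mc _ It0).
    apply/eqP => /(Mc _ It0) c0.
    exact: (surf_cone_not ff It0 (@edge_diff R) (@edge_fib0 R) c0 th00).
  - exact: no (@swallowtail_diff R) (@swallowtail_fib0 R) (@swallowtail_not_loc_inj R).
  - exact: no (@crosscap_diff R) (@crosscap_fib0 R) (@crosscap_not_loc_inj R).
(* Now the line t = t0 is singular, hence al = 0 and be = 1. The null direction at p0 is d/dt, and
   the derivative of N sinh th along it is N' sinh th0. *)
have edge : th0 != 0 -> derive1 N t0 != 0 -> A_equiv (@chartH R \o surf E n) p0 (@cuspidal_edge_model R) 0.
  move=> th0' N1; apply: (surf_edge ff It0 Nsinh (al := 0) (be := 1)) => //.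
  - by move=> u _; rewrite mul0r addr0 -[u_ p0]/t0 N0 mul0r.
  - by rewrite !mul0r subr0 oner_neq0.
  - by rewrite -[u_ p0]/t0 N0 !mul0r addr0 mulf_neq0 // sinhR_eq0.
split; last split; last split; last split.
- split=> [/GT A|[h1 h2]]; last by apply/GT/edge => //; apply: contra_neq h2 => /(AN _ It0 N0).
  split; first by apply/eqP => h; exact: (surf_th0_not_edge ff It0 N0 h A).
  by apply/eqP => /(AN _ It0 N0) h; exact: (surf_flat_not_edge ff It0 N0 h A).
- move=> /GT A; have [h|h] := eqVneq th0 0; first exact: (surf_th0_not_beaks ff It0 N0 h A).
  exact: (surf_not_beaks_th ff It0 h A).
- by move=> /GT; exact: (surf_not_lips ff It0 N0).
- by move=> /GT; exact: (surf_not_swallowtail ff It0 N0).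
- move=> /GT A; have [h|h] := eqVneq th0 0; first exact: (surf_th0_not_crosscap ff It0 N0 h A).
  have [N1|N1] := eqVneq (derive1 N t0) 0; first exact: (surf_flat_not_crosscap ff It0 N0 N1 A).
  exact: (edge_excludes ff It0 (@crosscap_diff R) (@crosscap_not_loc_inj R) (edge h N1) A).
Qed.
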